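(* Suppose assumptions (A1)–(A3) of the context hold, and moreover $\mathrm{Real}(\lambda)<-1$ for every eigenvalue $\lambda$ of $A$. Then, for the linear recursion $\tilde\theta_{n+1}=\tilde\theta_n+\alpha_{n+1}[A\tilde\theta_n+\Delta_{n+1}]$, $$\mathrm{Cov}(\theta_n)=n^{-1}\Sigma_\theta+n^{-2}\Sigma_{\theta,2}+O(n^{-2-\delta}),$$ where $\delta=\delta(I+A,\Sigma_\Delta)>0$, $\Sigma_\theta\ge0$ is the solution of $[\tfrac12 I+A]\Sigma+\Sigma[\tfrac12 I+A]^{\top}+\Sigma_\Delta=0$, $$\Sigma_{\theta,2}=\Sigma_\sharp+\Sigma_Z-\mathsf E_\pi[\Delta_n^m\widehat Z_n^{\top}]-\mathsf E_\pi[\widehat Z_n(\Delta_n^m)^{\top}],$$ and $\Sigma_\sharp$ is the unique solution to the Lyapunov equation $$[I+A]\bigl[\Sigma-\mathrm{Cov}_\pi(\widehat\Delta_n^m,\Delta_n^m)\bigr]+\bigl[\Sigma-\mathrm{Cov}_\pi(\Delta_n^m,\widehat\Delta_n^m)\bigr][I+A]^{\top}+A\Sigma_\theta A^{\top}-\Sigma_\Delta=0 .$$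
   Context: Let $\mathsf Z$ be a Polish space and $V:\mathsf Z\to[1,\infty)$ a measurable function. For measurable $g:\mathsf Z\to\mathbb R$ put $\|g\|_V=\sup_{z}|g(z)|/V(z)$, and let $L_\infty^V$ be the set of measurable $g$ with $\|g\|_V<\infty$. (A1) $\{\Phi_n\}_{n\ge0}$ is a time-homogeneous Markov chain on $\mathsf Z$ that is $V$-uniformly ergodic with unique invariant measure $\pi$: there are $\rho\in(0,1)$ and $B_V<\infty$ such that for all $g\in L_\infty^V$, $z\in\mathsf Z$, $n\ge 0$, $|\mathsf E[g(\Phi_n)\mid\Phi_0=z]-\pi(g)|\le B_V\|g\|_V\rho^nV(z)$. (A2) $A$ is a real $d\times d$ Hurwitz matrix, and $\alpha_n=1/n$ for $n\ge1$. (A3) $f^*:\mathsf Z\to\mathbb R^d$ is measurable with $\|(f_i^* )^2\|_V<\infty$ and $\pi(f_i^* )=0$ for each $i$. Put $\Delta_n=f^*(\Phi_n)$ and $\Sigma_\Delta=\sum_{k=-\infty}^{\infty}\mathsf E_\pi[\Delta_k\Delta_0^{\top}]$, where $\mathsf E_\pi$ is expectation for the (two-sided) stationary version of the chain. The initial condition $(\Phi_0,\tilde\theta_0)$ is fixed, and $\mathrm{Cov}(\theta_n)=\mathsf E[\tilde\theta_n\tilde\theta_n^{\top}]$. $\mathcal F_n$ is the $\sigma$-algebra generated by $\Phi_0,\dots,\Phi_n$. $\hat f:\mathsf Z\to\mathbb R^d$ is the $\pi$-mean-zero solution of Poisson's equation $\mathsf E[\hat f(\Phi_{k+1})\mid\Phi_k=z]=\hat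 f(z)-f^*(z)$ (with $\hat f_i^2\in L_\infty^V$), and $\hat{\hat f}:\mathsf Z\to\mathbb R^d$ is the $\pi$-mean-zero solution of the second Poisson equation $\mathsf E[\hat{\hat f}(\Phi_{k+1})\mid\Phi_k=z]=\hat{\hat f}(z)-\hat f(z)$ (with $\hat{\hat f}_i^{\,2}\in L_\infty^V$). Set $Z_n=\hat f(\Phi_n)$, $\Delta_{n+1}^m=Z_{n+1}-\mathsf E[Z_{n+1}\mid\mathcal F_n]$, $\widehat Z_n=\hat{\hat f}(\Phi_n)$, $\widehat\Delta_{n+1}^m=\widehat Z_{n+1}-\mathsf E[\widehat Z_{n+1}\mid\mathcal F_n]$, $\Sigma_Z=\mathsf E_\pi[Z_nZ_n^{\top}]$, and $\mathrm{Cov}_\pi(X,Y)=\mathsf E_\pi[XY^{\top}]$; steady-state expectations do not depend on $n$. *)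

(* Defs.v *)
From HB Require Import structures.
From mathcomp Require Import all_boot all_order all_algebra.
From mathcomp Require Import all_classical all_reals all_analysis.
From mathcomp Require Import complex.

Set Implicit Arguments.
Unset Strict Implicit.
Unset Printing Implicit Defensive.

Import Order.TTheory GRing.Theory Num.Theory.
Import numFieldNormedType.Exports.

Local Open Scope classical_set_scope.
Local Open Scope ring_scope.

(* A complete pseudometric structure whose topology is Hausdorff is a complete
   metric one up to equivalence, so this says that the topology of T is
   separable and completely metrizable. *)
Definition polish (R : realType) (T : completePseudoMetricType R) : Prop :=
  hausdorff_space T /\ exists2 D : set T, countable D & dense D.

Notation borel T := (g_sigma_algebraType (@open T)).

Section Matrices.
Context {R : realType}.

Definition eigenvalue_C d (A : 'M[R]_d) (l : R[i]) : Prop :=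
  eigenvalue (map_mx (real_complex R) A) l.

Definition hurwitz d (A : 'M[R]_d) : Prop :=
  forall l : R[i], eigenvalue_C A l -> complex.Re l < 0.

Definition psd d (S : 'M[R]_d) : Prop :=
  S^T = S /\ forall x : 'cV[R]_d, 0 <= (x^T *m S *m x) 0 0.

End Matrices.

Section Expectation.
Context {R : realType} {dO : measure_display} {Omega : measurableType dO}.
Variable P : probability Omega R.

Definition expect_mx m n (M : Omega -> 'M[R]_(m, n)) : 'M[R]_(m, n) :=
  \matrix_(i, j) fine ('E_P[fun w => M w i j])%E.

Definition cross_moment d (X Y : Omega -> 'cV[R]_d) : 'M[R]_d :=
  expect_mx (fun w => X w *m (Y w)^T).

(* Y is a version of E[X | G], componentwise *)
Definition cond_expect d (G : set (set Omega)) (X Y : Omega -> 'cV[R]_d) :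
    Prop :=
  forall i : 'I_d,
    [/\ forall B : set R, measurable B -> G ((fun w => Y w i 0) @^-1` B),
        P.-integrable setT (fun w => (Y w i 0)%:E) &
        forall A, G A ->
          (\int[P]_(w in A) (Y w i 0)%:E = \int[P]_(w in A) (X w i 0)%:E)%E].

(* D is a version of X - E[X | G] *)
Definition innovation d (G : set (set Omega)) (X D : Omega -> 'cV[R]_d) :
    Prop :=
  exists2 Y, cond_expect G X Y & forall w, D w = X w - Y w.

End Expectation.

Section Ergodicity.
Context {R : realType} {dZ : measure_display} {Z : measurableType dZ}.
Implicit Types (V g : Z -> R) (K : R.-pker Z ~> Z) (pi : probability Z R).

Definition Vnorm V g : \bar R :=
  ereal_sup [set (`|g z| / V z)%:E | z in [set: Z]].

Definition LinftyV V g : Prop :=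
  measurable_fun setT g /\ (Vnorm V g < +oo)%E.

(* n-step transition kernel; the composition law forces the codomain to be the
   subprobability kernels *)
Fixpoint kstep K (n : nat) : R.-spker Z ~> Z :=
  if n is m.+1 then mkcomp_noparam (kstep K m) K
  else kdirac (@measurable_id _ Z setT).

Definition invariant K pi : Prop :=
  forall B, measurable B -> (\int[pi]_z K z B = pi B)%E.

(* In \bar R the value of |x - y| is +oo as soon as x or y is infinite, so the
   bound includes the integrability of g under pi and under every K^n(z, .). *)
Definition V_uniformly_ergodic V K pi : Prop :=
  exists rho B : R, 0 < rho < 1 /\
    forall g, LinftyV V g -> forall (z : Z) (n : nat),
      (`| \int[kstep K n z]_y (g y)%:E - \int[pi]_y (g y)%:E |
         <= B%:E * Vnorm V g * (rho ^+ n * V z)%:E)%E.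

Definition unique_invariant K pi : Prop :=
  invariant K pi /\
  forall mu : probability Z R, invariant K mu ->
    forall B, measurable B -> mu B = pi B.

Definition square_LinftyV d V (f : Z -> 'cV[R]_d) : Prop :=
  forall i : 'I_d, measurable_fun setT (fun z => f z i 0) /\
                   LinftyV V (fun z => f z i 0 ^+ 2).

Definition mean_zero d pi (f : Z -> 'cV[R]_d) : Prop :=
  forall i : 'I_d, (\int[pi]_z (f z i 0)%:E = 0)%E.

(* g is the pi-mean-zero solution of Poisson's equation with forcing f *)
Definition poisson_solution d V K pi (f g : Z -> 'cV[R]_d) : Prop :=
  [/\ square_LinftyV V g, mean_zero pi g &
      forall z (i : 'I_d),
        (\int[K z]_y (g y i 0)%:E = (g z i 0 - f z i 0)%:E)%E].

End Ergodicity.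

Section Chains.
Context {R : realType} {dO : measure_display} {Omega : measurableType dO}.
Context {dZ : measure_display} {Z : measurableType dZ}.
Implicit Types (P : probability Omega R) (K : R.-pker Z ~> Z).

(* sigma-algebra generated by the X i, for i in D *)
Definition history (I : Type) (X : I -> Omega -> Z) (D : set I) :
    set (set Omega) :=
  <<s \bigcup_(i in D) preimage_set_system setT (X i) measurable >>.

(* the conditional law of Y given G is K(X, .) *)
Definition transition P (G : set (set Omega)) K (X Y : Omega -> Z) : Prop :=
  forall A B, G A -> measurable B ->
    P (A `&` Y @^-1` B) = (\int[P]_(w in A) K (X w) B)%E.

Definition markov_chain P K (Phi : nat -> Omega -> Z) : Prop :=
  (forall n, measurable_fun setT (Phi n)) /\
  forall n, transition P (history Phi [set k | (k <= n)%N]) K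
              (Phi n) (Phi n.+1).

(* Marginals equal to pi together with the Markov property determine the joint
   law and make it shift-invariant. *)
Definition stationary_chain P K (pi : probability Z R)
    (Psi : int -> Omega -> Z) : Prop :=
  [/\ forall n, measurable_fun setT (Psi n),
      forall n B, measurable B -> P (Psi n @^-1` B) = pi B &
      forall n, transition P (history Psi [set k | k <= n]) K
                  (Psi n) (Psi (n + 1))].

(* sum over k in Z of E_pi[f(Psi_k) f(Psi_0)^T], entrywise as the sum over
   k >= 0 plus the sum over k <= -1; limn is a total operator, and both series
   converge for a V-uniformly ergodic chain with square_LinftyV V f and
   mean_zero pi f *)
Definition Sigma_Delta d P (Psi : int -> Omega -> Z) (f : Z -> 'cV[R]_d) :
    'M[R]_d :=
  let C (k : int) := cross_moment P (f \o Psi k) (f \o Psi 0) in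
  \matrix_(i, j) (limn (series (fun k : nat => C k%:Z i j)) +
                  limn (series (fun k : nat => C (- k.+1%:Z) i j))).

Definition stepsize (n : nat) : R := n%:R^-1.

Fixpoint sa_error d (A : 'M[R]_d) (f : Z -> 'cV[R]_d)
    (Phi : nat -> Omega -> Z) (theta0 : 'cV[R]_d) (n : nat) (w : Omega) :
    'cV[R]_d :=
  if n is m.+1 then
    let t := sa_error A f Phi theta0 m w in
    t + stepsize m.+1 *: (A *m t + f (Phi m.+1 w))
  else theta0.

End Chains.

(* Main.v *)
Require Import Defs.
From HB Require Import structures.
From mathcomp Require Import all_boot all_order all_algebra.
From mathcomp Require Import all_classical all_reals all_analysis.
From mathcomp Require Import complex.
From mathcomp Require Import ring lra.
From mathcomp Require Import spectral measurable_realfun.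

Set Implicit Arguments.
Unset Strict Implicit.
Unset Printing Implicit Defensive.

Import Order.TTheory GRing.Theory Num.Theory.
Import numFieldNormedType.Exports.

Local Open Scope classical_set_scope.
Local Open Scope ring_scope.

(** Write P for the transition operator, a = 1/(n+1), and
    S_n = E[theta_n theta_n^T]. Expanding theta_(n+1) theta_(n+1)^T expresses
    S_(n+1) through S_n and the cross moment of theta_(n+1) with
    f(Phi_(n+1)). Conditioning on the past replaces g(Phi_(n+1)) by
    (P g)(Phi_n), so that this cross moment belongs to the doubly indexed family
      x(n,j) = E[theta_n (P^j f)(Phi_n)^T],
      x(n+1,j) = (I + aA) x(n,j+1) + a E[f(Phi_(n+1)) (P^j f)(Phi_(n+1))^T],
    which is closed under the recursion (lemma chain_crossS). Ergodicity
    replaces the last expectation by its stationary value p_j, up to a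
    geometric error. Moving along the recursion lowers n by one and raises j
    by one, and everything is geometrically small in j; this gives
      x(n,j) = U_j/n + (I + A) W_j/n^2 + O(n^-3),
    where U_j sums p_i over i >= j and W_j sums U_i over i > j
    (cross_expansion).

    Inserted into the recursion for S_n, this leaves
      S_(n+1) = (I + aA) S_n (I + aA)^T + a^2 Sigma_Delta + a^3 G + O(a^4)
    with Sigma_Delta = U_0 + U_0^T - p_0 and G = (I + A) W_0 + W_0^T (I + A)^T.
    Trying S_n = S1/n + S2/n^2 + E_n, the orders a^2 and a^3 yield one Lyapunov
    equation for S1 and one for S2, and E_n obeys the same recursion with
    forcing O(a^4). As Re l < -1 on the spectrum of A, a suitable norm of E_n is
    multiplied by at most (1 - ba)^2 with b > 1 (stable_norm), whence
    E_n = O(n^-(2+delta)) for a delta > 0 that is read off from the spectrum of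
    I + A (contraction_power, covariance_expansion_bound).

    The weight of f is sqrt V, since only its square is dominated by V; products
    f (P^j f) have to decay geometrically in j while staying below V. This is
    the transfer of ergodicity from V to sqrt V (iter_kop_sqrt).

    The Poisson solutions sum the series: U_j = pi(f (P^j fhat)^T) and
    W_j = pi(f (P^(j+1) fhathat)^T) telescope by the two Poisson equations. The
    innovations satisfy
    E[Dm Dhatm^T] = E[Dm Zhat^T] = E[Z Z^T] + W_0 (innovation_cross), and with
    this value the equation for S2 is the equation that defines Ssharp. *)

(** * Lyapunov equations *)

Lemma char_poly_trmx (F : comNzRingType) n (A : 'M[F]_n) :
  char_poly A^T = char_poly A.
Proof.
rewrite /char_poly -[RHS]det_tr; congr (\det _).
by rewrite /char_poly_mx -map_trmx linearB /= tr_scalar_mx.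
Qed.

Section Lyapunov.
Context {R : realType} {d : nat}.
Implicit Types (M S : 'M[R]_d).

(** The equation reads M S = - S M^T. If (M - l) X = 0 for such a matrix X, then
    the rows of X are eigenvectors of M^T for -l or zero; but l and -l cannot
    both be eigenvalues of M. So the factors of the characteristic polynomial of
    M cancel one after the other from the Cayley-Hamilton identity. *)
Lemma lyapunov_inj M : hurwitz M ->
  forall S, M *m S + S *m M^T = 0 -> S = 0.
Proof.
move=> hM S hS.
pose f := real_complex R; pose Mc := map_mx f M.
have key (s : seq R[i]) : (forall l, l \in s -> eigenvalue_C M l) ->
    forall X : 'M[R[i]]_d, Mc *m X = - (X *m Mc^T) ->
      foldr (fun l Y => (Mc - l%:M) *m Y) X s = 0 -> X = 0.
  elim: s => [|l s IH] hs X hX //= h0.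
  have [Y [hYX hY]] : exists Y, Y = (Mc - l%:M) *m X /\ Mc *m Y = - (Y *m Mc^T).
    eexists; split; first by [].
    have -> : Mc *m ((Mc - l%:M) *m X) = (Mc - l%:M) *m (Mc *m X).
      rewrite !mulmxA; congr (_ *m X).
      by rewrite mulmxBr mulmxBl mul_mx_scalar mul_scalar_mx.
    by rewrite hX mulmxN mulmxA.
  have hc : foldr (fun l Y => (Mc - l%:M) *m Y) Y s =
      (Mc - l%:M) *m foldr (fun l Y => (Mc - l%:M) *m Y) X s.
    rewrite {}hYX => {h0 hY IH hs}; elim: s => [//|k s IH] /=.
    rewrite IH !mulmxA; congr (_ *m _).
    rewrite !mulmxBl !mulmxBr -!scalar_mxM [k * l]mulrC.
    rewrite !mul_scalar_mx !mul_mx_scalar !opprB !addrA.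
    by rewrite addrAC [RHS]addrAC; congr (_ + _); rewrite addrAC.
  have Y0 : Y = 0.
    apply: IH => [k ks||]; first by apply: hs; rewrite inE ks orbT.
      by [].
    by rewrite hc.
  apply/row_matrixP => i; rewrite row0; apply/eqP/negPn/negP => xn0.
  have : eigenvalue_C M (- l).
    rewrite /eigenvalue_C eigenvalue_root_char -char_poly_trmx.
    rewrite -eigenvalue_root_char; apply/eigenvalueP; exists (row i X) => //.
    rewrite -row_mul -[X *m _]opprK -hX.
    have -> : Mc *m X = l *: X.
      by apply/eqP; rewrite -subr_eq0 -mul_scalar_mx -mulmxBl -hYX Y0.
    by rewrite -scaleNr linearZ.
  move=> /hM /=; have /hM : eigenvalue_C M l by apply: hs; rewrite inE eqxx.
  case: l {hs h0 hYX hc} => a b /= h1; rewrite oppr_lt0; lra.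
suff : map_mx f S = 0.
  by move=> /matrixP h; apply/matrixP => i j; have := h i j; rewrite !mxE => -[].
have hSc : Mc *m map_mx f S = - (map_mx f S *m Mc^T).
  apply/eqP; rewrite -addr_eq0 map_trmx -!map_mxM -map_mxD; apply/eqP.
  by have /= -> := hS; rewrite map_mx0.
have [s hs] := closed_field_poly_normal (char_poly Mc).
rewrite (monicP (char_poly_monic Mc)) scale1r in hs.
apply: (key s _ _ hSc).
  move=> l ls; rewrite /eigenvalue_C eigenvalue_root_char -/Mc hs.
  by rewrite root_prod_XsubC.
case: d M S hM hS @Mc key hSc hs => [|d'] M0 S0 hM hS Mc key hSc hs.
  by apply: flatmx0.
have ch := Cayley_Hamilton Mc; rewrite hs rmorph_prod /= in ch.
have : \prod_(z <- s) horner_mx Mc ('X - z%:P) *m map_mx f S0 = 0.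
  by rewrite ch mul0mx.
suff -> : \prod_(z <- s) horner_mx Mc ('X - z%:P) *m map_mx f S0 =
  foldr (fun l Y => (Mc - l%:M) *m Y) (map_mx f S0) s by [].
elim: s {hs ch} => [|l s IH]; first by rewrite big_nil mul1mx.
rewrite big_cons -mulmxA IH /=; congr (_ *m _).
by rewrite rmorphB /= horner_mx_X horner_mx_C.
Qed.

Lemma lyapunov_surj M : hurwitz M ->
  forall B : 'M[R]_d, exists S, M *m S + S *m M^T = B.
Proof.
move=> hM B.
pose L : 'M[R]_(d * d) := lin_mulmx M + lin_mulmxr M^T.
have LE S : mxvec S *m L = mxvec (M *m S + S *m M^T).
  by rewrite mulmxDr !mul_vec_lin linearD.
have uL : L \in unitmx.
  rewrite -row_free_unit -kermx_eq0; apply/eqP/row_matrixP => i; rewrite row0.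
  have /sub_kermxP : (row i (kermx L) <= kermx L)%MS by exact: row_sub.
  move: (row i _) => v; rewrite -[v]vec_mxK LE => /(congr1 vec_mx).
  rewrite mxvecK linear0 => /(lyapunov_inj hM) ->; exact: linear0.
exists (vec_mx (mxvec B *m invmx L)).
by apply: (can_inj mxvecK); rewrite -LE vec_mxK mulmxKV.
Qed.

End Lyapunov.
(** * A norm contracted by the step matrices *)

Section Contraction.
Context {R : realType} {d : nat}.
Local Notation C := (R[i]).
Local Notation cc := (real_complex R).
Local Notation nc := (@Normc.normc R).

(** Conjugating a lower triangular matrix by diag(t^i) multiplies its entry
    (i,j), i > j, by t^(i-j), which is at most t for t <= 1. *)
Lemma trig_small_offdiag (A : 'M[C]_d) (e : R) : 0 < e ->
  exists Q T : 'M[C]_d, [/\ Q \in unitmx, Q *m A = T *m Q,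
    forall j, \sum_(i | i != j) nc (T i j) <= e &
    forall i, eigenvalue A (T i i)].
Proof.
move=> e0.
have [d0|d0] := posnP d.
  exists 1%:M, A; split => //; first exact: unitmx1.
  - by rewrite mul1mx mulmx1.
  - by move=> [j hj]; exfalso; rewrite d0 in hj.
  - by move=> [j hj]; exfalso; rewrite d0 in hj.
have [P Pu PT] := Schur A d0.
have {Pu}Pu := unitarymx_unit Pu.
set T := conjmx P A in PT; have hT : P *m A = T *m P.
  by apply/(similarP Pu)/eqP.
have /is_trig_mxP trT : is_trig_mx T by [].
clearbody T.
pose B := \sum_i \sum_j nc (T i j).
have B0 : 0 <= B.
  apply: sumr_ge0 => i _; apply: sumr_ge0 => j _.
  by case: (T i j) => x y; exact: sqrtr_ge0.
pose t : R := Num.min 1 (e / (B + 1)).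
have B1 : 0 < B + 1 by lra.
have t0 : 0 < t by rewrite lt_min ltr01 divr_gt0.
have t1 : t <= 1 by rewrite ge_min lexx.
have tB : t * B <= e.
  apply: (@le_trans _ _ (t * (B + 1))); first by rewrite ler_wpM2l ?ltW//; lra.
  by rewrite -ler_pdivlMr// ge_min lexx orbT.
pose D : 'M[C]_d := diag_mx (\row_i (cc (t ^+ i))).
pose D' : 'M[C]_d := diag_mx (\row_i (cc (t ^- i))).
have DD' : D *m D' = 1%:M.
  rewrite mulmx_diag -diag_const_mx; congr diag_mx; apply/rowP => i.
  by rewrite !mxE -rmorphM /= mulfV ?expf_neq0 ?gt_eqF.
have D'D : D' *m D = 1%:M by exact: mulmx1C.
have Du : D \in unitmx by have [] := mulmx1_unit DD'.
exists (D *m P), (D *m T *m D'); split.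
- by rewrite unitmx_mul Du Pu.
- by rewrite -mulmxA hT -!mulmxA (mulmxA D') D'D mul1mx.
- move=> j; apply: le_trans tB; rewrite /B exchange_big mulr_sumr.
  rewrite [leRHS](bigD1 j)//= -[leLHS]addr0; apply: lerD; last first.
    apply: sumr_ge0 => k _; apply: mulr_ge0; first exact: ltW.
    by apply: sumr_ge0 => l _; case: (T l k) => x y; exact: sqrtr_ge0.
  rewrite mulr_sumr [leRHS](bigD1 j)//= -[leLHS]add0r; apply: lerD.
    apply: mulr_ge0; first exact: ltW.
    by case: (T j j) => x y; exact: sqrtr_ge0.
  apply: ler_sum => i ij; rewrite mul_diag_mx mul_mx_diag !mxE.
  rewrite !Normc.normcM; have nT : 0 <= nc (T i j).
    by case: (T i j) => x y; exact: sqrtr_ge0.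
  have nr (x : R) : 0 <= x -> nc (cc x) = x.
    by move=> x0; rewrite /Normc.normc /= expr0n addr0 sqrtr_sqr ger0_norm.
  have [ji|ij'] := ltnP i j.
    have -> : T i j = 0 by exact: trT.
    by rewrite Normc.normc0 mulr0 mul0r mulr0.
  have {}ij : (j < i)%N by rewrite ltn_neqAle ij' andbT eq_sym; exact: ij.
  rewrite mulrAC ler_wpM2r//.
  rewrite !nr ?invr_ge0 ?exprn_ge0 ?(ltW t0)//.
  rewrite -(subnK (ltnW ij)) exprD mulfK ?expf_neq0 ?gt_eqF//.
  have [k ->] : exists k, (i - j)%N = k.+1.
    by exists (i - j).-1; rewrite prednK// subn_gt0.
  by rewrite exprS ler_piMr ?(ltW t0)// exprn_ile1// ltW.
- move=> i; rewrite mul_diag_mx mul_mx_diag !mxE mulrAC -rmorphM/=.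
  rewrite mulfV ?expf_neq0 ?gt_eqF// rmorph1 mul1r.
  have : eigenvalue T (T i i).
    rewrite eigenvalue_root_char char_poly_trig; last exact/is_trig_mxP.
    rewrite rootE horner_prod (bigD1 i)//=.
    by rewrite !hornerE subrr mul0r.
  move=> /eigenvalueP[v hv v0]; apply/eigenvalueP; exists (v *m P).
    by rewrite -mulmxA hT mulmxA hv scalemxAl.
  by apply: contra v0 => /eqP hv0; rewrite -(mulmxK Pu v) hv0 mul0mx.
Qed.

Definition nrm m n (E : 'M[R]_(m, n)) : R := \sum_i \sum_j `|E i j|.
Let cn (F : 'M[C]_d) : R := \sum_i \sum_j nc (F i j).

Let nc_ge0 z : 0 <= nc z. Proof. by case: z => x y; exact: sqrtr_ge0. Qed.

Let nc_cc (x : R) : nc (cc x) = `|x|.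
Proof. by rewrite /Normc.normc /= expr0n addr0 sqrtr_sqr. Qed.

Let nc_sum (I : Type) (r : seq I) (F : I -> C) :
  nc (\sum_(i <- r) F i) <= \sum_(i <- r) nc (F i).
Proof.
elim/big_rec2: _ => [|i y z _ h]; first by rewrite Normc.normc0.
by apply: (le_trans (le_normcD _ _)); rewrite lerD2l.
Qed.

(** The norm cn is the sum of moduli of the entries; the largest column sum of B
    enters once for each of the two factors. *)
Let cn_conj (B F : 'M[C]_d) (k : R) :
  (forall j, \sum_i nc (B i j) <= k) -> cn (B *m F *m B^T) <= k ^+ 2 * cn F.
Proof.
move=> hB.
apply: (@le_trans _ _ (\sum_i \sum_j \sum_l \sum_m
    nc (B i m) * nc (F m l) * nc (B j l))).
  apply: ler_sum => i _; apply: ler_sum => j _; rewrite mxE.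
  apply: (le_trans (nc_sum _ _)); apply: ler_sum => l _.
  rewrite Normc.normcM !mxE -mulr_suml ler_wpM2r//.
  apply: (le_trans (nc_sum _ _)); apply: ler_sum => m _.
  by rewrite Normc.normcM.
rewrite (_ : \sum_i _ = \sum_m \sum_l
    nc (F m l) * ((\sum_i nc (B i m)) * (\sum_j nc (B j l)))); last first.
  under eq_bigr do under eq_bigr do rewrite exchange_big /=.
  under eq_bigr do rewrite exchange_big /=.
  rewrite exchange_big /=; apply: eq_bigr => m _.
  under eq_bigr do rewrite exchange_big /=.
  rewrite exchange_big /=; apply: eq_bigr => l _.
  rewrite mulr_suml mulr_sumr; apply: eq_bigr => i _.
  rewrite mulr_sumr mulr_sumr; apply: eq_bigr => j _; ring.
rewrite mulr_sumr; apply: ler_sum => m _.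
rewrite mulr_sumr; apply: ler_sum => l _.
rewrite [leRHS]mulrC ler_wpM2l// expr2.
by apply: ler_pM => //; apply: sumr_ge0.
Qed.

(** Since |1 + a l|^2 = 1 + 2a Re l + a^2 |l|^2, the real part decides for small
    a. *)
Let nc_step (l : C) (a c e : R) : complex.Re l <= - c - e ->
  0 <= a -> a * nc l ^+ 2 <= 2 * e -> a * c <= 1 ->
  nc (1 + cc a * l) <= 1 - c * a.
Proof.
case: l => x y /= hx a0; rewrite sqr_sqrtr ?addr_ge0 ?sqr_ge0// => hm hc.
have h1 : 0 <= 1 - c * a by lra.
rewrite -[leRHS](ger0_norm h1) -[leRHS]sqrtr_sqr ler_wsqrtr//.
rewrite !mul0r subr0 add0r addr0.
have h2 : a * x <= a * (- c - e) by rewrite ler_wpM2l.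
have h3 : a * (a * (x ^+ 2 + y ^+ 2)) <= a * (2 * e) by rewrite ler_wpM2l.
have h4 : 0 <= (c * a) ^+ 2 by exact: sqr_ge0.
nra.
Qed.

(** There are finitely many eigenvalues. *)
Lemma eigenvalue_margin (A : 'M[R]_d) (b : R) :
  (forall l, eigenvalue_C A l -> complex.Re l < - b) ->
  exists2 e : R, 0 < e &
    forall l, eigenvalue_C A l -> complex.Re l <= - b - e.
Proof.
move=> hA.
have [s hs] := closed_field_poly_normal (char_poly (map_mx cc A)).
rewrite (monicP (char_poly_monic _)) scale1r in hs.
have mem l : eigenvalue_C A l = (l \in s) :> Prop.
  by rewrite /eigenvalue_C eigenvalue_root_char hs root_prod_XsubC.
have {hA} : forall l, l \in s -> complex.Re l < - b.
  by move=> l ls; apply: hA; rewrite mem.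
suff : (forall l, l \in s -> complex.Re l < - b) ->
    exists2 e : R, 0 < e & forall l, l \in s -> complex.Re l <= - b - e.
  move=> /[apply] -[e e0 he]; exists e => // l; rewrite mem; exact: he.
elim: {hs mem} s => [_|l s IH hs]; first by exists 1.
have [|e e0 he] := IH; first by move=> k ks; apply: hs; rewrite inE ks orbT.
have hl := hs l (mem_head _ _).
exists (Num.min e (- b - complex.Re l)); first by rewrite lt_min e0; lra.
move=> k; rewrite inE => /predU1P[->|/he hk].
  have : Num.min e (- b - complex.Re l) <= - b - complex.Re l.
    by rewrite ge_min lexx orbT.
  by move=> ?; lra.
have : Num.min e (- b - complex.Re l) <= e by rewrite ge_min lexx.
move=> ?; lra.
Qed.

(** Take Q with Q A = T Q and T almost diagonal, and let N E be the sum of moduli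
    of the entries of Q E Q^T. Then I + aA acts as I + aT, whose column sums are
    at most 1 - ba for small a. *)
Lemma stable_norm (A : 'M[R]_d) (b : R) :
  (forall l, eigenvalue_C A l -> complex.Re l < - b) ->
  exists (N : 'M[R]_d -> R) (K a0 : R),
    [/\ 0 < K, 0 < a0,
        forall E F, N (E + F) <= N E + N F,
        forall E, N E <= K * nrm E /\ nrm E <= K * N E &
        forall a E, 0 <= a <= a0 ->
          N ((1%:M + a *: A) *m E *m (1%:M + a *: A)^T)
            <= (1 - b * a) ^+ 2 * N E].
Proof.
move=> hA; have [e e0 he] := eigenvalue_margin hA.
have e20 : 0 < e / 2 by rewrite divr_gt0.
have [Q [T [Qu QA offT eigT]]] := trig_small_offdiag (map_mx cc A) e20.
pose N (E : 'M[R]_d) := cn (Q *m map_mx cc E *m Q^T).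
have cols (B : 'M[C]_d) j : \sum_i nc (B i j) <= cn B.
  by rewrite /cn exchange_big [leRHS](bigD1 j)//= lerDl; apply: sumr_ge0 => k _;
     apply: sumr_ge0.
have cn0 B : 0 <= cn B by apply: sumr_ge0 => i _; apply: sumr_ge0.
have nrmE E : cn (map_mx cc E) = nrm E.
  by apply: eq_bigr => i _; apply: eq_bigr => j _; rewrite mxE nc_cc.
pose m := \sum_i nc (T i i) ^+ 2.
have m0 : 0 <= m by apply: sumr_ge0 => i _; exact: sqr_ge0.
pose c := b + e / 2.
pose a0 := Num.min (e / (m + 1)) (1 / (`|c| + 1)).
pose K := (cn Q + cn (invmx Q) + 1) ^+ 2.
have K0 : 0 < K by rewrite exprn_gt0// ltr_wpDl// addr_ge0.
exists N, K, a0; split => //.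
- by rewrite lt_min !divr_gt0// ltr_wpDl.
- move=> E F; rewrite /N map_mxD mulmxDr mulmxDl /cn -big_split/=.
  apply: ler_sum => i _; rewrite -big_split/=; apply: ler_sum => j _.
  by rewrite mxE; exact: le_normcD.
- move=> E; split.
    rewrite -nrmE; apply: le_trans (cn_conj _ (cols Q)) _.
    rewrite ler_wpM2r// lerXn2r ?nnegrE// ?addr_ge0//.
    by rewrite -addrA lerDl addr_ge0.
  have -> : nrm E = cn (invmx Q *m (Q *m map_mx cc E *m Q^T) *m (invmx Q)^T).
    rewrite trmx_inv !mulmxA mulVmx// mul1mx -mulmxA mulmxV ?unitmx_tr//.
    by rewrite mulmx1 nrmE.
  apply: le_trans (cn_conj _ (cols (invmx Q))) _.
  rewrite ler_wpM2r// lerXn2r ?nnegrE// ?addr_ge0//.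
  by rewrite addrAC lerDr addr_ge0.
move=> a E /andP[a_ge0 ale].
have hQ : Q *m map_mx cc (1%:M + a *: A) = (1%:M + cc a *: T) *m Q.
  by rewrite map_mxD map_mx1 map_mxZ mulmxDr mulmx1 mulmxDl mul1mx
     -scalemxAr QA scalemxAl.
have -> : N ((1%:M + a *: A) *m E *m (1%:M + a *: A)^T) =
    cn ((1%:M + cc a *: T) *m (Q *m map_mx cc E *m Q^T)
        *m (1%:M + cc a *: T)^T).
  rewrite /N !map_mxM -map_trmx; congr cn.
  rewrite !mulmxA hQ -[LHS]mulmxA -[RHS]mulmxA -trmx_mul hQ.
  by rewrite trmx_mul.
apply: cn_conj => j.
rewrite (bigD1 j)//= !mxE eqxx -[leRHS](subrK (a * (e / 2))).
apply: lerD.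
  rewrite (_ : 1 - b * a - _ = 1 - c * a); last by rewrite /c; ring.
  have m1 : 0 < m + 1 by lra.
  have c1 : 0 < `|c| + 1 by rewrite ltr_wpDl.
  apply: (@nc_step _ _ _ (e / 2)) => //.
  - by have := he _ (eigT j); rewrite /c; lra.
  - have : a * (m + 1) <= e.
      by rewrite -ler_pdivlMr//; apply: (le_trans ale); rewrite ge_min lexx.
    have : nc (T j j) ^+ 2 <= m + 1.
      rewrite /m (bigD1 j)//= -addrA lerDl addr_ge0//.
      by apply: sumr_ge0 => i _; exact: sqr_ge0.
    move=> /(ler_wpM2l a_ge0) h1 h2; apply: (le_trans h1); lra.
  - have : a * (`|c| + 1) <= 1.
      rewrite -ler_pdivlMr//; apply: (le_trans ale).
      by rewrite ge_min lexx orbT.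
    by apply: le_trans; rewrite ler_wpM2l// (le_trans (ler_norm c))// lerDl.
apply: (@le_trans _ _ (\sum_(i | i != j) a * nc (T i j))).
  apply: ler_sum => i ij; rewrite !mxE (negPf ij) add0r Normc.normcM nc_cc.
  by rewrite ger0_norm.
by rewrite -mulr_sumr ler_wpM2l.
Qed.
End Contraction.
(** * The entrywise norm of real matrices *)

Section EntrywiseNorm.
Context {R : realType}.

Lemma nrm_ge0 m n (X : 'M[R]_(m, n)) : 0 <= nrm X.
Proof. by apply: sumr_ge0 => i _; apply: sumr_ge0. Qed.

Lemma nrm_entry m n (X : 'M[R]_(m, n)) i j : `|X i j| <= nrm X.
Proof.
rewrite /nrm (bigD1 i)//= (bigD1 j)//= -addrA lerDl addr_ge0//.
  exact: sumr_ge0.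
by apply: sumr_ge0 => k _; exact: sumr_ge0.
Qed.

Lemma nrm_le m n (X : 'M[R]_(m, n)) c : (forall i j, `|X i j| <= c) ->
  nrm X <= m%:R * (n%:R * c).
Proof.
move=> hX; apply: (@le_trans _ _ (\sum_(i < m) \sum_(j < n) c)).
  by apply: ler_sum => i _; apply: ler_sum => j _.
by rewrite !sumr_const !card_ord !mulr_natl.
Qed.

Lemma nrmD m n (X Y : 'M[R]_(m, n)) : nrm (X + Y) <= nrm X + nrm Y.
Proof.
rewrite /nrm -big_split/=; apply: ler_sum => i _; rewrite -big_split/=.
by apply: ler_sum => j _; rewrite mxE ler_normD.
Qed.

Lemma nrmZ m n k (X : 'M[R]_(m, n)) : nrm (k *: X) = `|k| * nrm X.
Proof.
rewrite /nrm mulr_sumr; apply: eq_bigr => i _; rewrite mulr_sumr.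
by apply: eq_bigr => j _; rewrite mxE normrM.
Qed.

Lemma nrmN m n (X : 'M[R]_(m, n)) : nrm (- X) = nrm X.
Proof. by rewrite -scaleN1r nrmZ normrN1 mul1r. Qed.

Lemma nrm_tr m n (X : 'M[R]_(m, n)) : nrm X^T = nrm X.
Proof.
rewrite /nrm exchange_big; apply: eq_bigr => i _; apply: eq_bigr => j _.
by rewrite mxE.
Qed.

Lemma nrmM m n q (X : 'M[R]_(m, n)) (Y : 'M[R]_(n, q)) :
  nrm (X *m Y) <= nrm X * nrm Y.
Proof.
apply: (@le_trans _ _ (\sum_i \sum_j \sum_k `|X i k| * `|Y k j|)).
  apply: ler_sum => i _; apply: ler_sum => j _; rewrite mxE.
  by apply: (le_trans (ler_norm_sum _ _ _)); apply: ler_sum => k _;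
     rewrite normrM.
rewrite [nrm X]/nrm mulr_suml; apply: ler_sum => i _; rewrite exchange_big /=.
rewrite mulr_suml; apply: ler_sum => k _; rewrite -mulr_sumr ler_wpM2l//.
rewrite /nrm (bigD1 k)//= lerDl.
by apply: sumr_ge0 => l _; apply: sumr_ge0.
Qed.

End EntrywiseNorm.

(** * Two scalar recursions *)

Section ScalarRecursions.
Context {R : realType}.

Lemma inv_nat_small (e : R) : 0 < e ->
  exists N : nat, forall n, (N <= n)%N -> (0 < n)%N /\ n%:R^-1 <= e.
Proof.
move=> e0; exists (Num.truncn e^-1).+1 => n hn.
have n0 : (0 < n)%N by exact: leq_ltn_trans hn.
split => //; rewrite invf_ple ?posrE ?ltr0n//.
have := truncnS_gt e^-1; move=> /ltW /le_trans; apply.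
by rewrite ler_nat.
Qed.

(** Moving one step along the chain costs a factor 1 + K/n but gains a factor
    s < 1 from the second index, so that for large n the recursion contracts
    and the size n^-3 of its forcing is inherited by the solution. *)
Lemma contraction_cubic (y : nat -> nat -> R) (K E s : R) :
  0 < s < 1 -> 0 <= K -> 0 <= E ->
  (forall j, y 1%N j <= E * s ^+ j) ->
  (forall n j, (0 < n)%N -> y n.+1 j <=
     (1 + K / n.+1%:R) * y n j.+1 + E * s ^+ j / n.+1%:R ^+ 3) ->
  exists (N : nat) (C : R), 0 <= C /\
    forall n j, (N <= n)%N -> y n j <= C * s ^+ j / n%:R ^+ 3.
Proof.
move=> /andP[s0 s1] K0 E0 hy1 hyS.
have fin n : (0 < n)%N -> exists2 C, 0 <= C & forall j, y n j <= C * s ^+ j.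
  elim: n => [//|[_|n IH] _]; first by exists E.
  have [//|C C0 hC] := IH; exists ((1 + K / n.+2%:R) * (C * s) + E).
    by rewrite addr_ge0// mulr_ge0// ?addr_ge0 ?divr_ge0 ?mulr_ge0 ?(ltW s0).
  move=> j; apply: (le_trans (hyS _ _ _)) => //; rewrite [leRHS]mulrDl; apply: lerD.
    rewrite -!mulrA -exprS ler_wpM2l ?hC// addr_ge0 ?divr_ge0//.
  rewrite ler_piMr ?mulr_ge0 ?exprn_ge0 ?(ltW s0)//.
  by rewrite invf_le1 ?exprn_gt0// exprn_ege1// ler1n.
(* With x = 1/n <= 1, the product (1 + K x)(1 + x)^3 is at most
   1 + (8K + 7) x; for x <= e this keeps s times it below sg. *)
pose e := Num.min 1 ((1 - s) / (2 * (8 * K + 7))).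
have e0 : 0 < e by rewrite lt_min ltr01 divr_gt0//; lra.
have [N hN] := inv_nat_small e0.
have [N0 _] := hN N (leqnn N).
have [C C0 hC] := fin N N0.
pose sg := (1 + s) / 2.
have sg1 : 0 < 1 - sg by rewrite /sg; lra.
pose D := C * N%:R ^+ 3 + E / (1 - sg).
have D0 : 0 <= D.
  apply: addr_ge0; first by rewrite mulr_ge0// exprn_ge0.
  by rewrite divr_ge0// ltW.
exists N, D; split => // n j hn; elim: n hn j => [hn|n IH hn] j.
  by move: N0; rewrite ltnNge hn.
have [nN|nN] := ltnP n N.
  have -> : n.+1 = N by apply: anti_leq; rewrite hn nN.
  apply: (le_trans (hC j)).
  have -> : D * s ^+ j / N%:R ^+ 3 =
      C * s ^+ j + E / (1 - sg) * s ^+ j / N%:R ^+ 3.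
    by rewrite /D; field; rewrite pnatr_eq0 -lt0n N0 gt_eqF.
  rewrite lerDl !mulr_ge0// ?invr_ge0 ?exprn_ge0 ?(ltW s0)//.
  exact: ltW.
have [n0 hx] := hN n nN.
apply: (le_trans (hyS n j n0)).
have key : (1 + K / n.+1%:R) * (s / n%:R ^+ 3) <= sg / n.+1%:R ^+ 3.
  set x := n%:R^-1 : R in hx.
  have x0 : 0 < x by rewrite invr_gt0 ltr0n.
  have xe : n.+1%:R^-1 = x / (1 + x) :> R.
    by rewrite /x -natr1; field; rewrite !(pnatr_eq0, natr1) -!lt0n n0.
  have x1 : x <= 1 by apply: (le_trans hx); rewrite ge_min lexx.
  have hx' : x * (2 * (8 * K + 7)) <= 1 - s.
    rewrite -ler_pdivlMr; last lra.
    by apply: (le_trans hx); rewrite ge_min lexx orbT.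
  rewrite -!exprVn xe -/x expr_div_n.
  have px : 0 < (1 + x) ^+ 3 by rewrite exprn_gt0//; lra.
  rewrite [leRHS]mulrA ler_pdivlMr//; set a := 1 + K * (x / (1 + x)).
  have -> : a * (s * x ^+ 3) * (1 + x) ^+ 3 = a * (1 + x) ^+ 3 * s * x ^+ 3.
    by ring.
  rewrite ler_wpM2r ?exprn_ge0 ?(ltW x0)//.
  have h1 : K * (x / (1 + x)) <= K * x.
    rewrite ler_wpM2l// ler_pdivrMr; last by lra.
    by rewrite mulrDr mulr1 lerDl mulr_ge0 ?(ltW x0).
  have x2 : x ^+ 2 <= x by rewrite expr2 ler_piMr ?(ltW x0).
  have x3 : x ^+ 3 <= x by rewrite exprS ler_piMr ?(ltW x0)// (le_trans x2).
  have h2 : (1 + x) ^+ 3 <= 1 + 7 * x.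
    have -> : (1 + x) ^+ 3 = 1 + 3 * x + 3 * x ^+ 2 + x ^+ 3 by ring.
    lra.
  have h3 : a * (1 + x) ^+ 3 <= (1 + K * x) * (1 + 7 * x).
    apply: ler_pM => //; [|exact: ltW|by rewrite lerD2l].
    by rewrite addr_ge0// mulr_ge0// divr_ge0 ?(ltW x0)//; lra.
  have h4 : (1 + K * x) * (1 + 7 * x) <= 1 + (8 * K + 7) * x.
    have : K * x ^+ 2 <= K * x by rewrite ler_wpM2l.
    by rewrite mulrDl mul1r mulrDr mulr1 !expr2; lra.
  have := le_trans h3 h4 => h5.
  by apply: (le_trans (ler_wpM2r (ltW s0) h5)); rewrite /sg; nra.
have kE : 0 <= 1 + K / n.+1%:R by rewrite addr_ge0// divr_ge0.
apply: (@le_trans _ _ (D * s ^+ j * (sg / n.+1%:R ^+ 3)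
    + E * s ^+ j / n.+1%:R ^+ 3)).
  rewrite lerD2r; apply: (le_trans (ler_wpM2l kE (IH nN j.+1))).
  apply: le_trans (ler_wpM2l _ key); last first.
    by rewrite mulr_ge0// exprn_ge0// ltW.
  by rewrite exprS le_eqVlt; apply/orP; left; apply/eqP; ring.
rewrite -mulrA [leLHS](_ : _ = (D * sg + E) * (s ^+ j / n.+1%:R ^+ 3)); last first.
  by ring.
rewrite -mulrA ler_wpM2r ?divr_ge0 ?exprn_ge0 ?(ltW s0)//.
have : E / (1 - sg) <= D by rewrite lerDr mulr_ge0 ?exprn_ge0.
rewrite ler_pdivrMr//; lra.
Qed.

(** r^(n+j) solves the recursion above with K = 0 and no forcing. *)
Lemma geometric_le_cubic (r : R) : 0 < r < 1 ->
  exists2 C : R, 0 <= C & forall n, (0 < n)%N -> r ^+ n <= C / n%:R ^+ 3.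
Proof.
move=> r01; have /andP[r0 r1] := r01.
have [||N [C [C0 h]]] :=
    @contraction_cubic (fun n j => r ^+ (n + j)) 0 1 r r01 (lexx 0) ler01.
- by move=> j; rewrite exprD expr1 mul1r ler_piMl ?exprn_ge0 ?(ltW r0)// ltW.
- move=> n j n0; rewrite mul0r addr0 mul1r addSnnS lerDl.
  by rewrite mul1r divr_ge0 ?exprn_ge0 ?(ltW r0).
exists (C + N%:R ^+ 3); first by rewrite addr_ge0 ?exprn_ge0.
move=> n n0; rewrite mulrDl; have [nN|/ltnW nN] := leqP N n.
  have := h n 0%N nN; rewrite addn0 expr0 mulr1 => h1; apply: (le_trans h1).
  by rewrite lerDl divr_ge0 ?exprn_ge0.
apply: (@le_trans _ _ 1); first by rewrite exprn_ile1 ?(ltW r0) ?(ltW r1).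
rewrite -[leLHS]add0r lerD ?divr_ge0 ?exprn_ge0//.
by rewrite ler_pdivlMr ?exprn_gt0 ?ltr0n// mul1r lerXn2r ?nnegrE// ler_nat.
Qed.

(** Young's inequality for the factors 1 - x and 1 with exponent s. *)
Let powR_bernoulli (s x : R) : 1 < s -> 0 <= x <= 1 ->
  1 - s * x <= (1 - x) `^ s.
Proof.
move=> s1 /andP[x0 x1]; have s0 : 0 < s by lra.
have s1' : 0 < s - 1 by lra.
have := @conjugate_powR R (1 - x) 1 s (s / (s - 1)).
rewrite powR1 mulr1 subr_ge0 ler01 => /(_ x1 isT s0 (divr_gt0 s0 s1')).
have -> : s^-1 + (s / (s - 1))^-1 = 1.
  by rewrite invf_div; field; rewrite gt_eqF.
move=> /(_ erefl); rewrite invf_div => /(ler_wpM2l (ltW s0)) h.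
move: h; have -> : s * ((1 - x) `^ s / s + 1 * ((s - 1) / s)) =
    (1 - x) `^ s + (s - 1) by field; rewrite gt_eqF.
lra.
Qed.

(** The contraction beats the decay rate n^-(2+dl), since 2 + 3/2 dl > 2 + dl,
    and so does the forcing, since 2 + dl <= 3; the comparison of consecutive values of
    n^-(2+dl) is Bernoulli's inequality. *)
Lemma contraction_power (e : nat -> R) (N0 : nat) (C dl : R) :
  0 < dl <= 1 -> 0 <= C ->
  (forall n, (N0 <= n)%N -> e n.+1 <=
     (1 - (1 + 3 / 4 * dl) / n.+1%:R) ^+ 2 * e n + C / n.+1%:R ^+ 4) ->
  exists (N : nat) (D : R),
    forall n, (N <= n)%N -> e n <= D * n%:R `^ (- (2 + dl)).
Proof.
move=> /andP[d0 d1] C0 he.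
have e0 : 0 < dl / 16 by rewrite divr_gt0.
have [N1 hN1] := inv_nat_small e0.
pose N := maxn N0 N1.
have N_gt0 : (0 < N)%N by have [] := hN1 N (leq_maxr _ _).
pose s := 2 + dl.
pose D := Num.max (e N / N%:R `^ (- s)) (C * (4 / dl)).
have D0 : 0 <= D.
  by rewrite le_max; apply/orP; right; rewrite mulr_ge0// divr_ge0// ltW.
exists N, D => n hn; elim: n hn => [hn|n IH hn].
  by move: N_gt0; rewrite ltnNge hn.
have [nN|nN] := ltnP n N.
  have -> : n.+1 = N by apply: anti_leq; rewrite hn nN.
  by rewrite -ler_pdivrMr ?powR_gt0 ?ltr0n// le_max lexx.
have {}IH := IH nN.
have n0 : (0 < n)%N by exact: leq_trans N_gt0 nN.
have [_ an] := hN1 n.+1 (leqW (leq_trans (leq_maxr _ _) nN)).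
apply: (le_trans (he n (leq_trans (leq_maxl _ _) nN))).
set a := n.+1%:R^-1 : R in an *.
have a0 : 0 < a by rewrite invr_gt0.
have a1 : a <= 1 by lra.
set q := n%:R `^ (- s) : R in IH *.
have q0 : 0 < q by rewrite powR_gt0// ltr0n.
have hna : n%:R = n.+1%:R * (1 - a) :> R.
  by rewrite /a mulrBr mulr1 mulfV ?pnatr_eq0// -natr1 addrK.
have hq : (1 - s * a) * q <= n.+1%:R `^ (- s).
  have -> : n.+1%:R `^ (- s) = (1 - a) `^ s * q.
    rewrite /q hna powRM ?subr_ge0// mulrC -mulrA -powRD.
      by rewrite addNr powRr0 mulr1.
    by apply/implyP => _; rewrite gt_eqF// -(pmulr_rgt0 (x := n.+1%:R)) ?ltr0n// -hna ltr0n.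
  rewrite ler_wpM2r ?(ltW q0)//; apply: powR_bernoulli; first by rewrite /s; lra.
  by rewrite (ltW a0).
have a3 : a ^+ 3 <= q.
  have ha : a ^+ 3 = n.+1%:R `^ (- 3).
    by rewrite powR_invn// exprVn.
  rewrite ha /q.
  apply: (@le_trans _ _ (n%:R `^ (- 3))).
    rewrite !powRN lef_pV2 ?posrE ?powR_gt0 ?ltr0n//.
    by rewrite ge0_ler_powR ?nnegrE// ler_nat.
  by rewrite ler_powR ?ler1n// /s; lra.
have -> : C / n.+1%:R ^+ 4 = C * a * a ^+ 3 by rewrite -exprVn -/a; ring.
have h1 : C * a * a ^+ 3 <= C * a * q.
  by rewrite ler_wpM2l// mulr_ge0// ltW.
have CD : C <= D * (dl / 4).
  rewrite -ler_pdivrMr; last by rewrite divr_gt0.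
  by rewrite invf_div le_max lexx orbT.
have h2 : C * a * q <= D * (dl / 4) * a * q.
  by rewrite !ler_wpM2r// ltW.
(* Of the surplus dl/2 of 2 + 3/2 dl over 2 + dl, dl/4 pays for the
   quadratic term of k, and dl/4 for the forcing. *)
set k := (1 - (1 + 3 / 4 * dl) * a) ^+ 2.
have k1 : k <= 1 - (2 + 5 / 4 * dl) * a.
  rewrite /k; have : a * ((1 + 3 / 4 * dl) ^+ 2 * a) <= a * (dl / 4).
    rewrite ler_wpM2l ?(ltW a0)//.
    have : (1 + 3 / 4 * dl) ^+ 2 <= 4 by nra.
    move=> /(ler_wpM2r (ltW a0)) h; apply: (le_trans h); lra.
  by move=> h; nra.
have h3 : k * e n <= (1 - (2 + 5 / 4 * dl) * a) * (D * q).
  apply: (@le_trans _ _ (k * (D * q))); first by rewrite ler_wpM2l// sqr_ge0.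
  by rewrite ler_wpM2r// mulr_ge0// ltW.
apply: le_trans (ler_wpM2l D0 hq).
apply: (le_trans (lerD h3 (le_trans h1 h2))).
by rewrite le_eqVlt; apply/orP; left; apply/eqP; rewrite /s; field.
Qed.

End ScalarRecursions.
(** * Second-order expansion of the covariance recursion *)

(** The letters are those of the introduction: p, U and W are the stationary
    correlations and their first and second tail sums, c n j tends to p j, and
    S is the covariance. The rate s governs the decay in j, the rate r that in
    n. *)
Section CovarianceExpansion.
Context {R : realType} {d : nat}.
Implicit Types (X Y Z : 'M[R]_d).

Let sum_lin3 (a b c : R) X Y Z :
  nrm (a *: X + b *: Y + c *: Z) <=
  `|a| * nrm X + `|b| * nrm Y + `|c| * nrm Z.
Proof.
rewrite -!nrmZ; apply: (le_trans (nrmD _ _)); rewrite lerD2r.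
exact: nrmD.
Qed.

Let scaleE : (forall a X Y, (a *: X) *m Y = a *: (X *m Y)) *
  (forall a X Y, X *m (a *: Y) = a *: (X *m Y)).
Proof. by split=> a X Y; [rewrite -scalemxAl|rewrite -scalemxAr]. Qed.

Let step_conj (A Z : 'M[R]_d) (a : R) :
  (1%:M + a *: A) *m Z *m (1%:M + a *: A)^T =
  Z + a *: (A *m Z + Z *m A^T) + a ^+ 2 *: (A *m Z *m A^T).
Proof.
rewrite linearD /= trmx1 linearZ /=.
rewrite !(mulmxDl, mulmxDr, mul1mx, mulmx1, scaleE).
by rewrite !scalerDr scalerA -expr2 !addrA; congr (_ + _); rewrite addrAC.
Qed.

Variables (A : 'M[R]_d) (r s : R) (C0 : R).
Variables (x c : nat -> nat -> 'M[R]_d) (p U W : nat -> 'M[R]_d).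
Hypothesis r01 : 0 < r < 1.
Hypothesis s01 : 0 < s < 1.
Hypothesis C00 : 0 <= C0.
Hypothesis xS : forall n j,
  x n.+1 j = (1%:M + n.+1%:R^-1 *: A) *m x n j.+1 + n.+1%:R^-1 *: c n.+1 j.
Hypothesis x1 : forall j, nrm (x 1%N j) <= C0 * s ^+ j.
Hypothesis cE : forall n j, nrm (c n j - p j) <= C0 * s ^+ j * r ^+ n.
Hypothesis US : forall j, U j = U j.+1 + p j.
Hypothesis WS : forall j, W j = W j.+1 + U j.+1.
Hypothesis Ub : forall j, nrm (U j) <= C0 * s ^+ j.
Hypothesis Wb : forall j, nrm (W j) <= C0 * s ^+ j.

Local Notation L := (1%:M + A).

Let y n j := x n j - n%:R^-1 *: U j - (n%:R ^+ 2)^-1 *: (L *m W j).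

(** Substituting the ansatz U/n + (I + A) W/n^2 into the recursion leaves a
    forcing of order n^-3: the terms of order 1/n and 1/n^2 cancel by the
    telescoping relations of U and W. *)
Let yS (n j : nat) : (0 < n)%N ->
  let a := n.+1%:R^-1 in let b := n%:R^-1 in
  y n.+1 j = (1%:M + a *: A) *m y n j.+1 +
    ((a ^+ 2 * b) *: (L *m U j.+1) + (a * b * (b + a)) *: (L *m W j.+1)
      + (a * b ^+ 2) *: (A *m (L *m W j.+1)))
    + a *: (c n.+1 j - p j).
Proof.
move=> n0 /=.
rewrite /y xS -!exprVn.
set a := n.+1%:R^-1; set b := n%:R^-1.
rewrite [in LHS]WS [in LHS]US !(mulmxDl, mulmxDr, mul1mx, mulmxBr, mulmxN, scaleE).
move: (A *m x n j.+1) (x n j.+1) (U j.+1) (W j.+1) (A *m U j.+1) (A *m W j.+1).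
move=> Ax xx u w Au Aw; move: (A *m Aw) (c n.+1 j) (p j) => AAw cc pp.
apply/matrixP => i k; rewrite !mxE.
rewrite /a /b -[n.+1%:R]natr1; field.
by rewrite !(pnatr_eq0, natr1) -!lt0n n0.
Qed.
Let K := nrm A.
Let CL := 1 + K.

Let K0 : 0 <= K. Proof. exact: nrm_ge0. Qed.

Let mulL Z : nrm (L *m Z) <= CL * nrm Z.
Proof.
rewrite mulmxDl mul1mx; apply: (le_trans (nrmD _ _)).
by rewrite /CL mulrDl mul1r lerD2l nrmM.
Qed.

Let inv_le (n : nat) : (0 < n)%N -> n%:R^-1 <= 2 * n.+1%:R^-1 :> R.
Proof.
move=> n0; rewrite -[leLHS]mul1r ler_pdivrMr ?ltr0n// mulrAC.
rewrite ler_pdivlMr ?ltr0n// mul1r -natrM ler_nat.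
by rewrite mul2n -addnn -addn1 leq_add2l.
Qed.

(** The cross-covariances x n j to second order, with an error that keeps the
    geometric decay in j. *)
Lemma cross_expansion : exists (N : nat) (C : R), 0 <= C /\
  forall n j, (N <= n)%N -> nrm (y n j) <= C * s ^+ j / n%:R ^+ 3.
Proof.
have /andP[r0 r1] := r01; have /andP[s0 s1] := s01.
have sj j : 0 <= s ^+ j by rewrite exprn_ge0 ?ltW.
have sjS j : s ^+ j.+1 <= s ^+ j by rewrite exprS ler_piMl// ltW.
have CL0 : 0 <= CL by rewrite addr_ge0.
have [Cg Cg0 hg] := geometric_le_cubic r01.
(* The three terms bound the start n = 1, the forcing of the ansatz, and the
   distance from stationarity. *)
pose E := (2 + CL) * C0 + (8 + 4 * K) * CL * C0 + C0 * Cg.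
have KC : 0 <= (8 + 4 * K) * CL * C0 by rewrite !mulr_ge0// addr_ge0// mulr_ge0.
have CC : 0 <= (2 + CL) * C0 by rewrite mulr_ge0// addr_ge0.
have CG : 0 <= C0 * Cg by rewrite mulr_ge0.
have E0 : 0 <= E by rewrite !addr_ge0.
apply: (@contraction_cubic _ (fun n j => nrm (y n j)) K E s) => //.
  move=> j; rewrite /y invr1 expr1n invr1 !scale1r.
  apply: (@le_trans _ _ ((2 + CL) * C0 * s ^+ j)); last first.
    by rewrite ler_wpM2r// /E; move: KC CG; lra.
  apply: (le_trans (nrmD _ _)); rewrite nrmN.
  apply: (le_trans (lerD (nrmD _ _) (mulL _))); rewrite nrmN.
  have := ler_wpM2l CL0 (Wb j); have := Ub j; have := x1 j; lra.
move=> n j n0; rewrite yS//.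
set a := n.+1%:R^-1; set b := n%:R^-1.
have a0 : 0 <= a by rewrite invr_ge0.
have b0 : 0 <= b by rewrite invr_ge0.
have ba : b <= 2 * a by exact: inv_le.
apply: (le_trans (nrmD _ _)); apply: (le_trans (lerD (nrmD _ _) (lexx _))).
rewrite -addrA; apply: lerD.
  rewrite mulmxDl mul1mx mulrDl mul1r; apply: (le_trans (nrmD _ _)).
  rewrite lerD2l -scalemxAl nrmZ ger0_norm// [K / _]mulrC -mulrA.
  by rewrite ler_wpM2l// nrmM.
have -> : E * s ^+ j / n.+1%:R ^+ 3 = a ^+ 3 * E * s ^+ j.
  by rewrite -exprVn -/a; ring.
have a1 : a <= 1 by rewrite invf_le1 ?ler1n// ltr0n.
have ub : nrm (L *m U j.+1) <= CL * C0 * s ^+ j.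
  apply: (le_trans (mulL _)); rewrite -mulrA ler_wpM2l//.
  by apply: (le_trans (Ub _)); rewrite ler_wpM2l.
have wb : nrm (L *m W j.+1) <= CL * C0 * s ^+ j.
  apply: (le_trans (mulL _)); rewrite -mulrA ler_wpM2l//.
  by apply: (le_trans (Wb _)); rewrite ler_wpM2l.
have awb : nrm (A *m (L *m W j.+1)) <= K * (CL * C0 * s ^+ j).
  by apply: (le_trans (nrmM _ _)); rewrite ler_wpM2l.
have a2 : 0 <= a ^+ 2 by rewrite exprn_ge0.
have a3 : 0 <= a ^+ 3 by rewrite exprn_ge0.
set q := CL * C0 * s ^+ j in ub wb awb.
have q0 : 0 <= q by rewrite !mulr_ge0.
have c1 : a ^+ 2 * b <= 2 * a ^+ 3.
  by rewrite (_ : 2 * a ^+ 3 = a ^+ 2 * (2 * a)); [rewrite ler_wpM2l|ring].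
have b2 : b ^+ 2 <= 4 * a ^+ 2.
  rewrite (_ : 4 * a ^+ 2 = (2 * a) ^+ 2); last by ring.
  by rewrite lerXn2r// nnegrE mulr_ge0.
have c3 : a * b ^+ 2 <= 4 * a ^+ 3.
  by rewrite (_ : 4 * a ^+ 3 = a * (4 * a ^+ 2)); [rewrite ler_wpM2l|ring].
have c2 : a * b * (b + a) <= 6 * a ^+ 3.
  have -> : a * b * (b + a) = a * b ^+ 2 + a ^+ 2 * b by ring.
  lra.
have hc : `|a| * nrm (c n.+1 j - p j) <= a ^+ 3 * (C0 * Cg) * s ^+ j.
  rewrite ger0_norm//; apply: (@le_trans _ _ (1 * (C0 * s ^+ j * (Cg * a ^+ 3)))).
    apply: ler_pM => //; first exact: nrm_ge0.
    apply: (le_trans (cE _ _)); rewrite ler_wpM2l ?mulr_ge0//.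
    by rewrite exprVn hg.
  by rewrite le_eqVlt; apply/orP; left; apply/eqP; ring.
apply: (@le_trans _ _ (a ^+ 3 * ((8 + 4 * K) * CL * C0) * s ^+ j
    + a ^+ 3 * (C0 * Cg) * s ^+ j)); last first.
  have := mulr_ge0 (mulr_ge0 a3 CC) (sj j).
  rewrite /E; lra.
apply: lerD; last by rewrite nrmZ.
apply: (le_trans (sum_lin3 _ _ _ _ _ _)).
rewrite !ger0_norm ?mulr_ge0 ?addr_ge0 ?exprn_ge0//.
have m1 := ler_pM (mulr_ge0 a2 b0) (nrm_ge0 _) c1 ub.
have m2 := ler_pM (mulr_ge0 (mulr_ge0 a0 b0) (addr_ge0 b0 a0)) (nrm_ge0 _) c2 wb.
have m3 := ler_pM (mulr_ge0 a0 (exprn_ge0 2 b0)) (nrm_ge0 _) c3 awb.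
rewrite (_ : _ * _ * s ^+ j = 2 * a ^+ 3 * q + 6 * a ^+ 3 * q + 4 * a ^+ 3 * (K * q)).
  by rewrite !lerD.
by rewrite /q; ring.
Qed.

Variables (S : nat -> 'M[R]_d) (St S2 : 'M[R]_d) (dl : R).
Local Notation SD := (U 0 + (U 0)^T - p 0).
Hypothesis dl01 : 0 < dl <= 1.
Hypothesis hA : forall l, eigenvalue_C A l -> complex.Re l <= - 1 - dl.
Hypothesis SS : forall n,
  S n.+1 = (1%:M + n.+1%:R^-1 *: A) *m S n *m (1%:M + n.+1%:R^-1 *: A)^T
    + n.+1%:R^-1 *: (x n.+1 0 + (x n.+1 0)^T)
    - (n.+1%:R^-1) ^+ 2 *: c n.+1 0.
Hypothesis St_eq : St + (A *m St + St *m A^T) + SD = 0.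
Hypothesis S2_eq :
  L *m (S2 + W 0) + (S2 + (W 0)^T) *m L^T + A *m St *m A^T - SD = 0.

Let e n := S n - n%:R^-1 *: St - (n%:R^-1) ^+ 2 *: S2.

(** The two Lyapunov equations are exactly what makes the terms of order
    n^-2 and n^-3 of the forcing vanish. *)
Let eS (n : nat) : (0 < n)%N -> let a := n.+1%:R^-1 in let b := n%:R^-1 in
  e n.+1 = (1%:M + a *: A) *m e n *m (1%:M + a *: A)^T +
    ((a ^+ 2 * b ^+ 2) *: (SD - S2 - A *m St *m A^T + A *m S2 *m A^T)
     + (- (a ^+ 2 * b * (a + b))) *: (L *m W 0 + (L *m W 0)^T)
     + a *: (y n.+1 0 + (y n.+1 0)^T))
    - a ^+ 2 *: (c n.+1 0 - p 0).
Proof.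
move=> n0 /=.
have xE : x n.+1 0 = y n.+1 0 + n.+1%:R^-1 *: U 0
    + (n.+1%:R^-1) ^+ 2 *: (L *m W 0).
  by rewrite /y -exprVn addrAC subrK subrK.
rewrite {1}/e SS xE.
set a := n.+1%:R^-1; set b := n%:R^-1.
have -> : S n = e n + b *: St + b ^+ 2 *: S2.
  by rewrite /e -/b addrAC subrK subrK.
have conjD X Z1 Z2 Z3 : X *m (Z1 + b *: Z2 + b ^+ 2 *: Z3) *m X^T =
    X *m Z1 *m X^T + b *: (X *m Z2 *m X^T) + b ^+ 2 *: (X *m Z3 *m X^T).
  by rewrite !(mulmxDl, mulmxDr, scaleE).
rewrite conjD (step_conj _ St) (step_conj _ S2).
have -> : A *m St + St *m A^T = - SD - St.
  move/eqP: St_eq; rewrite addr_eq0 => /eqP <-.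
  by rewrite [RHS]addrC addKr.
have -> : A *m S2 + S2 *m A^T = - (2 *: S2)
    - (L *m W 0 + (L *m W 0)^T) - A *m St *m A^T + SD.
  move: S2_eq; have -> : L *m (S2 + W 0) = S2 + A *m S2 + L *m W 0.
    by rewrite mulmxDr mulmxDl mul1mx.
  have -> : (S2 + (W 0)^T) *m L^T = S2 + S2 *m A^T + (L *m W 0)^T.
    rewrite trmx_mul [LHS]mulmxDl; congr (_ + _).
    by rewrite linearD /= trmx1 mulmxDr mulmx1.
  move: (L *m W 0) (A *m S2) (S2 *m A^T) (A *m St *m A^T) SD.
  move=> LW P1 P2 Q D /matrixP h; apply/matrixP => i k; move: (h i k).
  rewrite !mxE; lra.
move: (_ *m e n *m _) (y n.+1 0) (c n.+1 0) (U 0) (p 0) (L *m W 0) => ee yy cc u pp lw.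
move: (A *m S2 *m A^T) (A *m St *m A^T) => Q2 Qt.
apply/matrixP => i k; rewrite !mxE /a /b -[n.+1%:R]natr1; field.
by rewrite !(pnatr_eq0, natr1) -!lt0n n0.
Qed.

(** The eigenvalues of A leave room for b = 1 + 3/4 dl in the contraction, which
    beats the rate 2 + dl as 2b > 2 + dl. *)
Lemma covariance_expansion_bound : exists (N : nat) (C : R),
  forall n, (N <= n)%N -> nrm (e n) <= C * n%:R `^ (- (2 + dl)).
Proof.
have /andP[d0 d1] := dl01.
have hA' l : eigenvalue_C A l -> complex.Re l < - (1 + 3 / 4 * dl).
  by move=> /hA; lra.
have [N [k [a0 [k0 a00 ND Nn Ncontr]]]] := stable_norm hA'.
have [N1 [C1 [C10 hy]]] := cross_expansion.
have [N2 hN2] := inv_nat_small a00.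
have [Cg Cg0 hg] := geometric_le_cubic r01.
pose X1 := SD - S2 - A *m St *m A^T + A *m S2 *m A^T.
pose X2 := L *m W 0 + (L *m W 0)^T.
pose F := k * (4 * nrm X1 + 6 * nrm X2 + 2 * C1 + C0 * Cg).
have F0 : 0 <= F.
  by rewrite mulr_ge0 ?(ltW k0)// !addr_ge0// mulr_ge0// nrm_ge0.
have [|N3 [D hD]] := @contraction_power _ (fun n => N (e n))
    (maxn 1 (maxn N1 N2)) F dl dl01 F0; last first.
  exists N3, (k * D) => n hn; have [_ h] := Nn (e n); apply: (le_trans h).
  by rewrite -mulrA ler_wpM2l ?(ltW k0)// hD.
move=> n; rewrite !geq_max => /and3P[n0 nN1 nN2]; rewrite eS//.
set a := n.+1%:R^-1; set b := n%:R^-1.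
have a_ge0 : 0 <= a by rewrite invr_ge0.
have b_ge0 : 0 <= b by rewrite invr_ge0.
have ba : b <= 2 * a by exact: inv_le.
have a1 : a <= 1 by rewrite invf_le1 ?ler1n// ltr0n.
have a2 : 0 <= a ^+ 2 by rewrite exprn_ge0.
have a3 : 0 <= a ^+ 3 by rewrite exprn_ge0.
have a4 : 0 <= a ^+ 4 by rewrite exprn_ge0.
have aa0 : 0 <= a <= a0.
  by rewrite a_ge0; have [_] := hN2 _ (leqW nN2).
rewrite -addrA; apply: (le_trans (ND _ _)); apply: lerD.
  exact: (Ncontr a _ aa0).
apply: (le_trans (Nn _).1); rewrite -exprVn -/a /F -[leRHS]mulrA ler_wpM2l ?(ltW k0)//.
have b2 : b ^+ 2 <= 4 * a ^+ 2.
  rewrite (_ : 4 * a ^+ 2 = (2 * a) ^+ 2); last by ring.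
  by rewrite lerXn2r// nnegrE mulr_ge0.
have c1 : a ^+ 2 * b ^+ 2 <= 4 * a ^+ 4.
  by rewrite (_ : 4 * a ^+ 4 = a ^+ 2 * (4 * a ^+ 2)); [rewrite ler_wpM2l|ring].
have c2 : a ^+ 2 * b * (a + b) <= 6 * a ^+ 4.
  have : a ^+ 3 * b <= a ^+ 3 * (2 * a) by rewrite ler_wpM2l.
  have -> : a ^+ 2 * b * (a + b) = a ^+ 3 * b + a ^+ 2 * b ^+ 2 by ring.
  have -> : a ^+ 3 * (2 * a) = 2 * a ^+ 4 by ring.
  lra.
have hyy : a * nrm (y n.+1 0 + (y n.+1 0)^T) <= 2 * C1 * a ^+ 4.
  have h1 := hy n.+1 0%N (leqW nN1); rewrite expr0 mulr1 -exprVn -/a in h1.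
  have h2 : nrm (y n.+1 0 + (y n.+1 0)^T) <= 2 * (C1 * a ^+ 3).
    by apply: (le_trans (nrmD _ _)); rewrite nrm_tr; lra.
  rewrite (_ : 2 * C1 * a ^+ 4 = a * (2 * (C1 * a ^+ 3))); last by ring.
  by rewrite ler_wpM2l.
have hcc : a ^+ 2 * nrm (c n.+1 0 - p 0) <= C0 * Cg * a ^+ 4.
  have h1 : nrm (c n.+1 0 - p 0) <= C0 * (Cg * a ^+ 3).
    apply: (le_trans (cE _ _)); rewrite expr0 mulr1 ler_wpM2l//.
    by rewrite exprVn hg.
  have h2 := ler_wpM2l a2 h1; apply: (le_trans h2).
  have h3 : a ^+ 2 * (C0 * (Cg * a ^+ 3)) = a * (C0 * Cg * a ^+ 4) by ring.
  by rewrite h3 ler_piMl// !mulr_ge0.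
apply: (le_trans (nrmD _ _)); rewrite nrmN nrmZ (ger0_norm a2).
apply: (le_trans (lerD (sum_lin3 _ _ _ _ _ _) (lexx _))).
rewrite normrN !ger0_norm ?mulr_ge0 ?addr_ge0 ?exprn_ge0// -/X1 -/X2.
have m1 := ler_wpM2r (nrm_ge0 X1) c1.
have m2 := ler_wpM2r (nrm_ge0 X2) c2.
lra.
Qed.
End CovarianceExpansion.
(** * Integrals against mixtures of measures *)

Section KernelIntegrals.
Import HBNNSimple.

(** Every nonnegative measurable function is an increasing limit of simple
    ones. *)
Lemma ge0_measurable_ind d (T : measurableType d) (R : realType)
    (Q : (T -> \bar R) -> Prop) :
  (forall A, measurable A -> Q (fun x => (\1_A x)%:E)) ->
  (forall f g : T -> \bar R, measurable_fun setT f -> measurable_fun setT g ->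
     (forall x, 0 <= f x)%E -> (forall x, 0 <= g x)%E ->
     Q f -> Q g -> Q (fun x => f x + g x)%E) ->
  (forall (r : R) (f : T -> \bar R), 0 <= r -> measurable_fun setT f ->
     (forall x, 0 <= f x)%E -> Q f -> Q (fun x => r%:E * f x)%E) ->
  (forall f_ : nat -> T -> \bar R, (forall n, measurable_fun setT (f_ n)) ->
     (forall n x, 0 <= f_ n x)%E ->
     (forall x, nondecreasing_seq (f_ ^~ x)) ->
     (forall n, Q (f_ n)) -> Q (fun x => limn (f_ ^~ x))) ->
  forall f : T -> \bar R,
    measurable_fun setT f -> (forall x, 0 <= f x)%E -> Q f.
Proof.
move=> Q1 QD QZ Qlim f mf f0.
have Qeq (g h : T -> \bar R) : g =1 h -> Q g -> Q h by move=> /funext ->.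
have Qsimple (h : {nnsfun T >-> R}) : Q (fun x => (h x)%:E).
  pose F (r : R) x := (r * \1_(h @^-1` [set r]) x)%:E.
  have mF r : measurable_fun setT (F r).
    by apply/measurable_EFinP; apply: measurable_funM => //;
       exact: measurable_indic.
  have F0 r x : (0 <= F r x)%E.
    rewrite lee_fin; have [r0|r0] := leP 0 r; first by rewrite mulr_ge0.
    by rewrite preimage_nnfun0// indic0 mulr0.
  have QF r : Q (F r).
    have [r0|r0] := leP 0 r.
      apply: (Qeq (fun x => r%:E * (\1_(h @^-1` [set r]) x)%:E)%E) => //.
      apply: QZ => //; last exact: Q1.
      by apply/measurable_EFinP; exact: measurable_indic.
    apply: (Qeq (fun x => 0%:E * (\1_(h @^-1` [set r]) x)%:E)%E).
      by move=> x; rewrite /F preimage_nnfun0// indic0 mulr0 mul0e.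
    apply: QZ => //; last exact: Q1.
    by apply/measurable_EFinP; exact: measurable_indic.
  have [s hs] : exists s : seq R,
      forall x, h x = \sum_(r <- s) r * \1_(h @^-1` [set r]) x.
    exists (finmap.enum_fset (fset_set (range (h : T -> R)))) => x.
    by rewrite [LHS]fimfunE fsbig_finite.
  apply: (Qeq (fun x => \sum_(r <- s) F r x)%E).
    by move=> x; rewrite hs sumEFin.
  elim: s {hs} => [|r s IH].
    apply: (Qeq (fun x => 0%:E * (\1_(@setT T) x)%:E)%E).
      by move=> x; rewrite big_nil mul0e.
    apply: QZ => //; last exact: Q1.
    by apply/measurable_EFinP; exact: measurable_indic.
  apply: (Qeq (fun x => F r x + \sum_(r <- s) F r x)%E).
    by move=> x; rewrite big_cons.
  apply: QD; [exact: mF|exact: emeasurable_sum|exact: F0| |exact: QF|exact: IH].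
  by move=> x; exact: sume_ge0.
pose f_ := nnsfun_approx measurableT mf.
apply: (Qeq (fun x => limn (fun n => (f_ n x)%:E))).
  by move=> x; apply/cvg_lim => //; exact: cvg_nnsfun_approx.
apply: (Qlim (fun n x => (f_ n x)%:E)) => //.
- by move=> n; exact/measurable_EFinP.
- by move=> n x; rewrite lee_fin.
- by move=> x a b ab; rewrite lee_fin; exact/lefP/nd_nnsfun_approx.
Qed.

(** With phi the next state of a chain this is the tower rule for one
    transition; with phi the identity it computes integrals against a composite
    kernel. *)
Lemma ge0_integral_mixture d d' d'' (W : measurableType d'')
    (T : measurableType d) (Y : measurableType d')
    (R : realType) (nu : {measure set W -> \bar R}) (phi : W -> Y)
    (mu : {measure set T -> \bar R}) (k : T -> {measure set Y -> \bar R})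
    (E : set W) (D : set T) :
  measurable E -> measurable_fun setT phi -> measurable D ->
  (forall B, measurable B -> measurable_fun setT (k ^~ B)) ->
  (forall B, measurable B ->
     nu (E `&` phi @^-1` B) = \int[mu]_(x in D) k x B)%E ->
  forall g : Y -> \bar R, measurable_fun setT g -> (forall y, 0 <= g y)%E ->
  (\int[nu]_(w in E) g (phi w) = \int[mu]_(x in D) \int[k x]_y g y)%E.
Proof.
move=> mE mphi mD mk hnu.
have mI (g : Y -> \bar R) :
    measurable_fun setT g -> (forall y, 0 <= g y)%E ->
    measurable_fun D (fun x => \int[k x]_y g y)%E.
  move=> mg g0; apply: measurable_funS (measurable_fun_integral_kernel mk g0 mg).
    exact: measurableT.
  exact: subsetT.
have mc (g : Y -> \bar R) :
    measurable_fun setT g -> measurable_fun E (fun w => g (phi w)).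
  move=> mg; apply: measurable_funTS.
  exact: (measurableT_comp mg mphi).
apply: ge0_measurable_ind => [A mA|f g mf mg f0 g0 hf hg|r f r0 mf f0 hf|].
- rewrite (eq_integral (fun w => (\1_(phi @^-1` A) w)%:E))//.
  rewrite integral_indic//; last by rewrite -[X in measurable X]setTI; exact: mphi.
  rewrite setIC hnu//.
  by apply: eq_integral => x _; rewrite integral_indic// setIT.
- rewrite ge0_integralD//; [|exact: mc|exact: mc].
  rewrite hf hg -ge0_integralD//=.
  + by apply: eq_integral => x _; rewrite ge0_integralD.
  + by move=> x _; exact: integral_ge0.
  + exact: mI.
  + by move=> x _; exact: integral_ge0.
  + exact: mI.
- rewrite ge0_integralZl_EFin//; last exact: mc.
  rewrite hf -ge0_integralZl_EFin//=.
  + by apply: eq_integral => x _; rewrite ge0_integralZl_EFin.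
  + by move=> x _; exact: integral_ge0.
  + exact: mI.
move=> f_ mf f0 nd hf.
rewrite monotone_convergence//; last by move=> n; exact: mc.
transitivity (\int[mu]_(x in D) limn (fun n => \int[k x]_y f_ n y))%E.
  rewrite monotone_convergence//.
  - by congr (limn _); apply/funext => n; exact: hf.
  - by move=> n; exact: mI.
  - by move=> n x _; exact: integral_ge0.
  - by move=> x _ a b ab; apply: ge0_le_integral => // y _; exact: nd.
by apply: eq_integral => x _; rewrite monotone_convergence.
Qed.

End KernelIntegrals.
(** * Integrable real functions *)

Section RealIntegrals.
Context {d : measure_display} {T : measurableType d} {R : realType}.
Variable mu : {measure set T -> \bar R}.
Implicit Types f g : T -> R.

Definition integ f := mu.-integrable setT (fun x => (f x)%:E).

Lemma integ_mf f : integ f -> measurable_fun setT f.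
Proof. by move=> /integrableP[/measurable_EFinP]. Qed.

Lemma integ_le f g : measurable_fun setT f -> integ g ->
  (forall x, `|f x| <= g x) -> integ f.
Proof.
move=> mf ig fg; apply: le_integrable ig => //; first exact/measurable_EFinP.
move=> x _; rewrite lee_fin; apply: le_trans (fg x) _; exact: ler_norm.
Qed.

Lemma integD f g : integ f -> integ g -> integ (fun x => f x + g x).
Proof. by move=> hf hg; exact: (integrableD _ hf hg). Qed.

Lemma integB f g : integ f -> integ g -> integ (fun x => f x - g x).
Proof. by move=> hf hg; exact: (integrableB _ hf hg). Qed.

Lemma integZ k f : integ f -> integ (fun x => k * f x).
Proof. by move=> hf; exact: (integrableZl _ k hf). Qed.

Lemma integ_abs f : integ f -> integ (fun x => `|f x|).
Proof. by move=> hf; exact: (integrable_norm hf). Qed.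

Lemma integ_sum n (F : 'I_n -> T -> R) : (forall i, integ (F i)) ->
  integ (fun x => \sum_(i < n) F i x).
Proof.
move=> hF; rewrite /integ (_ : (fun x => _) =
    (fun x => \sum_(i < n) (F i x)%:E)%E).
  by apply: integrable_sum => // i _; exact: hF.
by apply/funext => x; rewrite sumEFin.
Qed.

Lemma Rint_sum n (F : 'I_n -> T -> R) : (forall i, integ (F i)) ->
  \int[mu]_x (\sum_(i < n) F i x) = \sum_(i < n) \int[mu]_x F i x.
Proof.
elim: n F => [|n IH] F hF.
  under eq_Rintegral do rewrite big_ord0.
  by rewrite big_ord0 /Rintegral integral0.
under eq_Rintegral do rewrite big_ord_recr.
rewrite RintegralD//; last 2 first.
- exact: integ_sum.
- exact: hF.
by rewrite big_ord_recr /= IH.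
Qed.

Lemma Rint_EFin f : integ f -> (\int[mu]_x f x)%:E = (\int[mu]_x (f x)%:E)%E.
Proof. by move=> hf; rewrite fineK//; exact: integrable_fin_num. Qed.

Lemma Rint_le f g : integ f -> integ g -> (forall x, `|f x| <= g x) ->
  `|\int[mu]_x f x| <= \int[mu]_x g x.
Proof.
move=> hf hg fg; apply: le_trans (le_normr_Rintegral _ hf) _ => //.
by apply: le_Rintegral => //; exact: integ_abs.
Qed.

Lemma integ_ge0 f : measurable_fun setT f -> (forall x, 0 <= f x) ->
  (\int[mu]_x (f x)%:E < +oo)%E -> integ f.
Proof.
move=> mf f0 hf; apply/integrableP; split; first exact/measurable_EFinP.
by under eq_integral do rewrite gee0_abs ?lee_fin//.
Qed.

End RealIntegrals.

(** * Conditioning on the past of a Markov chain *)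

Section MarkovPairing.
Context {dO : measure_display} {Omega : measurableType dO} {R : realType}.
Context {dZ : measure_display} {Z : measurableType dZ}.
Variables (P : {measure set Omega -> \bar R}) (K : R.-pker Z ~> Z).

(** The transition operator on real functions. *)
Definition kop (g : Z -> R) (z : Z) : R := \int[K z]_y g y.

Lemma kop_abs_ge0 (g : Z -> R) z : (forall y, 0 <= g y) -> 0 <= kop g z.
Proof. by move=> g0; apply: Rintegral_ge0. Qed.

Lemma measurable_kop (g : Z -> R) : measurable_fun setT g ->
  (forall z, integ (K z) g) -> measurable_fun setT (kop g).
Proof.
move=> mg ig.
have key (h : Z -> R) : measurable_fun setT h -> (forall z, 0 <= h z) ->
    (forall z, integ (K z) h) -> measurable_fun setT (kop h).
  move=> mh h0 ih; apply/measurable_EFinP.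
  rewrite (_ : _ \o _ = fun z => \int[K z]_y (h y)%:E)%E; last first.
    by apply/funext => z; rewrite /= Rint_EFin.
  apply: measurable_fun_integral_kernel => //.
  - by move=> U mU; exact: (measurable_kernel K U mU).
  - exact/measurable_EFinP.
have ip z : integ (K z) g^\+ by exact: (integrable_funrpos measurableT (ig z)).
have im z : integ (K z) g^\- by exact: (integrable_funrneg measurableT (ig z)).
rewrite (_ : kop g = kop g^\+ \- kop g^\-).
  apply: measurable_funB; apply: key => //.
  - exact: measurable_funrpos.
  - exact: measurable_funrneg.
apply/funext => z /=; rewrite /kop -RintegralB//; [|exact: ip|exact: im].
apply: eq_Rintegral => y _.
exact/esym/(congr1 (fun f => f y) (funrposBneg g)).
Qed.

Context {dS : measure_display} {S : measurableType dS}.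
Variables (X : Omega -> S) (X' Y : Omega -> Z).
Hypotheses (mX : measurable_fun setT X) (mX' : measurable_fun setT X')
  (mY : measurable_fun setT Y).
Hypothesis tr : forall C B, measurable C -> measurable B ->
  (P (X @^-1` C `&` Y @^-1` B) = \int[P]_(w in X @^-1` C) K (X' w) B)%E.

Let mpre C : measurable C -> measurable (X @^-1` C).
Proof. by move=> mC; rewrite -[X in measurable X]setTI; exact: mX. Qed.

Let mcomp dT (T : measurableType dT) (f : T -> R) (U : Omega -> T) :
  measurable_fun setT f ->
  measurable_fun setT U -> measurable_fun setT (fun w => f (U w)).
Proof. by move=> mf mU; exact: (measurableT_comp mf mU). Qed.

Let mecomp dT (T : measurableType dT) (f : T -> \bar R) (U : Omega -> T) :
  measurable_fun setT f ->
  measurable_fun setT U -> measurable_fun setT (fun w => f (U w)).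
Proof. by move=> mf mU; exact: (measurableT_comp mf mU). Qed.

Let pairing_ge0 (g : Z -> \bar R) (h : S -> \bar R) :
  measurable_fun setT g -> (forall y, 0 <= g y)%E ->
  (forall y, g y \is a fin_num) ->
  (forall z, \int[K z]_y g y \is a fin_num)%E ->
  measurable_fun setT h -> (forall y, 0 <= h y)%E ->
  (\int[P]_w (h (X w) * g (Y w)) = \int[P]_w (h (X w) * \int[K (X' w)]_y g y))%E.
Proof.
move=> mg g0 gfin Kgfin; move: h.
have mk B : measurable B -> measurable_fun setT (fun w => K (X' w) B).
  by move=> mB; exact: (measurableT_comp (measurable_kernel K _ mB) mX').
have mKg : measurable_fun setT (fun w => \int[K (X' w)]_y g y)%E.
  by apply: (measurable_fun_integral_kernel (l := fun w => K (X' w))).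
have Kg0 w : (0 <= \int[K (X' w)]_y g y)%E by exact: integral_ge0.
have mgY : measurable_fun setT (fun w => g (Y w)) by exact: mecomp.
apply: ge0_measurable_ind => [A mA|f1 f2 m1 m2 p1 p2 h1 h2|r f r0 mf f0 hf|].
- have := @ge0_integral_mixture _ _ _ _ _ _ R P Y P (fun w => K (X' w))
    (X @^-1` A) (X @^-1` A) (mpre mA) mY (mpre mA) mk
    (fun B mB => tr mA mB) g mg g0.
  rewrite integral_mkcond [in RHS]integral_mkcond => h.
  transitivity (\int[P]_w ((g \o Y) \_ (X @^-1` A)) w)%E.
    by apply: eq_integral => w _; rewrite epatch_indic /= muleC.
  by rewrite h; apply: eq_integral => w _; rewrite epatch_indic /= muleC.
- have mf1 := mecomp m1 mX; have mf2 := mecomp m2 mX.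
  under eq_integral do rewrite ge0_muleDl//.
  rewrite ge0_integralD//; last 4 first.
  + by move=> w _; exact: mule_ge0.
  + exact: emeasurable_funM.
  + by move=> w _; exact: mule_ge0.
  + exact: emeasurable_funM.
  rewrite h1 h2 -ge0_integralD//; last 4 first.
  + by move=> w _; exact: mule_ge0.
  + exact: emeasurable_funM.
  + by move=> w _; exact: mule_ge0.
  + exact: emeasurable_funM.
  by apply: eq_integral => w _; rewrite ge0_muleDl.
- have mf1 := mecomp mf mX.
  under eq_integral do rewrite -muleA.
  rewrite ge0_integralZl_EFin//; last 2 first.
  + by move=> w _; exact: mule_ge0.
  + exact: emeasurable_funM.
  rewrite hf -ge0_integralZl_EFin//; last 2 first.
  + by move=> w _; exact: mule_ge0.
  + exact: emeasurable_funM.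
  by apply: eq_integral => w _; rewrite muleA.
move=> f_ mf f0 nd hf.
have lim_mul (u : Omega -> \bar R) : measurable_fun setT u ->
    (forall w, 0 <= u w)%E -> (forall w, u w \is a fin_num) ->
    (\int[P]_w (limn (f_ ^~ (X w)) * u w) =
     limn (fun n => \int[P]_w (f_ n (X w) * u w)))%E.
  move=> mu u0 ufin; rewrite -monotone_convergence//; last 3 first.
  - by move=> n; apply: emeasurable_funM => //; exact: mecomp.
  - by move=> n w _; exact: mule_ge0.
  - by move=> w _ a b ab; rewrite lee_wpmul2r//; exact: nd.
  apply: eq_integral => w _.
  have cv : cvgn (f_ ^~ (X w)) by apply: ereal_nondecreasing_is_cvgn; exact: nd.
  by apply/esym/cvg_lim => //; exact: cvgeZr.
rewrite !lim_mul//; congr (limn _); apply/funext => n; exact: hf.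
Qed.

Let good (h : S -> R) (g : Z -> R) :=
  [/\ integ P (fun w => h (X w) * g (Y w)),
      integ P (fun w => h (X w) * kop g (X' w)) &
      \int[P]_w (h (X w) * g (Y w)) = \int[P]_w (h (X w) * kop g (X' w))].

Let goodB_r h g1 g2 : (forall z, integ (K z) g1) -> (forall z, integ (K z) g2) ->
  good h g1 -> good h g2 -> good h (fun z => g1 z - g2 z).
Proof.
move=> i1 i2 [a1 b1 c1] [a2 b2 c2].
have kB z : kop (fun z => g1 z - g2 z) z = kop g1 z - kop g2 z.
  by rewrite /kop RintegralB//; [exact: i1|exact: i2].
have e1 : (fun w => h (X w) * (g1 (Y w) - g2 (Y w))) =
    (fun w => h (X w) * g1 (Y w) - h (X w) * g2 (Y w)).
  by apply/funext => w; rewrite mulrBr.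
have e2 : (fun w => h (X w) * kop (fun z => g1 z - g2 z) (X' w)) =
    (fun w => h (X w) * kop g1 (X' w) - h (X w) * kop g2 (X' w)).
  by apply/funext => w; rewrite kB mulrBr.
rewrite /good e1 e2; split; [exact: integB|exact: integB|].
by rewrite !RintegralB// c1 c2.
Qed.

Let goodB_l h1 h2 g : good h1 g -> good h2 g -> good (fun z => h1 z - h2 z) g.
Proof.
move=> [a1 b1 c1] [a2 b2 c2].
have e1 : (fun w => (h1 (X w) - h2 (X w)) * g (Y w)) =
    (fun w => h1 (X w) * g (Y w) - h2 (X w) * g (Y w)).
  by apply/funext => w; rewrite mulrBl.
have e2 : (fun w => (h1 (X w) - h2 (X w)) * kop g (X' w)) =
    (fun w => h1 (X w) * kop g (X' w) - h2 (X w) * kop g (X' w)).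
  by apply/funext => w; rewrite mulrBl.
rewrite /good e1 e2; split; [exact: integB|exact: integB|].
by rewrite !RintegralB// c1 c2.
Qed.

Let good_ge0 (h : S -> R) (g : Z -> R) : measurable_fun setT h -> measurable_fun setT g ->
  (forall z, 0 <= h z) -> (forall z, 0 <= g z) -> (forall z, integ (K z) g) ->
  integ P (fun w => h (X w) * g (Y w)) -> good h g.
Proof.
move=> mh mg h0 g0 ig ihg.
have eq : (\int[P]_w (h (X w) * g (Y w))%:E =
    \int[P]_w (h (X w) * kop g (X' w))%:E)%E.
  have := @pairing_ge0 (EFin \o g) (EFin \o h).
  move=> /(_ _ _ _ _ _ _) hp.
  under eq_integral do rewrite EFinM.
  rewrite [LHS]hp//; last 3 first.
  - exact/measurable_EFinP.
  - by move=> z; exact: (integrable_fin_num _ (ig z)).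
  - exact/measurable_EFinP.
  by apply: eq_integral => w _ /=; rewrite EFinM Rint_EFin.
have iK : integ P (fun w => h (X w) * kop g (X' w)).
  apply: integ_ge0.
  - apply: measurable_funM; first exact: mcomp.
    by apply: mcomp => //; exact: measurable_kop.
  - by move=> w; rewrite mulr_ge0// kop_abs_ge0.
  - by rewrite -eq -Rint_EFin// ltry.
split => //; by rewrite /Rintegral eq.
Qed.

(** Conditioning on the past inside an expectation: g (Y) may be replaced by
    its conditional expectation (kop g) (X'). The variable X is an earlier state
    of the chain, or the identity onto the sigma-algebra of the past. *)
Lemma markov_pairing (h : S -> R) (g : Z -> R) :
  measurable_fun setT h -> measurable_fun setT g -> (forall z, integ (K z) g) ->
  integ P (fun w => h (X w) * g (Y w)) ->
  integ P (fun w => h (X w) * kop g (X' w)) /\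
  \int[P]_w (h (X w) * g (Y w)) = \int[P]_w (h (X w) * kop g (X' w)).
Proof.
move=> mh mg ig ihg; suff [] : good h g by [].
have ip z : integ (K z) g^\+ by exact: (integrable_funrpos measurableT (ig z)).
have im z : integ (K z) g^\- by exact: (integrable_funrneg measurableT (ig z)).
have posB T (f : T -> R) : f = (fun z => f^\+ z - f^\- z).
  by rewrite -[LHS]funrposBneg.
have pos_le T (f : T -> R) z : f^\+ z <= `|f z|.
  by rewrite /funrpos ge_max ler_norm normr_ge0.
have neg_le T (f : T -> R) z : f^\- z <= `|f z|.
  by rewrite /funrneg ge_max -normrN ler_norm normr_ge0.
have part (u : S -> R) (v : Z -> R) : measurable_fun setT u -> measurable_fun setT v ->
    (forall z, 0 <= u z <= `|h z|) -> (forall z, 0 <= v z <= `|g z|) ->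
    (forall z, integ (K z) v) -> good u v.
  move=> mu mv hu hv iv; apply: good_ge0 => //.
  - by move=> z; have /andP[] := hu z.
  - by move=> z; have /andP[] := hv z.
  apply: integ_le (integ_abs ihg) _.
    by apply: measurable_funM; exact: mcomp.
  move=> w; rewrite !normrM; have /andP[u0 u1] := hu (X w).
  by have /andP[v0 v1] := hv (Y w); rewrite (ger0_norm u0) (ger0_norm v0) ler_pM.
have hp := measurable_funrpos mh; have hn := measurable_funrneg mh.
have gp := measurable_funrpos mg; have gn := measurable_funrneg mg.
rewrite (posB _ h) (posB _ g); apply: goodB_l; apply: goodB_r => //;
  apply: part => // z; by rewrite ?funrpos_ge0 ?funrneg_ge0 ?pos_le ?neg_le.
Qed.

End MarkovPairing.
(** * Geometric ergodicity with weights V and sqrt V *)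

(** Real-valued form of V-uniform ergodicity: all integrals are finite numbers,
    and an explicit bound C V stands for the V-norm of g. *)
Definition ergodic_rate (R : realType) (dZ : measure_display)
    (Z : measurableType dZ) (V : Z -> R) (K : R.-pker Z ~> Z)
    (pi : probability Z R) (rho B : R) : Prop :=
  forall (g : Z -> R) (C : R), measurable_fun setT g -> 0 <= C ->
    (forall z, `|g z| <= C * V z) ->
    integ pi g /\ forall n z, integ (kstep K n z) g /\
      `|\int[kstep K n z]_y g y - \int[pi]_y g y| <= B * C * rho ^+ n * V z.

Section Ergodicity.
Context {R : realType} {dZ : measure_display} {Z : measurableType dZ}.
Variables (V : Z -> R) (K : R.-pker Z ~> Z) (pi : probability Z R).
Hypothesis mV : measurable_fun setT V.
Hypothesis V_ge1 : forall z, 1 <= V z.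
Hypothesis erg : V_uniformly_ergodic V K pi.

Let V_gt0 z : 0 < V z. Proof. exact: lt_le_trans (V_ge1 z). Qed.
Let V_ge0 z : 0 <= V z. Proof. exact: ltW. Qed.

(** The extended-real estimate applied to V itself makes the integrals of V
    finite, since the difference of two extended reals has absolute value +oo as
    soon as one of them is infinite; everything below V is then integrable. *)
Lemma ergodic_bound : exists (rho B : R),
  [/\ 0 < rho < 1, 0 <= B & ergodic_rate V K pi rho B].
Proof.
have [rho [B [rho01 hB]]] := erg; have /andP[rho0 rho1] := rho01.
exists rho, `|B|; split => //.
have ereal_bound (g : Z -> R) (C : R) : measurable_fun setT g -> 0 <= C ->
    (forall z, `|g z| <= C * V z) -> forall z n,
    (`| \int[kstep K n z]_y (g y)%:E - \int[pi]_y (g y)%:E |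
      <= (`|B| * C * rho ^+ n * V z)%:E)%E.
  move=> mg C0 hg z n.
  have vC : (Vnorm V g <= C%:E)%E.
    apply: ub_ereal_sup => _ [y _ <-].
    by rewrite lee_fin ler_pdivrMr.
  have v0 : (0 <= Vnorm V g)%E.
    apply: (@le_trans _ _ (`|g z| / V z)%:E); last first.
      by apply: ereal_sup_ubound; exists z.
    by rewrite lee_fin divr_ge0.
  have gL : LinftyV V g by split => //; exact: le_lt_trans vC (ltry _).
  apply: (le_trans (hB g gL z n)).
  have vfin : Vnorm V g \is a fin_num.
    by rewrite ge0_fin_numE//; exact: le_lt_trans vC (ltry _).
  rewrite -(fineK vfin) -!EFinM lee_fin.
  have vC' : fine (Vnorm V g) <= C by rewrite -lee_fin fineK.
  have v0' : 0 <= fine (Vnorm V g) by exact: fine_ge0.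
  have q0 : 0 <= rho ^+ n * V z by rewrite mulr_ge0// exprn_ge0// ltW.
  rewrite [leRHS](_ : _ = `|B| * C * (rho ^+ n * V z)); last by rewrite !mulrA.
  rewrite ler_wpM2r//.
  by apply: (le_trans (ler_wpM2r v0' (ler_norm B))); rewrite ler_wpM2l.
have VV z : `|V z| <= 1 * V z by rewrite mul1r ger0_norm.
have Vfin z n : (\int[kstep K n z]_y (V y)%:E < +oo)%E /\
    (\int[pi]_y (V y)%:E < +oo)%E.
  have := ereal_bound V 1 mV ler01 VV z n.
  have a0 : (0 <= \int[kstep K n z]_y (V y)%:E)%E.
    by apply: integral_ge0 => y _; rewrite lee_fin.
  have b0 : (0 <= \int[pi]_y (V y)%:E)%E.
    by apply: integral_ge0 => y _; rewrite lee_fin.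
  by case: (\int[kstep K n z]_y (V y)%:E)%E a0 => [a| |] //;
     case: (\int[pi]_y (V y)%:E)%E b0 => [b| |] // _ _ _; rewrite !ltry.
move=> g C mg C0 hg.
have iVpi : integ pi V.
  by apply: integ_ge0 => //; exact: (Vfin point 0%N).2.
have iVk n z : integ (kstep K n z) V.
  by apply: integ_ge0 => //; exact: (Vfin z n).1.
have igpi : integ pi g by apply: integ_le hg => //; exact: integZ.
have igk n z : integ (kstep K n z) g by apply: integ_le hg => //; exact: integZ.
split => // n z; split => //.
have := ereal_bound g C mg C0 hg z n.
by rewrite -!Rint_EFin// -EFinB abse_EFin lee_fin.
Qed.

End Ergodicity.
Section KernelIterates.
Context {R : realType} {dZ : measure_display} {Z : measurableType dZ}.
Variables (V : Z -> R) (K : R.-pker Z ~> Z) (pi : probability Z R).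
Variables (rho B : R).
Hypothesis mV : measurable_fun setT V.
Hypothesis V_ge1 : forall z, 1 <= V z.
Hypothesis rho01 : 0 < rho < 1.
Hypothesis B_ge0 : 0 <= B.
Hypothesis EB : ergodic_rate V K pi rho B.

Definition dominated (q g : Z -> R) :=
  measurable_fun setT g /\ exists2 C : R, 0 < C & forall z, `|g z| <= C * q z.

Let V_gt0 z : 0 < V z. Proof. exact: lt_le_trans (V_ge1 z). Qed.
Let V_ge0 z : 0 <= V z. Proof. exact: ltW. Qed.

Lemma dominated_integ_pi g : dominated V g -> integ pi g.
Proof. by move=> [mg [C C0 hg]]; have [] := EB mg (ltW C0) hg. Qed.

Lemma dominated_integ_kstep g n z : dominated V g -> integ (kstep K n z) g.
Proof.
by move=> [mg [C C0 hg]]; have [_ /(_ n z)[]] := EB mg (ltW C0) hg.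
Qed.

Lemma dominated_abs q (g : Z -> R) : dominated q g -> dominated q (fun z => `|g z|).
Proof.
move=> [mg [C C0 hg]]; split; first exact: measurableT_comp.
by exists C => // z; rewrite normr_id.
Qed.

Let kstepS_ge0 (g : Z -> R) n z : measurable_fun setT g ->
  (forall y, 0 <= g y) ->
  (\int[kstep K n.+1 z]_y (g y)%:E =
   \int[kstep K n z]_y \int[K y]_x (g x)%:E)%E.
Proof.
move=> mg g0.
apply: (@ge0_integral_mixture _ _ _ Z Z Z R (kstep K n.+1 z) id
  (kstep K n z) K setT setT) => //.
- by move=> U mU; exact: (measurable_kernel K U mU).
- by move=> U mU; rewrite setTI preimage_id.
- exact/measurable_EFinP.
Qed.

Let kstep0 (g : Z -> R) z : measurable_fun setT g ->
  (\int[kstep K 0 z]_y (g y)%:E = (g z)%:E)%E.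
Proof.
move=> mg; rewrite /= /kdirac integral_dirac//; last exact/measurable_EFinP.
by rewrite diracT mul1e.
Qed.

Lemma dominated_integ_K g z : dominated V g -> integ (K z) g.
Proof.
move=> dg; have [mg _] := dg.
have ma : measurable_fun setT (fun z => `|g z|) by exact: measurableT_comp.
have i1 : integ (K z) (fun y => `|g y|).
  apply: integ_ge0 => //.
  have ik := @dominated_integ_kstep _ 1 z (dominated_abs dg).
  have : (\int[kstep K 1 z]_y (`|g y|)%:E < +oo)%E by rewrite -Rint_EFin// ltry.
  rewrite kstepS_ge0//= /kdirac integral_dirac//.
    by rewrite diracT mul1e.
  apply: (measurable_fun_integral_kernel (l := K)) => //.
  - by move=> U mU; exact: (measurable_kernel K U mU).
  - exact/measurable_EFinP.
by apply: integ_le i1 _.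
Qed.

Let kstepS g n z : dominated V g ->
  integ (kstep K n z) (kop K g) /\
  \int[kstep K n.+1 z]_y g y = \int[kstep K n z]_y kop K g y.
Proof.
move=> dg; have [mg [C C0 hg]] := dg.
have key (h : Z -> R) : measurable_fun setT h -> (forall y, 0 <= h y <= `|g y|) ->
    dominated V h /\ integ (kstep K n z) (kop K h) /\
    \int[kstep K n.+1 z]_y h y = \int[kstep K n z]_y kop K h y.
  move=> mh hh; have h0 y : 0 <= h y by have /andP[] := hh y.
  have dh : dominated V h.
    split => //; exists C => // y; rewrite ger0_norm//.
    by apply: le_trans (hg y); have /andP[] := hh y.
  split => //.
  have e : (\int[kstep K n.+1 z]_y (h y)%:E =
      \int[kstep K n z]_y (kop K h y)%:E)%E.
    rewrite kstepS_ge0//; apply: eq_integral => y _.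
    by rewrite Rint_EFin//; exact: dominated_integ_K.
  split; last by rewrite /Rintegral e.
  apply: integ_ge0.
  - by apply: measurable_kop => // y; exact: dominated_integ_K.
  - by move=> y; exact: kop_abs_ge0.
  - by rewrite -e -Rint_EFin ?ltry//; exact: dominated_integ_kstep.
have [|dp [ip ep]] := key g^\+ (measurable_funrpos mg).
  by move=> y; rewrite funrpos_ge0 /funrpos ge_max ler_norm normr_ge0.
have [|dn [jn en]] := key g^\- (measurable_funrneg mg).
  by move=> y; rewrite funrneg_ge0 /funrneg ge_max -normrN ler_norm normr_ge0.
have gE y : g y = g^\+ y - g^\- y.
  exact/esym/(congr1 (fun f => f y) (funrposBneg g)).
have kE : kop K g = (fun y => kop K g^\+ y - kop K g^\- y).
  apply/funext => y; rewrite /kop -RintegralB//; last 2 first.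
  - exact: dominated_integ_K.
  - exact: dominated_integ_K.
  by apply: eq_Rintegral => x _; exact: gE.
rewrite kE; split; first exact: integB.
rewrite RintegralB// -ep -en -RintegralB//; last 2 first.
- exact: dominated_integ_kstep.
- exact: dominated_integ_kstep.
by apply: eq_Rintegral => x _; exact: gE.
Qed.

Lemma kop_kstep1 g z : dominated V g -> kop K g z = \int[kstep K 1 z]_y g y.
Proof.
move=> dg; have [_ ->] := kstepS 0 z dg; have [mg _] := dg.
rewrite [RHS]/Rintegral kstep0//.
by apply: measurable_kop => // y; exact: dominated_integ_K.
Qed.

Lemma dominated_kop g : dominated V g -> dominated V (kop K g).
Proof.
move=> dg; have [mg [C C0 hg]] := dg; split.
  by apply: measurable_kop => // y; exact: dominated_integ_K.
have piV0 : 0 <= \int[pi]_y V y by exact: Rintegral_ge0.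
exists (C * (\int[pi]_y V y + B * rho + 1)).
  rewrite mulr_gt0// ltr_wpDl// addr_ge0// mulr_ge0//.
  by have /andP[/ltW] := rho01.
move=> z; have VV y : `|V y| <= 1 * V y by rewrite mul1r ger0_norm.
have [iV /(_ 1%N z)[iVk bV]] := EB mV ler01 VV.
rewrite kop_kstep1//.
apply: (@le_trans _ _ (\int[kstep K 1 z]_y (C * V y))).
  by apply: Rint_le => //; [exact: dominated_integ_kstep|exact: integZ].
rewrite RintegralZl// -mulrA ler_wpM2l ?(ltW C0)//.
have : \int[kstep K 1 z]_y V y <= \int[pi]_y V y + B * rho * V z.
  have := le_trans (ler_norm _) bV; rewrite mulr1 expr1; lra.
move=> /le_trans; apply.
have : \int[pi]_y V y <= \int[pi]_y V y * V z by rewrite ler_peMr.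
by rewrite !mulrDl mul1r; have := V_ge0 z; lra.
Qed.

Lemma kopB g1 g2 z : dominated V g1 -> dominated V g2 ->
  kop K (fun y => g1 y - g2 y) z = kop K g1 z - kop K g2 z.
Proof.
by move=> d1 d2; rewrite /kop RintegralB//; exact: dominated_integ_K.
Qed.

Lemma iter_kop n g : dominated V g -> dominated V (iter n (kop K) g) /\
  forall z, iter n (kop K) g z = \int[kstep K n z]_y g y.
Proof.
elim: n g => [|n IH] g dg.
  split => // z; have [mg _] := dg.
  by rewrite /Rintegral kstep0.
rewrite iterSr; have [h1 h2] := IH _ (dominated_kop dg); split => // z.
by rewrite h2; have [_ ->] := kstepS n z dg.
Qed.

Lemma iter_kop_ergodic n (g : Z -> R) C z : measurable_fun setT g -> 0 < C ->
  (forall y, `|g y| <= C * V y) ->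
  `|iter n (kop K) g z - \int[pi]_y g y| <= B * C * rho ^+ n * V z.
Proof.
move=> mg C0 hg; have dg : dominated V g by split => //; exists C.
have [_ ->] := iter_kop n dg.
by have [_ /(_ n z)[]] := EB mg (ltW C0) hg.
Qed.

Local Notation W := (fun z => Num.sqrt (V z)).
Local Notation r := (Num.sqrt rho).

Let W_gt0 z : 0 < W z. Proof. by rewrite sqrtr_gt0. Qed.
Let WW z : W z ^+ 2 = V z. Proof. by rewrite sqr_sqrtr. Qed.
Let W_le z : W z <= V z.
Proof.
rewrite -[leRHS]WW expr2 ler_peMr ?(ltW (W_gt0 z))//.
by rewrite -[leLHS]sqrtr1 ler_wsqrtr.
Qed.

Lemma dominated_sqrt g : dominated W g -> dominated V g.
Proof.
move=> [mg [C C0 hg]]; split => //; exists C => // z.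
by apply: (le_trans (hg z)); rewrite ler_wpM2l// ltW.
Qed.

Lemma dominatedM f g : dominated W f -> dominated W g ->
  dominated V (fun z => f z * g z).
Proof.
move=> [mf [C C0 hf]] [mg [D D0 hg]]; split; first exact: measurable_funM.
exists (C * D); first exact: mulr_gt0.
move=> z; rewrite normrM -WW expr2 mulrACA.
by apply: ler_pM.
Qed.

(** Geometric ergodicity with weight V transfers to the weight sqrt V: cut g at
    the level t of order rho^(n/2) sqrt V(z). The part below t contributes at
    most 2t, and the part above is at most g^2/t, hence has V-norm of order
    1/t. *)
Lemma iter_kop_sqrt n (g : Z -> R) C z : measurable_fun setT g -> 0 < C ->
  (forall y, `|g y| <= C * W y) -> \int[pi]_y g y = 0 ->
  `|iter n (kop K) g z| <= (2 + B) * C * r ^+ n * W z.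
Proof.
move=> mg C0 hg g0; have /andP[rho0 rho1] := rho01.
have dg : dominated V g by apply: dominated_sqrt; split => //; exists C.
pose t := C * r ^+ n * W z.
have r0 : 0 < r by rewrite sqrtr_gt0.
have t0 : 0 < t by rewrite !mulr_gt0 ?exprn_gt0.
pose g1 y := Num.max (Num.min (g y) t) (- t).
pose g2 y := g y - g1 y.
have mg1 : measurable_fun setT g1.
  apply: measurable_maxr; last exact: measurable_cst.
  by apply: measurable_minr => //; exact: measurable_cst.
have mg2 : measurable_fun setT g2 by exact: measurable_funB.
have b1 y : `|g1 y| <= t.
  rewrite ler_norml /g1 le_max lexx orbT/= ge_max ge_min lexx orbT/=; lra.
have b2 y : `|g2 y| <= C ^+ 2 / t * V y.
  apply: (@le_trans _ _ (g y ^+ 2 / t)); last first.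
    rewrite [leRHS]mulrAC ler_wpM2r ?invr_ge0 ?(ltW t0)//.
    rewrite -WW -exprMn -[leLHS]real_normK ?num_real// lerXn2r ?nnegrE ?normr_ge0//.
    by rewrite mulr_ge0 ?(ltW C0)// ltW.
  rewrite ler_pdivlMr// /g2 /g1.
  have [h1|h1] := leP (g y) t.
    have [h2|h2] := leP (- t) (g y).
      by rewrite subrr normr0 mul0r sqr_ge0.
    by rewrite ltr0_norm; nra.
  have -> : Num.max t (- t) = t by apply/max_idPl; lra.
  by rewrite gtr0_norm; nra.
have D0 : 0 < C ^+ 2 / t by rewrite divr_gt0// exprn_gt0.
have [i2 /(_ n z)[k2 e2]] := EB mg2 (ltW D0) b2.
have b1' y : `|g1 y| <= t * V y.
  by apply: (le_trans (b1 y)); rewrite ler_peMr// ltW.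
have [i1 /(_ n z)[k1 _]] := EB mg1 (ltW t0) b1'.
have [_ ->] := iter_kop n dg.
have gE y : g y = g1 y + g2 y by rewrite /g2 addrC subrK.
have -> : \int[kstep K n z]_y g y =
    \int[kstep K n z]_y g1 y + \int[kstep K n z]_y g2 y.
  by rewrite -RintegralD//; apply: eq_Rintegral => y _; exact: gE.
have piE : \int[pi]_y g1 y + \int[pi]_y g2 y = 0.
  by rewrite -RintegralD// -g0; apply: eq_Rintegral => y _; rewrite -gE.
have small (mu : {measure set Z -> \bar R}) : integ mu g1 ->
    (mu setT <= 1)%E -> `|\int[mu]_y g1 y| <= t.
  move=> im m1; have [mT0 mTfin] : (0 <= mu setT)%E /\ mu setT \is a fin_num.
    by split=> //; rewrite ge0_fin_numE//; exact: le_lt_trans m1 (ltry _).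
  have ict : integ mu (fun=> t).
    apply: integ_ge0 => //; first by move=> _; exact: ltW.
    rewrite integral_cst//; apply: (@le_lt_trans _ _ (t%:E * 1)%E).
      by rewrite lee_wpmul2l// lee_fin ltW.
    by rewrite mule1 ltry.
  apply: (le_trans (Rint_le im ict b1)).
  rewrite Rintegral_cst// ler_piMr ?(ltW t0)//.
  by rewrite -lee_fin fineK.
have s1 : `|\int[kstep K n z]_y g1 y| <= t.
  by apply: small => //; exact: sprob_kernel_le1.
have s2 : `|\int[pi]_y g1 y| <= t by apply: small => //; exact: probability_le1.
have -> : \int[kstep K n z]_y g1 y + \int[kstep K n z]_y g2 y =
    (\int[kstep K n z]_y g1 y - \int[pi]_y g1 y) +
    (\int[kstep K n z]_y g2 y - \int[pi]_y g2 y).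
  by rewrite addrACA -opprD piE subr0.
apply: (le_trans (ler_normD _ _)).
apply: (@le_trans _ _ ((t + t) + B * t)); last first.
  by rewrite le_eqVlt; apply/orP; left; apply/eqP; rewrite /t; ring.
apply: lerD; first by apply: (le_trans (ler_normB _ _)); exact: lerD.
apply: (le_trans e2); rewrite -!mulrA ler_wpM2l// [leLHS]mulrCA -WW.
have -> : rho ^+ n = (r ^+ n) ^+ 2.
  by rewrite -exprM mulnC exprM sqr_sqrtr// ltW.
rewrite le_eqVlt; apply/orP; left; apply/eqP.
have q0 : r ^+ n != 0 by rewrite gt_eqF// exprn_gt0.
rewrite /t; move: (r ^+ n) (W z) q0 (W_gt0 z) => q w q0 w0; field.
by rewrite q0 !gt_eqF.
Qed.

End KernelIterates.
(** * Square-integrable vectors and their cross moments *)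

Section SquareIntegrable.
Context {d : measure_display} {T : measurableType d} {R : realType}.
Variable P : probability T R.

Definition l2 (f : T -> R) :=
  measurable_fun setT f /\ integ P (fun x => f x ^+ 2).

Lemma integ_cst k : integ P (fun=> k).
Proof.
exact: finite_measure_integrable_cst.
Qed.

Lemma l2M f g : l2 f -> l2 g -> integ P (fun x => f x * g x).
Proof.
move=> [mf hf] [mg hg]; apply: integ_le (integD hf hg) _.
  exact: measurable_funM.
move=> x; rewrite ler_norml; apply/andP; split.
  by have := sqr_ge0 (f x + g x); have := sqr_ge0 (f x); have := sqr_ge0 (g x); nra.
by have := sqr_ge0 (f x - g x); have := sqr_ge0 (f x); have := sqr_ge0 (g x); nra.
Qed.

Lemma l2_cst k : l2 (fun=> k).
Proof. by split=> //; exact: integ_cst. Qed.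

Lemma l2D f g : l2 f -> l2 g -> l2 (fun x => f x + g x).
Proof.
move=> hf hg; have [mf if2] := hf; have [mg ig2] := hg.
split; first exact: measurable_funD.
rewrite (_ : (fun x => _) =
    (fun x => (f x ^+ 2 + g x ^+ 2) + 2 * (f x * g x))).
  by apply: integD; [exact: integD|apply: integZ; exact: l2M].
by apply/funext => x; ring.
Qed.

Lemma l2Z k f : l2 f -> l2 (fun x => k * f x).
Proof.
move=> [mf if2]; split; first by apply: measurable_funM.
rewrite (_ : (fun x => _) = (fun x => k ^+ 2 * f x ^+ 2)); first exact: integZ.
by apply/funext => x; ring.
Qed.

Lemma l2_sum n (F : 'I_n -> T -> R) : (forall i, l2 (F i)) ->
  l2 (fun x => \sum_(i < n) F i x).
Proof.
elim: n F => [|n IH] F hF.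
  by rewrite (_ : (fun x => _) = (fun=> 0)); [exact: l2_cst|
     apply/funext => x; rewrite big_ord0].
rewrite (_ : (fun x => _) =
    (fun x => \sum_(i < n) F (widen_ord (leqnSn n) i) x + F ord_max x)).
  by apply: l2D; [exact: IH|exact: hF].
by apply/funext => x; rewrite big_ord_recr.
Qed.

End SquareIntegrable.

Section CrossMoment.
Context {dT : measure_display} {T : measurableType dT} {R : realType} {d : nat}.
Variable P : probability T R.
Implicit Types X Y : T -> 'cV[R]_d.

Definition l2v X := forall i, l2 P (fun w => X w i 0).

Lemma cross_momentE X Y i j :
  cross_moment P X Y i j = \int[P]_w (X w i 0 * Y w j 0).
Proof.
rewrite /cross_moment /expect_mx mxE unlock; congr fine.
by apply: eq_integral => w _; rewrite !mxE big_ord1 mxE.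
Qed.

Lemma cross_moment_tr X Y : (cross_moment P X Y)^T = cross_moment P Y X.
Proof.
apply/matrixP => i j; rewrite mxE !cross_momentE.
by apply: eq_Rintegral => w _; rewrite mulrC.
Qed.

Lemma l2vD X Y : l2v X -> l2v Y -> l2v (fun w => X w + Y w).
Proof.
move=> hX hY i; rewrite (_ : (fun w => _) = (fun w => X w i 0 + Y w i 0)).
  exact: l2D.
by apply/funext => w; rewrite mxE.
Qed.

Lemma l2vZ k X : l2v X -> l2v (fun w => k *: X w).
Proof.
move=> hX i; rewrite (_ : (fun w => _) = (fun w => k * X w i 0)).
  exact: l2Z.
by apply/funext => w; rewrite mxE.
Qed.

Lemma l2v_mul (M : 'M[R]_d) X : l2v X -> l2v (fun w => M *m X w).
Proof.
move=> hX i; rewrite (_ : (fun w => _) = (fun w => \sum_j M i j * X w j 0)).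
  by apply: l2_sum => j; exact: l2Z.
by apply/funext => w; rewrite mxE.
Qed.

Lemma cross_momentDl X1 X2 Y : l2v X1 -> l2v X2 -> l2v Y ->
  cross_moment P (fun w => X1 w + X2 w) Y =
  cross_moment P X1 Y + cross_moment P X2 Y.
Proof.
move=> h1 h2 hY; apply/matrixP => i j; rewrite cross_momentE [RHS]mxE !cross_momentE -RintegralD//.
- by apply: eq_Rintegral => w _; rewrite mxE mulrDl.
- exact: l2M.
- exact: l2M.
Qed.

Lemma cross_momentZl k X Y : l2v X -> l2v Y ->
  cross_moment P (fun w => k *: X w) Y = k *: cross_moment P X Y.
Proof.
move=> h1 hY; apply/matrixP => i j; rewrite cross_momentE [RHS]mxE !cross_momentE -RintegralZl//.
- by apply: eq_Rintegral => w _; rewrite mxE mulrA.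
- exact: l2M.
Qed.

Lemma cross_moment_mull (M : 'M[R]_d) X Y : l2v X -> l2v Y ->
  cross_moment P (fun w => M *m X w) Y = M *m cross_moment P X Y.
Proof.
move=> hX hY; apply/matrixP => i j; rewrite cross_momentE [RHS]mxE.
under eq_Rintegral do rewrite mxE mulr_suml.
rewrite Rint_sum; last first.
  move=> k; under eq_fun do rewrite -mulrA.
  by apply: integZ; exact: l2M.
apply: eq_bigr => k _; rewrite cross_momentE -RintegralZl//; last exact: l2M.
by apply: eq_Rintegral => w _; rewrite mulrA.
Qed.

Lemma cross_momentDr X Y1 Y2 : l2v X -> l2v Y1 -> l2v Y2 ->
  cross_moment P X (fun w => Y1 w + Y2 w) =
  cross_moment P X Y1 + cross_moment P X Y2.
Proof.
move=> hX h1 h2; rewrite -cross_moment_tr cross_momentDl// linearD /=.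
by rewrite !cross_moment_tr.
Qed.

Lemma cross_momentZr k X Y : l2v X -> l2v Y ->
  cross_moment P X (fun w => k *: Y w) = k *: cross_moment P X Y.
Proof.
move=> hX hY; rewrite -cross_moment_tr cross_momentZl// linearZ /=.
by rewrite !cross_moment_tr.
Qed.

Lemma cross_moment_mulr (M : 'M[R]_d) X Y : l2v X -> l2v Y ->
  cross_moment P X (fun w => M *m Y w) = cross_moment P X Y *m M^T.
Proof.
by move=> hX hY; rewrite -cross_moment_tr cross_moment_mull// trmx_mul
  !cross_moment_tr.
Qed.

Lemma l2vB X Y : l2v X -> l2v Y -> l2v (fun w => X w - Y w).
Proof.
move=> hX hY; rewrite (_ : (fun w => _) = (fun w => X w + (-1) *: Y w)).
  by apply: l2vD => //; exact: l2vZ.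
by apply/funext => w; rewrite scaleN1r.
Qed.

Lemma cross_momentBl X1 X2 Y : l2v X1 -> l2v X2 -> l2v Y ->
  cross_moment P (fun w => X1 w - X2 w) Y =
  cross_moment P X1 Y - cross_moment P X2 Y.
Proof.
move=> h1 h2 hY; rewrite -[in RHS]scaleN1r -cross_momentZl//.
rewrite -cross_momentDl//; last exact: l2vZ.
by congr cross_moment; apply/funext => w; rewrite scaleN1r.
Qed.

Lemma cross_momentBr X Y1 Y2 : l2v X -> l2v Y1 -> l2v Y2 ->
  cross_moment P X (fun w => Y1 w - Y2 w) =
  cross_moment P X Y1 - cross_moment P X Y2.
Proof.
move=> hX h1 h2; rewrite -cross_moment_tr cross_momentBl// linearB /=.
by rewrite !cross_moment_tr.
Qed.

Lemma cross_moment_ae X X' Y Y' :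
  (forall i, measurable_fun setT (fun w => X w i 0)) ->
  (forall i, measurable_fun setT (fun w => X' w i 0)) ->
  (forall i, measurable_fun setT (fun w => Y w i 0)) ->
  (forall i, measurable_fun setT (fun w => Y' w i 0)) ->
  (forall i, {ae P, forall w, X w i 0 = X' w i 0}) ->
  (forall i, {ae P, forall w, Y w i 0 = Y' w i 0}) ->
  cross_moment P X Y = cross_moment P X' Y'.
Proof.
move=> mX mX' mY mY' eX eY; apply/matrixP => i j; rewrite !cross_momentE.
congr fine; apply: ae_eq_integral => //.
- by apply/measurable_EFinP; exact: measurable_funM.
- by apply/measurable_EFinP; exact: measurable_funM.
- by apply: filterS2 (eX i) (eY j) => w /= -> ->.
Qed.

(** The quadratic form at x is the second moment of x^T X. *)
Lemma cross_moment_psd X : l2v X -> forall x : 'cV[R]_d,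
  0 <= (x^T *m cross_moment P X X *m x) 0 0.
Proof.
move=> hX x.
have -> : (x^T *m cross_moment P X X *m x) 0 0 =
    \int[P]_w ((\sum_i x i 0 * X w i 0) ^+ 2).
  under eq_Rintegral do rewrite expr2 mulr_suml.
  rewrite mxE Rint_sum; last first.
    move=> i; apply: l2M; first exact: l2Z.
    by apply: l2_sum => k; exact: l2Z.
  under eq_bigr do rewrite mxE mulr_suml.
  rewrite exchange_big /=; apply: eq_bigr => i _.
  under eq_Rintegral do rewrite mulr_sumr.
  rewrite Rint_sum; last by move=> k; apply: l2M; exact: l2Z.
  apply: eq_bigr => j _; rewrite [x^T _ _]mxE cross_momentE -RintegralZl//; last first.
    exact: l2M.
  rewrite -RintegralZr//; last by apply: integZ; exact: l2M.
  by apply: eq_Rintegral => w _; ring.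
by apply: Rintegral_ge0 => w _; exact: sqr_ge0.
Qed.

End CrossMoment.
(** * Iterates of the transition operator on vectors *)

Section Iterates.
Context {R : realType} {dZ : measure_display} {Z : measurableType dZ} {d : nat}.
Variable K : R.-pker Z ~> Z.

Definition iterate (j : nat) (g : Z -> 'cV[R]_d) (z : Z) : 'cV[R]_d :=
  \col_i iter j (kop K) (fun y => g y i 0) z.

End Iterates.

Lemma history_preimage {dO : measure_display} {Omega : measurableType dO}
    {dZ : measure_display} {Z : measurableType dZ} (I : Type)
    (X : I -> Omega -> Z) (D : set I) i C :
  D i -> measurable C -> history X D (X i @^-1` C).
Proof.
move=> Di mC; apply: sub_gen_smallest; exists i => //.
by exists C => //; rewrite setTI.
Qed.

Lemma dominated_uniform (R : realType) (dZ : measure_display)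
    (Z : measurableType dZ) (d : nat) (q : Z -> R) (g : Z -> 'cV[R]_d) :
  (forall z, 0 <= q z) -> (forall i, dominated q (fun z => g z i 0)) ->
  exists2 C : R, 0 < C & forall i z, `|g z i 0| <= C * q z.
Proof.
move=> q0 hg.
have /choice[C hC] : forall i, exists C : R,
    0 < C /\ forall z, `|g z i 0| <= C * q z.
  by move=> i; have [_ [C C0 hC]] := hg i; exists C.
exists (1 + \sum_i C i).
  by rewrite ltr_pwDl//; apply: sumr_ge0 => i _; apply: ltW; have [] := hC i.
move=> i z; have [C0 h] := hC i; apply: (le_trans (h z)); rewrite ler_wpM2r//.
rewrite (bigD1 i)//= addrCA lerDl addr_ge0//.
by apply: sumr_ge0 => k _; apply: ltW; have [] := hC k.
Qed.

Section IterateBounds.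
Context {R : realType} {dZ : measure_display} {Z : measurableType dZ} {d : nat}.
Variables (V : Z -> R) (K : R.-pker Z ~> Z) (pi : probability Z R).
Variables (rho B : R).
Hypothesis mV : measurable_fun setT V.
Hypothesis V_ge1 : forall z, 1 <= V z.
Hypothesis rho01 : 0 < rho < 1.
Hypothesis B_ge0 : 0 <= B.
Hypothesis EB : ergodic_rate V K pi rho B.
Local Notation W := (fun z => Num.sqrt (V z)).
Local Notation r := (Num.sqrt rho).

Variable g : Z -> 'cV[R]_d.
Hypothesis gW : forall i, dominated W (fun z => g z i 0).
Hypothesis g0 : forall i, \int[pi]_z g z i 0 = 0.

Lemma iterate_bound : exists2 C : R, 0 < C &
  forall j i z, `|iterate K j g z i 0| <= C * r ^+ j * W z.
Proof.
have [|C C0 hC] := dominated_uniform _ gW; first by move=> z; exact: sqrtr_ge0.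
exists ((2 + B) * C); first by rewrite mulr_gt0// ltr_pwDl.
move=> j i z; rewrite mxE; apply: (iter_kop_sqrt mV V_ge1 rho01 B_ge0 EB) => //.
exact: (gW i).1.
Qed.

Lemma dominated_iterate j i : dominated W (fun z => iterate K j g z i 0).
Proof.
have e : (fun z => iterate K j g z i 0) = iter j (kop K) (fun y => g y i 0).
  by apply/funext => z; rewrite mxE.
split.
  rewrite e; have dV := dominated_sqrt V_ge1 (gW i).
  by have [[]] := iter_kop mV V_ge1 rho01 B_ge0 EB j dV.
have [C C0 hC] := iterate_bound; exists (C * r ^+ j); last exact: hC.
by have /andP[rho0 _] := rho01; rewrite mulr_gt0// exprn_gt0// sqrtr_gt0.
Qed.

Lemma stationary_cross_bound (f : Z -> 'cV[R]_d) :
  (forall i, dominated W (fun z => f z i 0)) ->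
  exists2 C : R, 0 <= C & forall j,
    nrm (cross_moment pi f (iterate K j g)) <= C * r ^+ j.
Proof.
move=> fW.
have [|C C0 hC] := dominated_uniform _ fW; first by move=> z; exact: sqrtr_ge0.
have [D D0 hD] := iterate_bound.
have V0 z : 0 <= V z by apply: le_trans (V_ge1 z).
have iV : integ pi V.
  have [] // := EB mV (@ler01 R).
  by move=> z; rewrite mul1r ger0_norm.
have piV0 : 0 <= \int[pi]_y V y by exact: Rintegral_ge0.
exists (d%:R * (d%:R * (C * D * \int[pi]_y V y))).
  by rewrite !mulr_ge0 ?(ltW C0) ?(ltW D0).
move=> j; rewrite (_ : _ * r ^+ j =
    d%:R * (d%:R * (C * (D * r ^+ j) * \int[pi]_y V y))); last by ring.
apply: nrm_le => a b; rewrite cross_momentE.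
have hfg z : `|f z a 0 * iterate K j g z b 0| <= C * (D * r ^+ j) * V z.
  rewrite normrM -[V z]sqr_sqrtr// expr2 mulrACA.
  by apply: ler_pM.
rewrite -RintegralZl//; apply: Rint_le => //; last exact: integZ.
apply: integ_le hfg; last exact: integZ.
by apply: measurable_funM; [exact: (fW a).1|exact: (dominated_iterate j b).1].
Qed.

End IterateBounds.

(** * The chain with fixed initial condition *)

Section Chain.
Context {R : realType} {dZ : measure_display} {Z : measurableType dZ} {d : nat}.
Variables (V : Z -> R) (K : R.-pker Z ~> Z) (pi : probability Z R).
Variables (rho B : R).
Hypothesis mV : measurable_fun setT V.
Hypothesis V_ge1 : forall z, 1 <= V z.
Hypothesis rho01 : 0 < rho < 1.
Hypothesis B_ge0 : 0 <= B.
Hypothesis EB : ergodic_rate V K pi rho B.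
Context {dO : measure_display} {Omega : measurableType dO}.
Variables (P : probability Omega R) (Phi : nat -> Omega -> Z) (z0 : Z).
Hypothesis mc : markov_chain P K Phi.
Hypothesis Phi0 : {ae P, forall w, Phi 0%N w = z0}.

Local Notation W := (fun z => Num.sqrt (V z)).

Let V_gt0 z : 0 < V z. Proof. exact: lt_le_trans (V_ge1 z). Qed.
Let V_ge0 z : 0 <= V z. Proof. exact: ltW. Qed.
Let domVE g := @dominated_integ_K R dZ Z V K pi rho B EB g.
Let domK g := @dominated_kop R dZ Z V K pi rho B mV V_ge1 rho01 B_ge0 EB g.
Let domWV g := @dominated_sqrt R dZ Z V V_ge1 g.
Let domM f g := @dominatedM R dZ Z V V_ge1 f g.

Let mPhi n : measurable_fun setT (Phi n). Proof. exact: mc.1. Qed.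

Let mcomp (f : Z -> R) n : measurable_fun setT f ->
  measurable_fun setT (fun w => f (Phi n w)).
Proof. by move=> mf; exact: (measurableT_comp mf (mPhi n)). Qed.

Let tr k m : (k <= m)%N -> forall C B, measurable C -> measurable B ->
  (P (Phi k @^-1` C `&` Phi m.+1 @^-1` B) =
   \int[P]_(w in Phi k @^-1` C) K (Phi m w) B)%E.
Proof.
move=> km C U mC mU; apply: mc.2 => //.
exact: history_preimage.
Qed.

Let domV : dominated V V.
Proof. by split=> //; exists 1 => // z; rewrite mul1r ger0_norm. Qed.

Let int0 (h : Z -> R) : measurable_fun setT h ->
  (\int[P]_w (h (Phi 0%N w))%:E = (h z0)%:E)%E.
Proof.
move=> mh; rewrite (@ae_eq_integral _ _ _ P setT (cst (h z0)%:E)) //.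
- by rewrite integral_cst//= probability_setT mule1.
- by apply/measurable_EFinP; exact: mcomp.
- by apply: filterS Phi0 => w /= ->.
Qed.

(** One transition multiplies the expectation of V by at most a constant, since
    P V is again dominated by V. *)
Lemma integ_V_chain n : integ P (fun w => V (Phi n w)).
Proof.
elim: n => [|n IH]; apply: integ_ge0 => //; try exact: mcomp.
  by rewrite int0// ltry.
rewrite (@ge0_integral_mixture _ _ _ Omega Omega Z R P (Phi n.+1) P
  (fun w => K (Phi n w)) setT setT _ _ _ _ _ (EFin \o V))//; last first.
- exact/measurable_EFinP.
- move=> U mU; have := @tr n n (leqnn n) setT U measurableT mU.
  by rewrite preimage_setT.
- move=> U mU.
  exact: (measurableT_comp (measurable_kernel K _ mU) (mPhi n)).
have [mKV [C C0 hC]] := domK domV.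
apply: (@le_lt_trans _ _ (\int[P]_w (C * V (Phi n w))%:E)%E); last first.
  by rewrite -Rint_EFin ?ltry//; exact: integZ.
apply: ge0_le_integral => //.
- by move=> w _; apply: integral_ge0 => y _; rewrite lee_fin.
- apply: (measurable_fun_integral_kernel (l := fun w => K (Phi n w))) => //.
    move=> U mU.
    exact: (measurableT_comp (measurable_kernel K _ mU) (mPhi n)).
  exact/measurable_EFinP.
- by apply/measurable_EFinP; apply: measurable_funM => //; exact: mcomp.
move=> w _ /=; rewrite -Rint_EFin; last exact: domVE.
by rewrite lee_fin; apply: (le_trans (ler_norm _)); exact: hC.
Qed.

Lemma integ_dominated_chain g n : dominated V g ->
  integ P (fun w => g (Phi n w)).
Proof.
move=> [mg [C C0 hg]].
apply: integ_le (integZ C (integ_V_chain n)) _; first exact: mcomp.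
by move=> w; exact: hg.
Qed.

Lemma l2_dominated_chain g n : dominated W g -> l2 P (fun w => g (Phi n w)).
Proof.
move=> dg; have [mg _] := dg; split; first exact: mcomp.
exact: (integ_dominated_chain n (domM dg dg)).
Qed.

Let domW_cst k : dominated W (fun=> k).
Proof.
split=> //; exists (`|k| + 1); first by rewrite ltr_wpDl.
move=> z; apply: (@le_trans _ _ (`|k| + 1)); first by rewrite lerDl.
by rewrite ler_peMr ?addr_ge0// -[leLHS]sqrtr1 ler_wsqrtr.
Qed.

Lemma chain_law n g : dominated V g ->
  \int[P]_w g (Phi n w) = iter n (kop K) g z0.
Proof.
elim: n g => [|n IH] g dg; have [mg _] := dg.
  by rewrite /Rintegral int0.
rewrite iterSr -IH; last exact: domK.
have [||||_] := @markov_pairing _ _ _ _ _ P K _ _ (Phi n) (Phi n) (Phi n.+1)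
  (mPhi n) (mPhi n) (mPhi n.+1) (@tr n n (leqnn n)) (fun=> 1) g => //.
- by move=> z; exact: domVE.
- by under eq_fun do rewrite mul1r; exact: integ_dominated_chain.
under eq_Rintegral do rewrite mul1r.
by under [in RHS]eq_Rintegral do rewrite mul1r.
Qed.

(** Square-integrable variables that only depend on the chain up to time m,
    seen through the one consequence of this that matters here. *)
Let past m (Y : Omega -> R) := l2 P Y /\
  forall g n, dominated W g -> (m <= n)%N ->
    integ P (fun w => Y w * kop K g (Phi n w)) /\
    \int[P]_w (Y w * g (Phi n.+1 w)) = \int[P]_w (Y w * kop K g (Phi n w)).

Let past_chain h k m : dominated W h -> (k <= m)%N ->
  past m (fun w => h (Phi k w)).
Proof.
move=> dh km; split; first exact: l2_dominated_chain.
move=> g n dg mn; have [mh _] := dh; have [mg _] := dg.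
apply: (markov_pairing (mPhi k) (mPhi n) (mPhi n.+1)) => //.
- exact: tr (leq_trans km mn).
- by move=> z; apply: domVE; exact: domWV.
- by apply: l2M; exact: l2_dominated_chain.
Qed.

Let pastD m Y1 Y2 : past m Y1 -> past m Y2 -> past m (fun w => Y1 w + Y2 w).
Proof.
move=> [l1 h1] [l2 h2]; split; first exact: l2D.
move=> g n dg mn; have [i1 e1] := h1 g n dg mn; have [i2 e2] := h2 g n dg mn.
have e (u : Omega -> R) : (fun w => (Y1 w + Y2 w) * u w) =
    (fun w => Y1 w * u w + Y2 w * u w).
  by apply/funext => w; rewrite mulrDl.
rewrite !e; split; first exact: integD.
by rewrite !RintegralD ?e1 ?e2//; apply: l2M => //; exact: l2_dominated_chain.
Qed.

Let pastZ m k Y : past m Y -> past m (fun w => k * Y w).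
Proof.
move=> [l1 h1]; split; first exact: l2Z.
move=> g n dg mn; have [i1 e1] := h1 g n dg mn.
have e (u : Omega -> R) : (fun w => k * Y w * u w) =
    (fun w => k * (Y w * u w)).
  by apply/funext => w; rewrite mulrA.
rewrite !e; split; first exact: integZ.
by rewrite !RintegralZl ?e1//; apply: l2M => //; exact: l2_dominated_chain.
Qed.

Let past_sum m n (F : 'I_n -> Omega -> R) : (forall i, past m (F i)) ->
  past m (fun w => \sum_(i < n) F i w).
Proof.
elim: n F => [|n IH] F hF.
  rewrite (_ : (fun w => _) = (fun=> 0)).
    exact: (past_chain (domW_cst 0) (leqnn m)).
  by apply/funext => w; rewrite big_ord0.
rewrite (_ : (fun x => _) =
    (fun x => \sum_(i < n) F (widen_ord (leqnSn n) i) x + F ord_max x)).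
  by apply: pastD; [exact: IH|exact: hF].
by apply/funext => x; rewrite big_ord_recr.
Qed.

Let pastS m n Y : (m <= n)%N -> past m Y -> past n Y.
Proof.
move=> mn [l1 h1]; split=> // g k dg nk; apply: h1 => //.
exact: leq_trans mn nk.
Qed.

Variables (A : 'M[R]_d) (f : Z -> 'cV[R]_d) (theta0 : 'cV[R]_d).
Hypothesis fW : forall i, dominated W (fun z => f z i 0).
Hypothesis f0 : forall i, \int[pi]_z f z i 0 = 0.

Local Notation th := (sa_error A f Phi theta0).
Local Notation it := (fun j => iterate K j f).

Let thS n w : th n.+1 w =
  (1%:M + n.+1%:R^-1 *: A) *m th n w + n.+1%:R^-1 *: f (Phi n.+1 w).
Proof. by rewrite /= /stepsize scalerDr mulmxDl mul1mx -scalemxAl addrA. Qed.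

Let th_past n i : past n (fun w => th n w i 0).
Proof.
elim: n i => [|n IH] i.
  exact: (past_chain (domW_cst (theta0 i 0)) (leqnn 0)).
under eq_fun do rewrite thS mxE mxE [in X in _ + X]mxE.
apply: pastD; last by apply: pastZ; exact: (past_chain (fW i) (leqnn n.+1)).
apply: past_sum => j; apply: pastZ.
exact: pastS (IH j).
Qed.

Let th_l2 n : l2v P (th n).
Proof. by move=> i; have [] := th_past n i. Qed.

Lemma sa_error_l2 n : l2v P (th n). Proof. exact: th_l2. Qed.

Let f_l2 n : l2v P (fun w => f (Phi n w)).
Proof. by move=> i; exact: (l2_dominated_chain n (fW i)). Qed.

Let it_dom j i : dominated W (fun z => it j z i 0).
Proof. exact: (dominated_iterate mV V_ge1 rho01 B_ge0 EB). Qed.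

Let it_l2 n j : l2v P (fun w => it j (Phi n w)).
Proof. by move=> i; exact: (l2_dominated_chain n (it_dom j i)). Qed.

Definition chain_cross n j := cross_moment P (th n) (fun w => it j (Phi n w)).
Definition chain_moment n j :=
  cross_moment P (fun w => f (Phi n w)) (fun w => it j (Phi n w)).

Let cross_next n j :
  cross_moment P (th n) (fun w => it j (Phi n.+1 w)) = chain_cross n j.+1.
Proof.
apply/matrixP => a b; rewrite !cross_momentE.
have [_ /(_ _ n (it_dom j b) (leqnn n))[_ ->]] := th_past n a.
apply: eq_Rintegral => w _; congr (_ * _); rewrite [in RHS]mxE iterS.
by congr kop; apply/funext => z; rewrite mxE.
Qed.

(** The step from theta_n to theta_(n+1) is affine, and conditioning turns P^j f
    at time n+1 into P^(j+1) f at time n. *)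
Lemma chain_crossS n j : chain_cross n.+1 j =
  (1%:M + n.+1%:R^-1 *: A) *m chain_cross n j.+1
  + n.+1%:R^-1 *: chain_moment n.+1 j.
Proof.
rewrite {1}/chain_cross.
have -> : th n.+1 = (fun w => (1%:M + n.+1%:R^-1 *: A) *m th n w
    + n.+1%:R^-1 *: f (Phi n.+1 w)) by apply/funext => w; rewrite thS.
rewrite cross_momentDl; [|exact: l2v_mul|exact: l2vZ|exact: it_l2].
rewrite cross_moment_mull; [|exact: th_l2|exact: it_l2].
rewrite cross_momentZl; [|exact: f_l2|exact: it_l2].
by rewrite cross_next.
Qed.

Lemma it0 z : it 0%N z = f z.
Proof. by apply/colP => i; rewrite mxE. Qed.

(** The cross moment of theta_(n+1) with f already contains one copy of
    a E[f f^T], so that symmetrising it counts a^2 E[f f^T] twice; hence the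
    negative last term. *)
Lemma chain_covS n : cross_moment P (th n.+1) (th n.+1) =
  (1%:M + n.+1%:R^-1 *: A) *m cross_moment P (th n) (th n)
     *m (1%:M + n.+1%:R^-1 *: A)^T
  + n.+1%:R^-1 *: (chain_cross n.+1 0 + (chain_cross n.+1 0)^T)
  - (n.+1%:R^-1) ^+ 2 *: chain_moment n.+1 0.
Proof.
set M := 1%:M + _; set a := n.+1%:R^-1.
pose u w := M *m th n w; pose v w := a *: f (Phi n.+1 w).
have lu : l2v P u by exact: l2v_mul.
have lv : l2v P v by exact: l2vZ.
have fE : (fun w => it 0 (Phi n.+1 w)) = (fun w => f (Phi n.+1 w)).
  by apply/funext => w; rewrite it0.
have -> : th n.+1 = (fun w => u w + v w) by apply/funext => w; rewrite thS.
pose G := cross_moment P (th n) (fun w => f (Phi n.+1 w)).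
have cE : chain_cross n.+1 0 = M *m G + a *: chain_moment n.+1 0.
  by rewrite chain_crossS -cross_next fE.
have uv : cross_moment P u v = a *: (M *m G).
  by rewrite cross_momentZr// cross_moment_mull.
have vv : cross_moment P v v = a ^+ 2 *: chain_moment n.+1 0.
  rewrite cross_momentZr ?cross_momentZl//.
  by rewrite scalerA -expr2 /chain_moment fE.
rewrite cross_momentDl ?cross_momentDr//; try exact: l2vD.
rewrite -(cross_moment_tr P u v) uv vv.
rewrite cross_moment_mulr// cross_moment_mull// cE.
have msym : (chain_moment n.+1 0)^T = chain_moment n.+1 0.
  by rewrite /chain_moment fE cross_moment_tr.
move: (M *m _ *m M^T) (M *m G) (chain_moment n.+1 0) msym => S1 S2 S3 /matrixP h.
apply/matrixP => i k; have := h i k; rewrite !mxE => ->; ring.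
Qed.

Let r := Num.sqrt rho.

Let r_gt0 : 0 < r. Proof. by rewrite sqrtr_gt0; have /andP[] := rho01. Qed.

Let f_bound : exists2 C : R, 0 < C & forall i z, `|f z i 0| <= C * W z.
Proof. by apply: dominated_uniform fW => z; exact: sqrtr_ge0. Qed.

Let it_bound : exists2 C : R, 0 < C &
  forall j i z, `|it j z i 0| <= C * r ^+ j * W z.
Proof. exact: (iterate_bound mV V_ge1 rho01 B_ge0 EB). Qed.

(** The product of f with P^j f is at most a multiple of r^j V, and the law of
    Phi_n approaches pi at the rate rho^n on functions below V. *)
Lemma chain_moment_bound : exists2 C : R, 0 <= C & forall n j,
  nrm (chain_moment n j - cross_moment pi f (it j)) <= C * r ^+ j * rho ^+ n.
Proof.
have [C C0 hC] := f_bound; have [D D0 hD] := it_bound.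
exists (d%:R * (d%:R * (B * (C * D) * V z0))).
  by rewrite !mulr_ge0// ltW.
move=> n j; rewrite (_ : _ * r ^+ j * _ =
    d%:R * (d%:R * (B * (C * (D * r ^+ j)) * rho ^+ n * V z0))); last by ring.
apply: nrm_le => a b; rewrite mxE [X in _ + X]mxE !cross_momentE.
have db := domM (fW a) (it_dom j b).
rewrite (chain_law n db); apply: (iter_kop_ergodic mV V_ge1 rho01 B_ge0 EB).
- by have [] := db.
- by rewrite !mulr_gt0// exprn_gt0.
move=> z; rewrite normrM -[V z]sqr_sqrtr// expr2 mulrACA.
by apply: ler_pM.
Qed.

Lemma chain_cross1_bound : exists2 C : R, 0 <= C & forall j,
  nrm (chain_cross 1 j) <= C * r ^+ j.
Proof.
have [D D0 hD] := it_bound.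
pose I := \sum_a \int[P]_w (`|th 1 w a 0| * W (Phi 1%N w)).
have I0 a : 0 <= \int[P]_w (`|th 1 w a 0| * W (Phi 1%N w)).
  by apply: Rintegral_ge0 => w _; rewrite mulr_ge0// sqrtr_ge0.
have dW : dominated W W.
  split; last by exists 1 => // z; rewrite mul1r ger0_norm// sqrtr_ge0.
  exact: (measurableT_comp (continuous_measurable_fun (@sqrt_continuous R)) mV).
exists (d%:R * (d%:R * (I * D))).
  by rewrite !mulr_ge0// ?(ltW D0)//; apply: sumr_ge0.
move=> j; rewrite (_ : _ * r ^+ j = d%:R * (d%:R * (I * (D * r ^+ j)))); last by ring.
apply: nrm_le => a b; rewrite cross_momentE.
have la : l2 P (fun w => `|th 1 w a 0|).
  have [m1 m2] := th_l2 1 a; split; first exact: measurableT_comp.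
  by under eq_fun do rewrite real_normK ?num_real//.
have i1 : integ P (fun w => `|th 1 w a 0| * W (Phi 1%N w)).
  by apply: l2M => //; exact: (l2_dominated_chain 1 dW).
apply: (@le_trans _ _ (\int[P]_w (D * r ^+ j * (`|th 1 w a 0| * W (Phi 1%N w))))).
  apply: Rint_le.
  - by apply: l2M; [exact: th_l2|exact: it_l2].
  - exact: integZ.
  - by move=> w; rewrite normrM mulrCA ler_wpM2l.
rewrite RintegralZl// mulrC ler_wpM2r//; last first.
  by rewrite /I (bigD1 a)//= lerDl; apply: sumr_ge0.
by rewrite mulr_ge0 ?exprn_ge0 ?(ltW D0) ?(ltW r_gt0).
Qed.

End Chain.
(** * The stationary chain and its innovations *)

Section Stationary.
Context {R : realType} {dZ : measure_display} {Z : measurableType dZ} {d : nat}.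
Variables (V : Z -> R) (K : R.-pker Z ~> Z) (pi : probability Z R).
Variables (rho B : R).
Hypothesis mV : measurable_fun setT V.
Hypothesis V_ge1 : forall z, 1 <= V z.
Hypothesis rho01 : 0 < rho < 1.
Hypothesis B_ge0 : 0 <= B.
Hypothesis EB : ergodic_rate V K pi rho B.
Local Notation W := (fun z => Num.sqrt (V z)).
Local Notation r := (Num.sqrt rho).

Let domWV g := @dominated_sqrt R dZ Z V V_ge1 g.
Let domM f g := @dominatedM R dZ Z V V_ge1 f g.

Lemma l2_dominated_pi g : dominated W g -> l2 pi g.
Proof.
move=> dg; have [mg _] := dg; split => //.
exact: (dominated_integ_pi EB (domM dg dg)).
Qed.

Lemma iterateS j (g : Z -> 'cV[R]_d) z i :
  iterate K j.+1 g z i 0 = kop K (fun y => iterate K j g y i 0) z.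
Proof. by rewrite mxE iterS; congr kop; apply/funext => y; rewrite mxE. Qed.

(** A solution g of Poisson's equation with forcing f telescopes the iterates
    of f. *)
Lemma iterate_poisson (f g : Z -> 'cV[R]_d) :
  (forall i, dominated W (fun z => f z i 0)) ->
  (forall i, dominated W (fun z => g z i 0)) ->
  (forall z i, kop K (fun y => g y i 0) z = g z i 0 - f z i 0) ->
  forall j z, iterate K j g z = iterate K j.+1 g z + iterate K j f z.
Proof.
move=> fW gW hg j z; apply/colP => i; rewrite [RHS]mxE.
rewrite [iterate K j.+1 g z i 0]mxE ![iterate K j _ z i 0]mxE.
have -> : iter j.+1 (kop K) (fun y => g y i 0) =
    iter j (kop K) (fun y => g y i 0 - f y i 0).
  by rewrite iterSr; congr iter; apply/funext => y; exact: hg.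
suff -> : forall u v, dominated V u -> dominated V v ->
    iter j (kop K) (fun y => u y - v y) z =
    iter j (kop K) u z - iter j (kop K) v z.
- by rewrite subrK.
- exact: domWV.
- exact: domWV.
move=> u v du dv.
rewrite (_ : iter j (kop K) (fun y => u y - v y) =
  (fun z => iter j (kop K) u z - iter j (kop K) v z))//.
elim: j => [//|j IH]; rewrite !iterS IH; apply/funext => y.
have [d1 _] := iter_kop mV V_ge1 rho01 B_ge0 EB j du.
have [d2 _] := iter_kop mV V_ge1 rho01 B_ge0 EB j dv.
exact: (kopB EB).
Qed.

Context {dO : measure_display} {Omega : measurableType dO}.
Variables (P : probability Omega R) (Psi : int -> Omega -> Z).
Hypothesis sc : stationary_chain P K pi Psi.

Let mPsi n : measurable_fun setT (Psi n). Proof. by have [] := sc. Qed.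

Let mPsi_pre n C : measurable C -> measurable (Psi n @^-1` C).
Proof. by move=> mC; rewrite -[X in measurable X]setTI; exact: mPsi. Qed.

Let mcomp (f : Z -> R) n : measurable_fun setT f ->
  measurable_fun setT (fun w => f (Psi n w)).
Proof. by move=> mf; exact: (measurableT_comp mf (mPsi n)). Qed.

Lemma stationary_law n g : dominated V g ->
  integ P (fun w => g (Psi n w)) /\
  \int[P]_w g (Psi n w) = \int[pi]_z g z.
Proof.
have [_ hpi _] := sc.
move=> dg; have [mg _] := dg.
have ig : integ P (fun w => g (Psi n w)).
  apply/integrableP; split; first by apply/measurable_EFinP; exact: mcomp.
  have := @ge0_integral_pushforward _ _ _ _ R (Psi n) (mPsi n) P setT
    (fun z => (`|g z|)%:E) measurableT.
  rewrite preimage_setT => <-//; last first.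
    by apply/measurable_EFinP; exact: measurableT_comp.
  rewrite (eq_measure_integral pi); last by move=> A mA _; exact: hpi.
  by rewrite -Rint_EFin ?ltry//; apply: (dominated_integ_pi EB (dominated_abs dg)).
split=> //; rewrite /Rintegral; congr fine.
have := @integral_pushforward _ _ _ _ R (Psi n) (mPsi n) P setT
    (fun z => (g z)%:E).
rewrite preimage_setT => <-//; last exact/measurable_EFinP.
by apply: eq_measure_integral => A mA _; exact: hpi.
Qed.

Let l2_Psi g n : dominated W g -> l2 P (fun w => g (Psi n w)).
Proof.
move=> dg; have [mg _] := dg; split; first exact: mcomp.
by have [] := stationary_law n (domM dg dg).
Qed.

Lemma stationary_pairing (h g : Z -> R) k n : dominated W h -> dominated W g ->
  (k <= n)%R ->
  \int[P]_w (h (Psi k w) * g (Psi (n + 1) w)) =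
  \int[P]_w (h (Psi k w) * kop K g (Psi n w)).
Proof.
move=> dh dg kn; have [mh _] := dh; have [mg _] := dg.
have [_ _ htr] := sc.
have tr' C U : measurable C -> measurable U ->
    (P (Psi k @^-1` C `&` Psi (n + 1) @^-1` U) =
     \int[P]_(w in Psi k @^-1` C) K (Psi n w) U)%E.
  by move=> mC mU; apply: htr => //; exact: history_preimage.
have iK z : integ (K z) g by apply: (dominated_integ_K EB); exact: domWV.
have ihg : integ P (fun w => h (Psi k w) * g (Psi (n + 1) w)).
  by apply: l2M; exact: l2_Psi.
by have [] := markov_pairing (mPsi k) (mPsi n) (mPsi (n + 1)) tr' mh mg iK ihg.
Qed.

Variables (f fh fhh : Z -> 'cV[R]_d).
Hypothesis fW : forall i, dominated W (fun z => f z i 0).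
Hypothesis fhW : forall i, dominated W (fun z => fh z i 0).
Hypothesis fhhW : forall i, dominated W (fun z => fhh z i 0).
Hypothesis f0 : forall i, \int[pi]_z f z i 0 = 0.
Hypothesis fh0 : forall i, \int[pi]_z fh z i 0 = 0.
Hypothesis fhh0 : forall i, \int[pi]_z fhh z i 0 = 0.
Hypothesis Kfh : forall z i, kop K (fun y => fh y i 0) z = fh z i 0 - f z i 0.
Hypothesis Kfhh : forall z i,
  kop K (fun y => fhh y i 0) z = fhh z i 0 - fh z i 0.

(** Stationary correlation of f with P^j f, and its first and second tail sums,
    written with the Poisson solutions. *)
Definition lagp j := cross_moment pi f (iterate K j f).
Definition lagU j := cross_moment pi f (iterate K j fh).
Definition lagW j := cross_moment pi f (iterate K j.+1 fhh).

Let it_dom (g : Z -> 'cV[R]_d) j i : (forall i, dominated W (fun z => g z i 0)) ->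
  (forall i, \int[pi]_z g z i 0 = 0) ->
  dominated W (fun z => iterate K j g z i 0).
Proof. by move=> gW g0; exact: (dominated_iterate mV V_ge1 rho01 B_ge0 EB). Qed.

Lemma lagUS j : lagU j = lagU j.+1 + lagp j.
Proof.
rewrite /lagU /lagp -cross_momentDr.
- by congr cross_moment; apply/funext => z; exact: iterate_poisson.
- by move=> i; exact: l2_dominated_pi.
- by move=> i; apply: l2_dominated_pi; exact: it_dom.
- by move=> i; apply: l2_dominated_pi; exact: it_dom.
Qed.

Lemma lagWS j : lagW j = lagW j.+1 + lagU j.+1.
Proof.
rewrite /lagU /lagW -cross_momentDr.
- by congr cross_moment; apply/funext => z; exact: iterate_poisson.
- by move=> i; exact: l2_dominated_pi.
- by move=> i; apply: l2_dominated_pi; exact: it_dom.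
- by move=> i; apply: l2_dominated_pi; exact: it_dom.
Qed.

Let lag_pairing (h : Z -> R) k n i : dominated W h ->
  \int[P]_w (h (Psi k w) * f (Psi (k + n%:Z) w) i 0) =
  \int[pi]_z (h z * iterate K n f z i 0).
Proof.
move=> dh.
have key j : \int[P]_w (h (Psi k w) * iterate K j f (Psi (k + n%:Z) w) i 0) =
    \int[P]_w (h (Psi k w) * iterate K (n + j) f (Psi k w) i 0).
  elim: n j => [|n IH] j; first by rewrite addr0.
  rewrite (_ : k + n.+1%:Z = k + n%:Z + 1); last by rewrite intS addrA addrAC.
  rewrite (stationary_pairing (g := fun z => iterate K j f z i 0)) ?lerDl//.
    rewrite addSnnS -IH.
    by apply: eq_Rintegral => w _; rewrite iterateS.
  exact: it_dom.
have := key 0%N; rewrite addn0.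
under eq_Rintegral do rewrite mxE /=.
move=> ->; have dn := it_dom n i fW f0.
by have [_ ->] := stationary_law k (domM dh dn).
Qed.

(** The correlations telescope, so that those with lag at least 0 sum to U_0 and
    those with lag at least 1 to U_1 = U_0 - p_0; the remainder U_N vanishes
    geometrically. *)
Lemma Sigma_Delta_lag :
  Sigma_Delta P Psi f = lagU 0 + (lagU 0)^T - lagp 0.
Proof.
have rr : 0 <= r < 1.
  have /andP[rho0 rho1] := rho01.
  rewrite sqrtr_ge0/= -sqrtr1 ltr_sqrt//.
have [C C0 hC] := stationary_cross_bound mV V_ge1 rho01 B_ge0 EB fhW fh0 fW.
have cvgU i j : (fun N => lagU N i j) @ \oo --> (0 : R).
  apply/norm_cvg0P.
  apply: (@squeeze_cvgr _ _ _ _ (fun=> 0) (fun N => C * r ^+ N)).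
  - near=> N; rewrite normr_ge0/=.
    by apply: le_trans (hC N); exact: nrm_entry.
  - exact: cvg_cst.
  - rewrite -[X in _ --> X](mulr0 C); apply: cvgMr.
    by apply: cvg_expr; rewrite ger0_norm; case/andP: rr.
have sum_lag i j a N : \sum_(0 <= k < N) lagp (k + a) i j =
    lagU a i j - lagU (N + a) i j.
  elim: N => [|N IH]; first by rewrite big_geq// add0n subrr.
  rewrite big_nat_recr//= IH (lagUS (N + a)) addSn !mxE.
  by rewrite opprD addrA subrK.
have lim_lag i j a : limn (series (fun k => lagp (k + a) i j)) = lagU a i j.
  apply/cvg_lim => //.
  rewrite (_ : series _ = fun N => lagU a i j - lagU (N + a) i j); last first.
    by apply/funext => N; rewrite /series /= sum_lag.
  rewrite -[X in _ --> X]subr0; apply: cvgB; first exact: cvg_cst.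
  by have := cvgU i j; rewrite -(cvg_shiftn a).
apply/matrixP => i j; rewrite [LHS]mxE.
have -> : (fun k : nat => cross_moment P (f \o Psi k%:Z) (f \o Psi 0) i j) =
    (fun k => lagp (k + 0) j i).
  apply/funext => k; rewrite /lagp !cross_momentE addn0.
  under eq_Rintegral do rewrite /= mulrC -[k%:Z]add0r.
  by rewrite (lag_pairing (h := fun z => f z j 0)).
have -> : (fun k : nat => cross_moment P (f \o Psi (- k.+1%:Z)) (f \o Psi 0) i j) =
    (fun k => lagp (k + 1) i j).
  apply/funext => k; rewrite /lagp !cross_momentE addn1.
  under eq_Rintegral do rewrite /= -[X in _ * f (Psi X _) _ _](addNr k.+1%:Z).
  by rewrite (lag_pairing (h := fun z => f z i 0)).
rewrite !lim_lag.
have mxD (X1 X2 X3 : 'M[R]_d) :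
    (X1 + X2^T - X3) i j = X1 i j + X2 j i - X3 i j by rewrite !mxE.
have e : lagU 1 i j = lagU 0 i j - lagp 0 i j.
  by rewrite (lagUS 0) [X in X - _]mxE addrK.
by rewrite mxD e addrCA addrA.
Unshelve. all: by end_near. Qed.

Variable m : nat.
Local Notation Fm := (history Psi [set k : int | 0 <= k <= m%:Z]).
Local Notation gen := (\bigcup_(k in [set k : int | 0 <= k <= m%:Z])
  preimage_set_system setT (Psi k) measurable).
Local Notation SF := (g_sigma_algebraType gen).

Let Fm_measurable A : Fm A -> measurable A.
Proof.
apply: smallest_sub; first exact: sigma_algebra_measurable.
by move=> _ [k _ [C mC <-]]; rewrite setTI; exact: mPsi_pre.
Qed.

Let Fm_past A : Fm A -> history Psi [set k : int | k <= m%:Z] A.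
Proof.
apply: smallest_sub; first exact: smallest_sigma_algebra.
move=> _ [k /= /andP[_ km] [C mC <-]]; rewrite setTI.
exact: history_preimage.
Qed.

Let past_id : Omega -> SF := id.

Let mid : measurable_fun setT past_id.
Proof. by move=> _ U mU; rewrite setTI; exact: Fm_measurable. Qed.

(** The difference of two versions of a conditional expectation is measurable
    with respect to the past and integrates to 0 over the sets where it is
    positive or negative. *)
Lemma conditional_expectation_kop (g : Z -> 'cV[R]_d) (Y : Omega -> 'cV[R]_d) :
  (forall i, dominated W (fun z => g z i 0)) ->
  cond_expect P Fm (fun w => g (Psi m.+1%:Z w)) Y ->
  forall i, measurable_fun setT (fun w => Y w i 0) /\
    {ae P, forall w, Y w i 0 = kop K (fun z => g z i 0) (Psi m%:Z w)}.
Proof.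
move=> gW hY i; have [YG iY hint] := hY i.
pose gi z := g z i 0; pose U w := kop K gi (Psi m%:Z w).
pose Yi w := Y w i 0.
have dg : dominated V gi by exact: domWV (gW i).
have [mg _] := dg.
have dk : dominated V (kop K gi) by exact: (dominated_kop mV V_ge1 rho01 B_ge0 EB).
have [mk _] := dk.
have iK z : integ (K z) gi by exact: (dominated_integ_K EB).
have [iU _] := stationary_law m%:Z dk.
have [ig _] := stationary_law m.+1%:Z dg.
have mYF : measurable_fun setT (Yi : SF -> R).
  by move=> _ C mC; rewrite setTI; exact: YG.
have mY : measurable_fun setT Yi.
  by move=> _ C mC; rewrite setTI; apply: Fm_measurable; exact: YG.
have mUF : measurable_fun setT (U : SF -> R).
  move=> _ C mC; rewrite setTI.
  apply: (history_preimage (C := kop K gi @^-1` C)); first by rewrite /= lexx.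
  by rewrite -[X in measurable X]setTI; exact: mk.
have mU : measurable_fun setT U by exact: mcomp.
split => //.
have tr (C : set SF) B0 : measurable C -> measurable B0 ->
    (P (past_id @^-1` C `&` Psi (m%:Z + 1) @^-1` B0) =
     \int[P]_(w in past_id @^-1` C) K (Psi m%:Z w) B0)%E.
  move=> mC mB; have [_ _ htr] := sc; apply: htr => //; exact: Fm_past.
have m1 : m%:Z + 1 = m.+1%:Z by rewrite intS addrC.
rewrite m1 in tr.
have key (A : set SF) : measurable A ->
    \int[P]_w (\1_A w * Yi w) = \int[P]_w (\1_A w * U w).
  move=> mA; have mA' : measurable (A : set Omega) by exact: Fm_measurable.
  have bnd (u : Omega -> R) : integ P u -> integ P (fun w => \1_A w * u w).
    move=> iu; apply: integ_le (integ_abs iu) _.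
      by apply: measurable_funM; [exact: measurable_indic|exact: integ_mf iu].
    move=> w; rewrite normrM ler_piMl// indicE.
    by case: (w \in A); rewrite ?normr1 ?normr0.
  have [_ <-] := markov_pairing mid (mPsi m%:Z) (mPsi m.+1%:Z) tr
    (h := \1_A) (measurable_indic mA) mg iK (bnd _ ig).
  have e (u : Omega -> R) : (\int[P]_w (\1_A w * u w)%:E = \int[P]_(w in A) (u w)%:E)%E.
    rewrite [RHS]integral_mkcond; apply: eq_integral => w _.
    by rewrite epatch_indic /= -EFinM mulrC.
  by rewrite /Rintegral; congr fine; rewrite !e; exact: hint.
pose D w := Yi w - U w.
have iD : integ P D by exact: integB.
have mDF : measurable_fun setT (D : SF -> R) by exact: measurable_funB.
have keyD (A : set SF) : measurable A ->
    integ P (fun w => \1_A w * D w) /\ \int[P]_w (\1_A w * D w) = 0.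
  move=> mA; have mA' : measurable (A : set Omega) by exact: Fm_measurable.
  have bnd (u : Omega -> R) : integ P u -> integ P (fun w => \1_A w * u w).
    move=> iu; apply: integ_le (integ_abs iu) _.
      by apply: measurable_funM; [exact: measurable_indic|exact: integ_mf iu].
    move=> w; rewrite normrM ler_piMl// indicE.
    by case: (w \in A); rewrite ?normr1 ?normr0.
  split; first exact: bnd.
  under eq_Rintegral do rewrite mulrBr.
  by rewrite RintegralB ?key ?subrr//; exact: bnd.
pose Ap : set SF := (D : SF -> R) @^-1` `]0, +oo[%classic.
pose An : set SF := (D : SF -> R) @^-1` `]-oo, 0[%classic.
have mAp : measurable Ap by rewrite -[X in measurable X]setTI; exact: mDF.
have mAn : measurable An by rewrite -[X in measurable X]setTI; exact: mDF.
have [ip ep] := keyD Ap mAp; have [jn en] := keyD An mAn.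
have absD w : `|D w| = \1_Ap w * D w - \1_An w * D w.
  have pE : (w \in Ap) = (0 < D w).
    by apply/idP/idP; rewrite inE /Ap /= in_itv /= andbT.
  have nE : (w \in An) = (D w < 0) by apply/idP/idP; rewrite inE /An /= in_itv.
  rewrite !indicE pE nE; have [D0|D0|->] := ltgtP (D w) 0.
  - by rewrite ltr0_norm// mul0r mul1r sub0r.
  - by rewrite gtr0_norm// mul0r mul1r subr0.
  - by rewrite normr0 !mulr0 subrr.
have : (\int[P]_w `|(D w)%:E| = 0)%E.
  have -> : (\int[P]_w `|(D w)%:E| = (\int[P]_w `|D w|)%:E)%E.
    by rewrite Rint_EFin//; exact: integ_abs.
  congr EFin; under eq_Rintegral do rewrite absD.
  by rewrite RintegralB// ep en subrr.
have mDE : measurable_fun setT (fun w => (D w)%:E).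
  by apply/measurable_EFinP; exact: integ_mf iD.
move/(ae_eq_integral_abs P measurableT mDE); apply: filterS => w /= /(_ Logic.I).
by move=> [/eqP]; rewrite subr_eq0 => /eqP.
Qed.

Let pred_part (g : Z -> 'cV[R]_d) w := iterate K 1 g (Psi m%:Z w).

Lemma innovation_ae (g : Z -> 'cV[R]_d) (D : Omega -> 'cV[R]_d) :
  (forall i, dominated W (fun z => g z i 0)) ->
  innovation P Fm (g \o Psi m.+1%:Z) D -> forall i,
    measurable_fun setT (fun w => D w i 0) /\
    {ae P, forall w, D w i 0 = (g (Psi m.+1%:Z w) - pred_part g w) i 0}.
Proof.
move=> gW [Y hY hD] i.
have [mY eY] := conditional_expectation_kop gW hY i.
have e : (fun w => D w i 0) = (fun w => g (Psi m.+1%:Z w) i 0 - Y w i 0).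
  by apply/funext => w; rewrite hD !mxE.
split.
  rewrite e; apply: measurable_funB => //.
  by apply: (mcomp (f := fun z => g z i 0)); exact: (gW i).1.
apply: filterS eY => w h; rewrite (congr1 (fun u => u w) e) /= h.
by rewrite /pred_part !mxE.
Qed.

Let l2v_Psi (g : Z -> 'cV[R]_d) n :
  (forall i, dominated W (fun z => g z i 0)) -> l2v P (fun w => g (Psi n w)).
Proof. by move=> gW i; exact: (l2_Psi n (gW i)). Qed.

Let cross_Psi (g h : Z -> 'cV[R]_d) n :
  (forall i, dominated W (fun z => g z i 0)) ->
  (forall i, dominated W (fun z => h z i 0)) ->
  cross_moment P (fun w => g (Psi n w)) (fun w => h (Psi n w)) =
  cross_moment pi g h.
Proof.
move=> gW hW; apply/matrixP => i j; rewrite !cross_momentE.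
by have [_ ->] := stationary_law n (domM (gW i) (hW j)).
Qed.

Let cross_pred (g h : Z -> 'cV[R]_d) :
  (forall i, dominated W (fun z => g z i 0)) ->
  (forall i, dominated W (fun z => h z i 0)) ->
  (forall i, \int[pi]_z h z i 0 = 0) ->
  cross_moment P (fun w => g (Psi m%:Z w)) (fun w => h (Psi m.+1%:Z w)) =
  cross_moment pi g (iterate K 1 h).
Proof.
move=> gW hW h0; apply/matrixP => i j; rewrite !cross_momentE.
rewrite (_ : m.+1%:Z = m%:Z + 1); last by rewrite intS addrC.
rewrite (stationary_pairing (gW i) (hW j) (lexx _)).
have e w : kop K (fun z => h z j 0) (Psi m%:Z w) =
    iterate K 1 h (Psi m%:Z w) j 0 by rewrite mxE.
under eq_Rintegral do rewrite e.
have h1 := it_dom 1 j hW h0.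
by have [_ ->] := stationary_law m%:Z (domM (gW i) h1).
Qed.

Variables Dm Dhatm : Omega -> 'cV[R]_d.
Hypothesis hDm : innovation P Fm (fh \o Psi m.+1%:Z) Dm.
Hypothesis hDhatm : innovation P Fm (fhh \o Psi m.+1%:Z) Dhatm.
Local Notation Zn := (fh \o Psi m.+1%:Z).
Local Notation Zhatn := (fhh \o Psi m.+1%:Z).

Let iterate1 (f1 g : Z -> 'cV[R]_d) :
  (forall z i, kop K (fun y => g y i 0) z = g z i 0 - f1 z i 0) ->
  iterate K 1 g = fun z => g z - f1 z.
Proof.
by move=> h; apply/funext => z; apply/colP => i; rewrite mxE /= h !mxE.
Qed.

Let residual : cross_moment pi fh fhh
    - cross_moment pi (iterate K 1 fh) (iterate K 1 fhh) =
  cross_moment P Zn Zn + lagW 0.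
Proof.
rewrite cross_Psi// /lagW !(iterate1 Kfh) !(iterate1 Kfhh).
have lf : l2v pi f by move=> i; exact: l2_dominated_pi.
have lfh : l2v pi fh by move=> i; exact: l2_dominated_pi.
have lfhh : l2v pi fhh by move=> i; exact: l2_dominated_pi.
rewrite cross_momentBl//; last exact: l2vB.
rewrite !cross_momentBr//.
move: (cross_moment pi fh fhh) (cross_moment pi fh fh) => a b.
move: (cross_moment pi f fhh) (cross_moment pi f fh) => c e.
by apply/matrixP => i j; rewrite !mxE; ring.
Qed.

(** Both cross moments equal pi(fh fhh^T) - pi((P fh) (P fhh)^T), because the
    part of a function of the next state that is known one step ahead is
    uncorrelated with every innovation. The Poisson equations evaluate the
    difference. *)
Lemma innovation_cross :
  cross_moment P Dm Dhatm = cross_moment P Zn Zn + lagW 0 /\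
  cross_moment P Dm Zhatn = cross_moment P Zn Zn + lagW 0.
Proof.
have D1 := innovation_ae fhW hDm; have D2 := innovation_ae fhhW hDhatm.
pose kfh := iterate K 1 fh; pose kfhh := iterate K 1 fhh.
have kfhW i : dominated W (fun z => kfh z i 0) by exact: it_dom.
have kfhhW i : dominated W (fun z => kfhh z i 0) by exact: it_dom.
have la := l2v_Psi m.+1%:Z fhW; have la2 := l2v_Psi m.+1%:Z fhhW.
have lb : l2v P (pred_part fh) by exact: (l2v_Psi m%:Z kfhW).
have lb2 : l2v P (pred_part fhh) by exact: (l2v_Psi m%:Z kfhhW).
have aa2 : cross_moment P Zn Zhatn = cross_moment pi fh fhh by exact: cross_Psi.
have ba2 : cross_moment P (pred_part fh) Zhatn = cross_moment pi kfh kfhh.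
  exact: cross_pred.
have bb2 : cross_moment P (pred_part fh) (pred_part fhh) =
    cross_moment pi kfh kfhh by exact: cross_Psi.
have ab2 : cross_moment P Zn (pred_part fhh) = cross_moment pi kfh kfhh.
  by rewrite -cross_moment_tr (cross_pred kfhhW fhW fh0) cross_moment_tr.
have mreg (u v : Omega -> 'cV[R]_d) : l2v P u -> l2v P v ->
    forall i, measurable_fun setT (fun w => (u w - v w) i 0).
  by move=> hu hv i; exact: (l2vB hu hv i).1.
rewrite -residual; split.
- rewrite (@cross_moment_ae _ _ _ _ P Dm (fun w => Zn w - pred_part fh w)
    Dhatm (fun w => Zhatn w - pred_part fhh w)).
  + rewrite cross_momentBl//; last exact: l2vB.
    by rewrite !cross_momentBr// aa2 ba2 ab2 bb2 subrr subr0.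
  + by move=> i; have [] := D1 i.
  + exact: mreg.
  + by move=> i; have [] := D2 i.
  + exact: mreg.
  + by move=> i; have [] := D1 i.
  + by move=> i; have [] := D2 i.
- rewrite (@cross_moment_ae _ _ _ _ P Dm (fun w => Zn w - pred_part fh w)
    Zhatn Zhatn).
  + by rewrite cross_momentBl// aa2 ba2.
  + by move=> i; have [] := D1 i.
  + exact: mreg.
  + by move=> i; exact: (la2 i).1.
  + by move=> i; exact: (la2 i).1.
  + by move=> i; have [] := D1 i.
  + by move=> i; exact: filterE.
Qed.

End Stationary.
(** * The expansion of the covariance *)

Section Assembly.
Context {R : realType}.

(** The distance of the spectrum from the imaginary axis, cut off at 1: the
    error terms of order n^-3 do not allow a larger exponent. *)
Lemma hurwitz_margin d : exists delta : 'M[R]_d -> R, forall M,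
  0 < delta M <= 1 /\
  (hurwitz M -> forall l, eigenvalue_C M l -> complex.Re l <= - delta M).
Proof.
suff /choice[delta hdelta] : forall M : 'M[R]_d, exists e : R, 0 < e <= 1 /\
    (hurwitz M -> forall l, eigenvalue_C M l -> complex.Re l <= - e).
  by exists delta.
move=> M; have [hM|nhM] := pselect (hurwitz M); last first.
  by exists 1; rewrite ltr01 lexx.
have [|e e0 he] := @eigenvalue_margin _ _ M 0.
  by move=> l /hM; rewrite oppr0.
exists (Num.min e 1); split.
  by rewrite lt_min e0 ltr01/= ge_min lexx orbT.
move=> _ l /he; rewrite oppr0 sub0r => h; apply: (le_trans h).
by rewrite lerN2 ge_min lexx.
Qed.

Lemma eigenvalue_C_shift d (A : 'M[R]_d) (c : R) (l : R[i]) :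
  eigenvalue_C (c%:M + A) l -> eigenvalue_C A (l - real_complex R c).
Proof.
move=> /eigenvalueP[v hv v0]; apply/eigenvalueP; exists v => //.
rewrite scalerBl -hv map_mxD map_scalar_mx mulmxDr mul_mx_scalar.
by rewrite addrC addKr.
Qed.

Lemma square_LinftyV_dominated (dZ : measure_display) (Z : measurableType dZ)
    d (V : Z -> R) (f : Z -> 'cV[R]_d) :
  (forall z, 1 <= V z) -> square_LinftyV V f ->
  forall i, dominated (fun z => Num.sqrt (V z)) (fun z => f z i 0).
Proof.
move=> V1 hf i; have [mf [mf2 fin]] := hf i; split => //.
have v0 : (0 <= Vnorm V (fun z => (f z i 0 ^+ 2)%R))%E.
  apply: (@le_trans _ _ (`|f point i 0 ^+ 2| / V point)%:E).
    by rewrite lee_fin divr_ge0//; apply: le_trans (V1 point).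
  by apply: ereal_sup_ubound; exists point.
pose C := fine (Vnorm V (fun z => f z i 0 ^+ 2)) + 1.
have C0 : 0 < C by rewrite ltr_wpDl// fine_ge0.
exists (Num.sqrt C); first by rewrite sqrtr_gt0.
move=> z; have V0 : 0 < V z by apply: lt_le_trans (V1 z).
rewrite -sqrtrM ?(ltW C0)// -sqrtr_sqr ler_wsqrtr//.
rewrite -[leLHS]ger0_norm ?sqr_ge0// -ler_pdivrMr//.
apply: (@le_trans _ _ (fine (Vnorm V (fun z => f z i 0 ^+ 2)))); last first.
  by rewrite lerDl.
rewrite -lee_fin fineK; last by rewrite ge0_fin_numE.
by apply: ereal_sup_ubound; exists z.
Qed.

(** The leading coefficient is the limit of n S_n. *)
Lemma psd_of_expansion d (S : nat -> 'M[R]_d) (St S2 : 'M[R]_d) (C : R) (N : nat)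
    (s : R) : 2 <= s ->
  (forall n (x : 'cV[R]_d), 0 <= (x^T *m S n *m x) 0 0) ->
  (forall n, (N <= n)%N ->
     nrm (S n - n%:R^-1 *: St - (n%:R^-1) ^+ 2 *: S2) <= C * n%:R `^ (- s)) ->
  forall x : 'cV[R]_d, 0 <= (x^T *m St *m x) 0 0.
Proof.
move=> s2 S0 hS x; rewrite leNgt; apply/negP => q0.
set q := (x^T *m St *m x) 0 0 in q0.
have quad (M : 'M[R]_d) : (x^T *m M *m x) 0 0 <= nrm x ^+ 2 * nrm M.
  apply: (le_trans (ler_norm _)); apply: (le_trans (nrm_entry _ _ _)).
  apply: (le_trans (nrmM _ _)); rewrite expr2 mulrAC ler_wpM2r ?nrm_ge0//.
  by apply: (le_trans (nrmM _ _)); rewrite nrm_tr.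
have X0 : 0 <= nrm x ^+ 2 by exact: sqr_ge0.
pose D := nrm x ^+ 2 * (nrm S2 + `|C|) + 1.
have D0 : 0 < D by rewrite ltr_wpDl// mulr_ge0// addr_ge0// nrm_ge0.
have e0 : 0 < - q / (2 * D) by rewrite divr_gt0 ?oppr_gt0// mulr_gt0.
have [N1 hN1] := inv_nat_small e0.
pose n := maxn N N1.
have [n0 hn] := hN1 n (leq_maxr _ _).
have := S0 n x; set b := n%:R^-1 in hn *.
have b0 : 0 < b by rewrite invr_gt0 ltr0n.
have := hS n (leq_maxl _ _); rewrite -/b.
set E := S n - _ - _ => hE.
have -> : S n = b *: St + b ^+ 2 *: S2 + E.
  by apply/matrixP => i j; rewrite /E !mxE; ring.
have -> : (x^T *m (b *: St + b ^+ 2 *: S2 + E) *m x) 0 0 =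
    b * q + b ^+ 2 * (x^T *m S2 *m x) 0 0 + (x^T *m E *m x) 0 0.
  have -> : x^T *m (b *: St + b ^+ 2 *: S2 + E) *m x =
      b *: (x^T *m St *m x) + b ^+ 2 *: (x^T *m S2 *m x) + x^T *m E *m x.
    by rewrite !mulmxDr !mulmxDl -!scalemxAr -!scalemxAl.
  rewrite /q; move: (x^T *m St *m x) (x^T *m S2 *m x) (x^T *m E *m x).
  by move=> a1 a2 a3; rewrite !mxE.
apply/negP; rewrite -ltNge.
have hb : n%:R `^ (- s) <= b ^+ 2.
  rewrite exprVn -powR_invn// ler_powR ?ler1n//; lra.
have h1 : nrm E <= `|C| * b ^+ 2.
  apply: (le_trans hE); apply: (@le_trans _ _ (`|C| * n%:R `^ (- s))).
    by rewrite ler_wpM2r ?powR_ge0// ler_norm.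
  by rewrite ler_wpM2l.
have h2 : (x^T *m E *m x) 0 0 <= nrm x ^+ 2 * (`|C| * b ^+ 2).
  by apply: (le_trans (quad E)); rewrite ler_wpM2l.
have h3 : b ^+ 2 * (x^T *m S2 *m x) 0 0 <= b ^+ 2 * (nrm x ^+ 2 * nrm S2).
  by rewrite ler_wpM2l ?sqr_ge0.
have h4 : b * (b * D) <= b * (- q / 2).
  rewrite ler_wpM2l ?(ltW b0)// -ler_pdivlMr//.
  by rewrite -mulrA -invfM.
have h5 : b * (- q / 2) = - (b * q) / 2 by ring.
have h6 : b * (b * D) = b ^+ 2 * (nrm x ^+ 2 * nrm S2)
    + nrm x ^+ 2 * (`|C| * b ^+ 2) + b ^+ 2 by rewrite /D; ring.
have h7 : 0 < b ^+ 2 by rewrite exprn_gt0.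
have h8 : b * q < 0 by rewrite pmulr_rlt0.
lra.
Qed.

(** With E[Dm Dhatm^T] = E[Dm Zhat^T] = SZ + W_0, the shifts in the equation for
    Ssharp turn it into the equation for the coefficient of n^-2. *)
Lemma chain_covariance_expansion (d : nat) (dl : R)
    (dZ : measure_display) (Z : measurableType dZ) (V : Z -> R)
    (K : R.-pker Z ~> Z) (pi : probability Z R) (A : 'M[R]_d)
    (f fh fhh : Z -> 'cV[R]_d)
    (dO : measure_display) (Omega : measurableType dO)
    (P : probability Omega R) (Phi : nat -> Omega -> Z) (z0 : Z)
    (theta0 : 'cV[R]_d)
    (dS : measure_display) (OmegaS : measurableType dS)
    (PS : probability OmegaS R) (Psi : int -> OmegaS -> Z)
    (m : nat) (Dm Dhatm : OmegaS -> 'cV[R]_d) :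
  measurable_fun setT V -> (forall z, 1 <= V z) ->
  V_uniformly_ergodic V K pi ->
  markov_chain P K Phi -> {ae P, forall w, Phi 0%N w = z0} ->
  square_LinftyV V f -> mean_zero pi f ->
  0 < dl <= 1 ->
  (forall l, eigenvalue_C (1%:M + A) l -> complex.Re l <= - dl) ->
  poisson_solution V K pi f fh -> poisson_solution V K pi fh fhh ->
  stationary_chain PS K pi Psi ->
  let Fm := history Psi [set k : int | 0 <= k <= m%:Z] in
  let Zn := fh \o Psi m.+1%:Z in
  let Zhatn := fhh \o Psi m.+1%:Z in
  innovation PS Fm Zn Dm -> innovation PS Fm Zhatn Dhatm ->
  let theta := sa_error A f Phi theta0 in
  let SD := Sigma_Delta PS Psi f in
  let SZ := cross_moment PS Zn Zn in
  let IA := 1%:M + A in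
  let halfIA := (2^-1)%:M + A in
  let lyap_theta S := halfIA *m S + S *m halfIA^T + SD = 0 in
  let lyap_sharp Stheta S :=
    IA *m (S - cross_moment PS Dhatm Dm)
    + (S - cross_moment PS Dm Dhatm) *m IA^T
    + A *m Stheta *m A^T - SD = 0 in
  exists Stheta Ssharp : 'M[R]_d,
    let Stheta2 := Ssharp + SZ
      - cross_moment PS Dm Zhatn - cross_moment PS Zhatn Dm in
    [/\ psd Stheta,
        lyap_theta Stheta /\ (forall S, lyap_theta S -> S = Stheta),
        lyap_sharp Stheta Ssharp /\
          (forall S, lyap_sharp Stheta S -> S = Ssharp) &
        exists (N : nat) (C : R), forall n, (N <= n)%N ->
          nrm (cross_moment P (theta n) (theta n)
             - n%:R^-1 *: Stheta - (n%:R^-1) ^+ 2 *: Stheta2)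
          <= C * n%:R `^ (- (2 + dl))].
Proof.
move=> mV V1 erg mc Phi0 fL fz dl01 hIA [fhL fhz Kfh] [fhhL fhhz Kfhh] sc.
move=> Fm Zn Zhatn hDm hDhatm theta SD SZ IA halfIA lyap_theta lyap_sharp.
have /andP[dl0 dl1] := dl01.
have [rho [B [rho01 B0 EB]]] := ergodic_bound mV V1 erg.
have fW := square_LinftyV_dominated V1 fL.
have fhW := square_LinftyV_dominated V1 fhL.
have fhhW := square_LinftyV_dominated V1 fhhL.
have f0 i : \int[pi]_z f z i 0 = 0 by rewrite /Rintegral fz.
have fh0 i : \int[pi]_z fh z i 0 = 0 by rewrite /Rintegral fhz.
have fhh0 i : \int[pi]_z fhh z i 0 = 0 by rewrite /Rintegral fhhz.
have kfh z i : kop K (fun y => fh y i 0) z = fh z i 0 - f z i 0.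
  by rewrite /kop /Rintegral Kfh.
have kfhh z i : kop K (fun y => fhh y i 0) z = fhh z i 0 - fh z i 0.
  by rewrite /kop /Rintegral Kfhh.
pose r := Num.sqrt rho.
have r01 : 0 < r < 1.
  by have /andP[h0 h1] := rho01; rewrite sqrtr_gt0 h0 -sqrtr1 ltr_sqrt.
pose p := lagp K pi f; pose U := lagU K pi f fh; pose W := lagW K pi f fhh.
have SDE : SD = U 0%N + (U 0%N)^T - p 0%N.
  exact: (Sigma_Delta_lag mV V1 rho01 B0 EB sc fW fhW f0 fh0 kfh).
have [Q1 Q2] := innovation_cross mV V1 rho01 B0 EB sc fW fhW fhhW fh0 fhh0
  kfh kfhh hDm hDhatm.
rewrite -/Zn -/SZ -/W in Q1 Q2.
have Q1' : cross_moment PS Dhatm Dm = SZ + (W 0%N)^T.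
  by rewrite -cross_moment_tr Q1 linearD /= cross_moment_tr.
have Q2' : cross_moment PS Zhatn Dm = SZ + (W 0%N)^T.
  by rewrite -cross_moment_tr Q2 linearD /= cross_moment_tr.
have hurIA : hurwitz IA by move=> l /hIA; lra.
have shift (c : R) l : eigenvalue_C (c%:M + A) l -> complex.Re l <= c - 1 - dl.
  move=> /eigenvalue_C_shift h.
  have : eigenvalue_C (1%:M + A) (l - real_complex R c + real_complex R 1).
    rewrite (_ : A = (- 1)%:M + (1%:M + A)) in h; last first.
      by rewrite addrA -raddfD /= addNr raddf0 add0r.
    move/eigenvalue_C_shift: h; rewrite rmorphN /= opprK.
    by [].
  by move=> /hIA; case: (l) => a b /=; lra.
have hurhalf : hurwitz halfIA by move=> l /shift; lra.
have hA l : eigenvalue_C A l -> complex.Re l <= - 1 - dl.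
  move=> h; have : eigenvalue_C (0%:M + A) l by rewrite raddf0 add0r.
  by move=> /shift; rewrite sub0r.
have [St St_sol] := lyapunov_surj hurhalf (- SD).
have St_lyap : lyap_theta St by rewrite /lyap_theta St_sol addNr.
have St_uniq S : lyap_theta S -> S = St.
  move=> hS; apply/eqP; rewrite -subr_eq0; apply/eqP.
  apply: (lyapunov_inj hurhalf).
  rewrite mulmxBr mulmxBl addrACA -opprD St_sol opprK.
  exact: hS.
have [Ss Ss_sol] := lyapunov_surj hurIA
  (IA *m cross_moment PS Dhatm Dm + cross_moment PS Dm Dhatm *m IA^T
   - A *m St *m A^T + SD).
have sharpE S : IA *m (S - cross_moment PS Dhatm Dm)
    + (S - cross_moment PS Dm Dhatm) *m IA^T + A *m St *m A^T - SD =
    (IA *m S + S *m IA^T) - (IA *m Ss + Ss *m IA^T).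
  have alg (a1 a2 a3 a4 a5 a6 : 'M[R]_d) : a1 - a3 + (a2 - a4) + a5 - a6 =
      a1 + a2 - (a3 + a4 - a5 + a6).
    by apply/matrixP => i j; rewrite !mxE; ring.
  by rewrite Ss_sol mulmxBr mulmxBl alg.
have Ss_lyap : lyap_sharp St Ss by rewrite /lyap_sharp sharpE subrr.
have Ss_uniq S : lyap_sharp St S -> S = Ss.
  rewrite /lyap_sharp sharpE => hS; apply/eqP; rewrite -subr_eq0; apply/eqP.
  by apply: (lyapunov_inj hurIA); rewrite mulmxBr mulmxBl addrACA -opprD.
exists St, Ss => Stheta2.
pose S n := cross_moment P (theta n) (theta n).
have [C1 C10 hC1] := chain_moment_bound mV V1 rho01 B0 EB mc Phi0 fW f0.
have [C2 C20 hC2] := chain_cross1_bound mV V1 rho01 B0 EB mc Phi0 A theta0 fW f0.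
have [C3 C30 hC3] := stationary_cross_bound mV V1 rho01 B0 EB fhW fh0 fW.
have [C4 C40 hC4] := stationary_cross_bound mV V1 rho01 B0 EB fhhW fhh0 fW.
have rj j : 0 <= r ^+ j by have /andP[/ltW h0 _] := r01; rewrite exprn_ge0.
pose C0 := C1 + C2 + C3 + C4.
have C00 : 0 <= C0 by rewrite !addr_ge0.
have up c j : 0 <= c -> c <= C0 -> c * r ^+ j <= C0 * r ^+ j.
  by move=> _ cC; rewrite ler_wpM2r.
have St_eq : St + (A *m St + St *m A^T) + (U 0%N + (U 0%N)^T - p 0%N) = 0.
  rewrite -SDE -St_lyap; congr (_ + _).
  rewrite /halfIA linearD /= tr_scalar_mx mulmxDl mulmxDr mul_scalar_mx.
  rewrite mul_mx_scalar addrACA -scalerDl.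
  by rewrite (_ : 2^-1 + 2^-1 = 1 :> R) ?scale1r//; lra.
have S2_eq : IA *m (Stheta2 + W 0%N) + (Stheta2 + (W 0%N)^T) *m IA^T
    + A *m St *m A^T - (U 0%N + (U 0%N)^T - p 0%N) = 0.
  have -> : Stheta2 + W 0%N = Ss - cross_moment PS Dhatm Dm.
    rewrite /Stheta2 Q2 Q1' Q2'; move: (W 0%N) (cross_moment PS Zn Zn) => w z.
    by apply/matrixP => i j; rewrite !mxE; ring.
  have -> : Stheta2 + (W 0%N)^T = Ss - cross_moment PS Dm Dhatm.
    rewrite /Stheta2 Q1 Q2 Q2'; move: (W 0%N) (cross_moment PS Zn Zn) => w z.
    by apply/matrixP => i j; rewrite !mxE; ring.
  by rewrite -SDE; exact: Ss_lyap.
have main : exists (N : nat) (C : R), forall n, (N <= n)%N ->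
    nrm (S n - n%:R^-1 *: St - (n%:R^-1) ^+ 2 *: Stheta2)
    <= C * n%:R `^ (- (2 + dl)).
  apply: (@covariance_expansion_bound R d A rho r C0
    (chain_cross K P Phi A f theta0) (chain_moment K P Phi f) p U W
    rho01 r01 C00 _ _ _ _ _ _ _ S St Stheta2 dl dl01 hA _ St_eq S2_eq).
  - exact: (chain_crossS mV V1 rho01 B0 EB mc Phi0 A theta0 fW f0).
  - by move=> j; apply: le_trans (hC2 j) _; apply: up => //; rewrite /C0; lra.
  - move=> n j; apply: le_trans (hC1 n j) _.
    rewrite ler_wpM2r ?exprn_ge0//; first by have /andP[/ltW] := rho01.
    by apply: up => //; rewrite /C0; lra.
  - exact: (lagUS mV V1 rho01 B0 EB fW fhW f0 fh0 kfh).
  - exact: (lagWS mV V1 rho01 B0 EB fW fhW fhhW fh0 fhh0 kfhh).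
  - by move=> j; apply: le_trans (hC3 j) _; apply: up => //; rewrite /C0; lra.
  - move=> j; apply: le_trans (hC4 j.+1) _.
    apply: (@le_trans _ _ (C4 * r ^+ j)).
      have /andP[h0 h1] := r01.
      by rewrite exprS ler_wpM2l// ler_piMl// ltW.
    by apply: up => //; rewrite /C0; lra.
  - exact: (chain_covS mV V1 rho01 B0 EB mc Phi0 A theta0 fW f0).
split => //; split.
- apply: St_uniq; rewrite /lyap_theta.
  have SDt : SD^T = SD.
    have p0 : (p 0%N)^T = p 0%N.
      rewrite /p /lagp (_ : iterate K 0 f = f) ?cross_moment_tr//.
      by apply/funext => z; exact: it0.
    by rewrite SDE linearB linearD /= trmxK p0 [_^T + _]addrC.
  have lyap_tr (M X : 'M[R]_d) :
      M *m X^T + X^T *m M^T + SD = (M *m X + X *m M^T + SD)^T.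
    rewrite linearD /= SDt; congr (_ + _).
    by rewrite linearD /= !trmx_mul trmxK addrC.
  rewrite lyap_tr -[RHS]trmx0; congr trmx; exact: St_lyap.
- have [N [C hNC]] := main.
  apply: (@psd_of_expansion _ S St Stheta2 C N (2 + dl)) => //; first lra.
  move=> n x; apply: cross_moment_psd.
  exact: (sa_error_l2 mV V1 rho01 B0 EB mc Phi0 A theta0 fW).
Qed.

End Assembly.

Theorem theorem2p11 (R : realType) (d : nat) :
  exists delta : 'M[R]_d -> 'M[R]_d -> R,
  forall (T : completePseudoMetricType R) (V : borel T -> R)
    (K : R.-pker (borel T) ~> (borel T)) (pi : probability (borel T) R)
    (A : 'M[R]_d) (fstar fhat fhathat : borel T -> 'cV[R]_d)
    (* the chain with fixed initial condition *)
    (dO : measure_display) (Omega : measurableType dO)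
    (P : probability Omega R) (Phi : nat -> Omega -> borel T)
    (z0 : borel T) (theta0 : 'cV[R]_d)
    (* its two-sided stationary version *)
    (dS : measure_display) (OmegaS : measurableType dS)
    (PS : probability OmegaS R) (Psi : int -> OmegaS -> borel T)
    (m : nat) (Dm Dhatm : OmegaS -> 'cV[R]_d),
  polish T ->
  measurable_fun setT V -> (forall z, 1 <= V z) ->
  V_uniformly_ergodic V K pi -> unique_invariant K pi ->
  markov_chain P K Phi -> {ae P, forall w, Phi 0%N w = z0} ->
  hurwitz A ->
  square_LinftyV V fstar -> mean_zero pi fstar ->
  (forall l : R[i], eigenvalue_C A l -> complex.Re l < -1) ->
  poisson_solution V K pi fstar fhat ->
  poisson_solution V K pi fhat fhathat ->
  stationary_chain PS K pi Psi ->
  (* steady-state quantities are evaluated at time m + 1 *)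
  let Fm := history Psi [set k : int | 0 <= k <= m%:Z] in
  let Zn := fhat \o Psi m.+1%:Z in
  let Zhatn := fhathat \o Psi m.+1%:Z in
  innovation PS Fm Zn Dm ->
  innovation PS Fm Zhatn Dhatm ->
  let theta := sa_error A fstar Phi theta0 in
  let SD := Sigma_Delta PS Psi fstar in
  let SZ := cross_moment PS Zn Zn in
  let IA := 1%:M + A in
  let halfIA := (2^-1)%:M + A in
  let lyap_theta S := halfIA *m S + S *m halfIA^T + SD = 0 in
  let lyap_sharp Stheta S :=
    IA *m (S - cross_moment PS Dhatm Dm)
    + (S - cross_moment PS Dm Dhatm) *m IA^T
    + A *m Stheta *m A^T - SD = 0 in
  0 < delta IA SD /\
  exists Stheta Ssharp : 'M[R]_d,
    let Stheta2 := Ssharp + SZ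
      - cross_moment PS Dm Zhatn - cross_moment PS Zhatn Dm in
    [/\ psd Stheta,
        lyap_theta Stheta /\ (forall S, lyap_theta S -> S = Stheta),
        lyap_sharp Stheta Ssharp /\
          (forall S, lyap_sharp Stheta S -> S = Ssharp) &
        forall i j : 'I_d,
          (fun n : nat => (cross_moment P (theta n) (theta n)
             - n%:R^-1 *: Stheta - (n%:R ^+ 2)^-1 *: Stheta2) i j : R^o)
          =O_\oo (fun n : nat => n%:R `^ (- (2 + delta IA SD)) : R^o)].
Proof.
have [delta hdelta] := hurwitz_margin (R := R) d.
exists (fun M _ => delta M).
move=> T V K pi A f fh fhh dO Omega P Phi z0 theta0 dS OmegaS PS Psi m Dm Dhatm.
move=> _ mV V1 erg _ mc Phi0 _ fL fz hA hfh hfhh sc.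
move=> Fm Zn Zhatn hDm hDhatm theta SD SZ IA halfIA lyap_theta lyap_sharp.
have [dl01 hd] := hdelta IA; have /andP[dl0 dl1] := dl01.
have hIA : hurwitz IA.
  move=> l /eigenvalue_C_shift /hA; case: l => a b /=; lra.
have [St [Ss [h1 h2 h3 [N [C hNC]]]]] := chain_covariance_expansion theta0 mV V1 erg
  mc Phi0 fL fz dl01 (hd hIA) hfh hfhh sc hDm hDhatm.
split => //; exists St, Ss => /=; split => // i j.
apply/eqO_exP; exists (`|C| + 1); first by rewrite ltr_wpDl.
near=> n.
rewrite -exprVn; apply: (le_trans (nrm_entry _ _ _)).
apply: (@le_trans _ _ (C * n%:R `^ (- (2 + delta IA)))).
  by apply: hNC; near: n; exact: nbhs_infty_ge.
rewrite [X in _ <= _ * X]ger0_norm ?powR_ge0//.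
rewrite ler_wpM2r ?powR_ge0//; apply: (le_trans (ler_norm C)).
by rewrite lerDl.
Unshelve. all: by end_near. Qed.
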